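(* Let $z\mapsto z+N(z)f(z)+\varepsilon G(z,\varepsilon)$ be a $C^r$-smooth fast-slow map on $\mathbb R^n$, $r\ge2$, with critical manifold $S$ satisfying (A1), (A2) of the context, and let $S_{\mathrm{nh}}\subseteq S$ be its normally hyperbolic part. Consider the slow map $$\mathcal G(z,\varepsilon)=z+\varepsilon\,\Pi^{S_{\mathrm{nh}}}_{\mathcal N}G(z,0)+O(\varepsilon^2),\qquad z\in\widetilde S,$$ where $\widetilde S$ is a compact submanifold of $S_{\mathrm{nh}}$, and let $z_0\in S_{\mathrm{nh}}$ (with $z_0 \in \widetilde S$). Then there is an $\varepsilon_0>0$ and an $\varepsilon$-independent neighbourhood $\Omega\ni z_0$ in $S_{\mathrm{nh}}$ such that for all $(z,\varepsilon)\in\Omega\times[0,\varepsilon_0)$ we have $$j^1\mathcal G(z,\varepsilon)=j^1\Phi^1_{\Pi^{S_{\mathrm{nh}}}_{\mathcal N}G(z,0)}(z,\varepsilon),\qquad j^l\mathcal G(z,\varepsilon)=j^l\Phi^1_{\Pi^{S_{\mathrm{nh}}}_{\mathcal N}G(z,0)}(z,\varepsilon)+O(\varepsilon^2),$$ where the latter holds for all $l=2,\dots,r$. Here $\Phi^1_{\Pi^{S_{\mathrm{nh}}}_{\mathcal N}G(z,0)}(z,\varepsilon)$ is the time-$1$ map of the flow of the reduced vector field $z'=\varepsilon\,\Pi^{S_{\mathrm{nh}}}_{\mathcal N}G(z,0)$ on $S_{\mathrm{nh}}$.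
   Context: Fast-slow maps. Let $n\ge2$, $k<n$ be positive integers and $\varepsilon\in[0,\varepsilon_0]$. Consider $z\mapsto z+h(z)+\varepsilon G(z,\varepsilon)$, $z\in\mathbb{R}^n$, with $h$ and $\varepsilon G$ $C^r$-smooth. Assumptions: (A1) the zero set of $h$ contains a $k$-dimensional, connected, regularly embedded submanifold $S\subset\mathbb{R}^n$ (the critical manifold); (A2) $h(z)=N(z)f(z)$ with $N(z)$ an $n\times(n-k)$ matrix of full column rank and $f(z)$ an $(n-k)\times1$ column vector, $S=\{f=0\}$ with $\operatorname{rk}\mathrm{D}f=n-k$ on $S$; points $z_*\notin S$ with $N(z_* )f(z_* )=0$, if any, are isolated. For $z\in S$ the non-trivial multipliers $\mu_1(z),\dots,\mu_{n-k}(z)$ are the eigenvalues of $\mathbb I_{n-k}+\mathrm{D}f(z)N(z)$, and $S_{\mathrm{nh}}=\{z\in S:|\mu_j(z)|\neq1\ \forall j\}$. Projection. $\Pi^{S_{\mathrm{nh}}}_{\mathcal N}=\mathbb I_n-N(\mathrm{D}f\,N)^{-1}\mathrm{D}f\,|_{S_{\mathrm{nh}}}$ is the oblique projection, along the span of the columns of $N(z)$, onto the tangent bundle $\mathrm TS_{\mathrm{nh}}$. Slow map. A compact connected submanifold $\widetilde S\subseteq S_{\mathrm{nh}}$ persists, for $\varepsilon>0$ small, as a locally invariant slow manifold $\widetilde S_\varepsilon$ that is $O(\varepsilon)$-close and diffeomorphic to $\widetilde S$ and $C^r$-smooth in $z$ and $\varepsilon$. The slow map $\mathcal G(z,\varepsilon)$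 is the fast-slow map restricted to $\widetilde S_\varepsilon$, expressed as a $C^r$ map of $z\in\widetilde S$; it is known to have the asymptotic form displayed in the claim. The operator $j^l$ denotes the $l$-jet with respect to $(z,\varepsilon)$ at $(z_0,0)$: truncation of the Taylor expansion (in local coordinates) after the terms of total degree $l$. *)

(* Defs.v *)
From HB Require Import structures.
From mathcomp Require Import all_boot all_order all_algebra.
From mathcomp Require Import all_classical all_reals all_analysis.
From mathcomp Require Import complex.
Set Implicit Arguments.
Unset Strict Implicit.
Unset Printing Implicit Defensive.
Import Order.TTheory GRing.Theory Num.Theory.
Import numFieldNormedType.Exports.
Local Open Scope classical_set_scope.
Local Open Scope ring_scope.

(* V is meant to be finite-dimensional and U open: then C^(r+1) amounts to
   differentiability together with C^r directional derivatives. *)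
Fixpoint Cr (R : realType) (V W : normedModType R) (r : nat) (U : set V)
    (f : V -> W) : Prop :=
  match r with
  | 0 => forall x, U x -> {for x, continuous f}
  | r'.+1 => (forall x, U x -> differentiable f x) /\
             forall v : V, Cr r' U (fun x => 'D_v f x)
  end.

(* Smoothness on an arbitrary subset: existence of local C^r extensions.  This
   covers maps on submanifolds, on manifolds with boundary, and one-sided
   smoothness at e = 0. *)
Definition smooth_on (R : realType) (V W : normedModType R) (r : nat)
    (A : set V) (f : V -> W) : Prop :=
  forall x, A x -> exists U : set V, exists F : V -> W,
    [/\ open U, U x, Cr r U F & forall y, A y -> U y -> F y = f y].

Definition diffeo (R : realType) (V W : normedModType R) (r : nat)
    (A : set V) (B : set W) (f : V -> W) (g : W -> V) : Prop :=
  [/\ smooth_on r A f, smooth_on r B g,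
      forall x, A x -> B (f x) /\ g (f x) = x &
      forall y, B y -> A (g y) /\ f (g y) = y].

Definition half_space (R : realType) (k : nat) : set 'cV[R]_k :=
  [set x | forall i : 'I_k, i = 0%N :> nat -> 0 <= x i 0].

(* M is an embedded submanifold locally modelled on open subsets of D:
   D = setT gives k-dimensional regularly embedded submanifolds,
   D = half_space those with a (possibly empty) boundary. *)
Definition modelled_on (R : realType) (n k r : nat) (D : set 'cV[R]_k)
    (M : set 'cV[R]_n) : Prop :=
  forall z, M z -> exists (W : set 'cV[R]_n) (V : set 'cV[R]_k)
      (chi : 'cV[R]_n -> 'cV[R]_k) (psi : 'cV[R]_k -> 'cV[R]_n),
    [/\ open W, W z, open V & diffeo r (M `&` W) (D `&` V) chi psi].

Definition submanifold (R : realType) (n k r : nat) (M : set 'cV[R]_n) : Prop :=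
  modelled_on r (@setT 'cV[R]_k) M.

Definition submanifold_with_boundary (R : realType) (n k r : nat)
    (M : set 'cV[R]_n) : Prop :=
  modelled_on r (@half_space R k) M.

Definition local_chart (R : realType) (n k r : nat) (M : set 'cV[R]_n)
    (z0 : 'cV[R]_n) (W : set 'cV[R]_n) (V : set 'cV[R]_k)
    (chi : 'cV[R]_n -> 'cV[R]_k) (psi : 'cV[R]_k -> 'cV[R]_n) : Prop :=
  [/\ open W, W z0, open V & diffeo r (M `&` W) V chi psi].

Definition Jac (R : realType) (n m : nat) (f : 'cV[R]_n -> 'cV[R]_m)
    (z : 'cV[R]_n) : 'M[R]_(m, n) :=
  \matrix_(i, j) ('D_(delta_mx j 0) f z) i 0.

Section FastSlow.
Variables (R : realType) (n k : nat).
Variables (N : 'cV[R]_n -> 'M[R]_(n, n - k)) (f : 'cV[R]_n -> 'cV[R]_(n - k)).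
Variables (G : 'cV[R]_n -> R -> 'cV[R]_n).

Definition fast_part (z : 'cV[R]_n) : 'cV[R]_n := N z *m f z.

Definition fsmap (z : 'cV[R]_n) (e : R) : 'cV[R]_n :=
  z + fast_part z + e *: G z e.

(* Only h = N f and (z, e) |-> e G(z, e) are required to be C^r.  Continuity of
   G is what makes G(z, 0) meaningful, and N continuous, f C^1 is what makes
   Dh = N Df on S. *)
Record fast_slow (r : nat) (ebar : R) (S : set 'cV[R]_n) : Prop := {
  fs_h_smooth : Cr r setT fast_part;
  fs_eG_smooth : smooth_on r [set p : 'cV[R]_n * R | 0 <= p.2 <= ebar]
                   (fun p => p.2 *: G p.1 p.2);
  fs_G_cont : {within [set p : 'cV[R]_n * R | 0 <= p.2 <= ebar],
                 continuous (fun p => G p.1 p.2)};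
  fs_N_cont : continuous N;
  fs_f_C1 : Cr 1 setT f;
  fs_S_manifold : submanifold k r S;
  fs_S_connected : connected S;
  fs_S_zero : S `<=` [set z | fast_part z = 0];
  fs_S_eq : S = [set z | f z = 0];
  fs_N_rank : forall z, S z -> \rank (N z) = (n - k)%N;
  fs_Df_rank : forall z, S z -> \rank (Jac f z) = (n - k)%N;
  fs_isolated : let E := [set z | ~ S z /\ fast_part z = 0] in
                E `<=` isolated E
}.

Definition nontrivial_multiplier (z : 'cV[R]_n) (mu : R[i]) : Prop :=
  eigenvalue (map_mx (real_complex R) (1%:M + Jac f z *m N z)) mu.

Definition Snh (S : set 'cV[R]_n) : set 'cV[R]_n :=
  [set z | S z /\ forall mu, nontrivial_multiplier z mu -> `|mu| != 1].

Definition Proj (z : 'cV[R]_n) : 'M[R]_n :=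
  1%:M - N z *m invmx (Jac f z *m N z) *m Jac f z.

Definition reduced_field (z : 'cV[R]_n) : 'cV[R]_n := Proj z *m G z 0.

(* The slow manifold St_e is Psi(-, e) @` St.  Since orbits may leave St_e
   through its boundary, Psi is given on a neighbourhood Snh `&` O of St in Snh,
   i.e. on a slightly larger slow manifold, which contains the image of St_e
   under the fast-slow map. *)
Record slow_manifold (r : nat) (ebar : R) (S St : set 'cV[R]_n) (e1 : R)
    (O : set 'cV[R]_n) (Psi : 'cV[R]_n -> R -> 'cV[R]_n) : Prop := {
  sm_e1 : 0 < e1 <= ebar;
  sm_open : open O;
  sm_sub : St `<=` O;
  sm_smooth : smooth_on r
    [set p : 'cV[R]_n * R | (Snh S `&` O) p.1 /\ 0 <= p.2 < e1]
    (fun p => Psi p.1 p.2);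
  sm_0 : forall z, (Snh S `&` O) z -> Psi z 0 = z;
  sm_close : exists C : R, \forall e \near 0^'+,
    forall z, St z -> `|Psi z e - z| <= C * e;
  sm_diffeo : forall e, 0 <= e < e1 -> exists P : 'cV[R]_n -> 'cV[R]_n,
    diffeo r (Snh S `&` O) ((Psi ^~ e) @` (Snh S `&` O)) (Psi ^~ e) P;
  sm_invariant : forall e, 0 <= e < e1 ->
    (fsmap ^~ e) @` ((Psi ^~ e) @` St) `<=` (Psi ^~ e) @` (Snh S `&` O)
}.

Record slow_map (r : nat) (S St : set 'cV[R]_n) (e1 : R)
    (O : set 'cV[R]_n) (Psi Gs : 'cV[R]_n -> R -> 'cV[R]_n) : Prop := {
  slow_smooth : smooth_on r [set p : 'cV[R]_n * R | St p.1 /\ 0 <= p.2 < e1]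
                  (fun p => Gs p.1 p.2);
  slow_conj : forall z e, St z -> 0 <= e < e1 ->
    (Snh S `&` O) (Gs z e) /\ Psi (Gs z e) e = fsmap (Psi z e) e;
  slow_asymptotics : exists C : R, \forall e \near 0^'+, forall z, St z ->
    `|Gs z e - (z + e *: reduced_field z)| <= C * e ^+ 2
}.

End FastSlow.

Definition integral_curve (R : realType) (n : nat) (M : set 'cV[R]_n)
    (X : 'cV[R]_n -> 'cV[R]_n) (g : R -> 'cV[R]_n) : Prop :=
  [/\ forall t : R, t \in `[0, 1] -> M (g t),
      {within `[0, 1], continuous g} &
      forall t : R, t \in `]0, 1[ -> is_derive t (1 : R) g (X (g t))].

(* Values at time 1 of the integral curves of X in M starting at z. *)
Definition time_one_values (R : realType) (n : nat) (M : set 'cV[R]_n)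
    (X : 'cV[R]_n -> 'cV[R]_n) (z : 'cV[R]_n) : set 'cV[R]_n :=
  [set w | exists g, [/\ integral_curve M X g, g 0 = z & g 1 = w]].

(* Meaningful where time_one_values is a singleton. *)
Definition time_one_map (R : realType) (n : nat) (M : set 'cV[R]_n)
    (X : 'cV[R]_n -> 'cV[R]_n) (z : 'cV[R]_n) : 'cV[R]_n :=
  xget z (time_one_values M X z).

(* Coefficients c a m of x^a e^m; those with |a| + m > l are ignored. *)
Definition jet (R : realType) (k l : nat) : Type :=
  {ffun 'I_k -> 'I_l.+1} -> 'I_l.+1 -> 'cV[R]_k.

Definition jet_eval (R : realType) (k l : nat) (c : jet R k l)
    (p : 'cV[R]_k * R) : 'cV[R]_k :=
  \sum_(a : {ffun 'I_k -> 'I_l.+1})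
    \sum_(m : 'I_l.+1 | (\sum_i a i + m <= l)%N)
      (p.2 ^+ m * \prod_i p.1 i 0 ^+ a i) *: c a m.

(* c is the Taylor expansion of F at a, along D, truncated after the terms of
   total degree l, i.e. F(p) = jet_eval c (p - a) + o(|p - a|^l); for a C^l map
   these are the coefficients D^(a,m) F / (a! m!).  The remainder form is used
   because F may be defined on one side only (e >= 0, boundary points) and
   because the time-one map of e X with X of class C^(r-1) is expandable to
   degree r at e = 0 although it need not be C^r nearby. *)
Definition is_jet (R : realType) (k l : nat) (D : set ('cV[R]_k * R))
    (F : 'cV[R]_k * R -> 'cV[R]_k) (a : 'cV[R]_k * R) (c : jet R k l) : Prop :=
  forall eps : R, 0 < eps -> \forall p \near within D (nbhs a),
    `|F p - jet_eval c (p - a)| <= eps * `|p - a| ^+ l.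

(* j^l at (z0, 0), in the chart (chi, psi) onto V, of F : M x [0, e1) -> R^n. *)
Definition is_local_jet (R : realType) (n k l : nat) (V : set 'cV[R]_k)
    (chi : 'cV[R]_n -> 'cV[R]_k) (psi : 'cV[R]_k -> 'cV[R]_n)
    (M : set 'cV[R]_n) (e1 : R) (F : 'cV[R]_n -> R -> 'cV[R]_n)
    (z0 : 'cV[R]_n) (c : jet R k l) : Prop :=
  is_jet [set p : 'cV[R]_k * R | [/\ V p.1, M (psi p.1) & 0 <= p.2 < e1]]
    (fun p => chi (F (psi p.1) p.2)) (chi z0, 0) c.

(* Main.v *)
(* On the normally hyperbolic part of S the reduced field X is tangent to S; on
   S it is a rational function of Dh and of the e-derivative of e G at e = 0, so
   in a chart it is of class C^(r-1).  The slow map and the time-one map of e X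
   are both of the form F(x, e) with F(x, 0) = x and dF/de = H, where H(x, 0) =
   X(x): for the slow map H is the e-derivative of a smooth extension, for the
   flow it is X composed with the flow.  If H has an expansion of order l at
   (x0, 0), one integration in e yields an expansion of F of order l + 1; in it
   the terms independent of e and linear in e come from x and from the expansion
   of X, hence are the same for both maps, and all the others carry a factor e^2.
   For the flow this is also how the expansion is obtained, one order at a time,
   from Lipschitz dependence on time alone.  Choosing the expansion of X once and
   for all avoids any appeal to uniqueness of jets at boundary points. *)

Require Import Defs.
From HB Require Import structures.
From mathcomp Require Import all_boot all_order all_algebra.
From mathcomp Require Import all_classical all_reals all_analysis.
From mathcomp Require Import complex lra ring.
Set Implicit Arguments.
Unset Strict Implicit.
Unset Printing Implicit Defensive.
Import Order.TTheory GRing.Theory Num.Theory.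
Import numFieldNormedType.Exports.
Local Open Scope classical_set_scope.
Local Open Scope ring_scope.

(** * Calculus of C^r maps in coordinates *)

(** No theorem on smooth dependence of flows on initial data is used: the flow enters only as a
    family of curves, Lipschitz in time uniformly in the starting point. The order-by-order loop
    closes because substituting an expansion of the flow into that of X costs no order, while
    integration in time gains one. The smoothness of the reduced field is hidden: [N] and Df are
    merely continuous, so the field must be rewritten through Dh, which equals N Df on S because f
    vanishes there, and through the e-derivative of e G. The time-one value must be unique among all
    integral curves in Snh, and these live in R^n and may leave the chart. Uniqueness is therefore
    proved in the ambient space, where small e confines every curve to a ball on which the field is
    Lipschitz. The time-one map of e X being the flow of X at time e, a single bound on e serves
    existence, confinement and uniqueness. *)

Section CrCalculus.
Context {R : realType}.
Implicit Types V W : normedModType R.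

Lemma open_near V (U : set V) x : open U -> U x -> \forall y \near x, U y.
Proof. by move=> oU Ux; exact: open_nbhs_nbhs. Qed.

Lemma Cr_sub V W r (U U' : set V) (f : V -> W) :
  U' `<=` U -> Cr r U f -> Cr r U' f.
Proof.
move=> sU; elim: r f => [|r IH] f /=; first by move=> h x /sU; exact: h.
by move=> [df h]; split=> [x /sU|v]; [exact: df|exact: IH].
Qed.

Lemma CrW V W r (U : set V) (f : V -> W) : Cr r.+1 U f -> Cr r U f.
Proof.
elim: r f => [|r IH] f [df h].
  by move=> x Ux; apply: differentiable_continuous; exact: df.
by split => // v; apply: IH.
Qed.

Lemma Cr_le V W r r' (U : set V) (f : V -> W) :
  (r' <= r)%N -> Cr r U f -> Cr r' U f.
Proof.
move=> /subnK <-; elim: (r - r')%N => // d IH.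
by rewrite addSn => /CrW.
Qed.

Lemma near_eq_continuous V W (f g : V -> W) x :
  (\forall y \near x, f y = g y) -> {for x, continuous f} ->
  {for x, continuous g}.
Proof.
move=> fg cf; have fgx : f x = g x by exact: (nbhs_singleton fg).
rewrite /prop_for /continuous_at -fgx.
by apply: cvg_trans cf; exact: near_eq_cvg.
Qed.

(** Differentiability is read off its little-o form, which sees only values near [x]; the
    differential of [f] serves for [g]. *)
Lemma near_eq_differentiable V W (f g : V -> W) x :
  (\forall y \near x, f y = g y) -> differentiable f x -> differentiable g x.
Proof.
move=> fg df; apply/diff_locallyP.
have fgx : f x = g x by exact: (nbhs_singleton fg).
have fg0 : \forall h \near (0 : V), f (h + x) = g (h + x).
  by move: fg; rewrite (near_shift 0) subr0.
have [cd E] : continuous ('d f x) /\ (f \o shift x = cst (f x) + 'd f x +o_ 0 id).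
  exact/diff_locallyP.
suff E' : g \o shift x = cst (g x) + 'd f x +o_ 0 id.
  by have -> : 'd g x = 'd f x :> (V -> W); [exact: diff_unique|].
apply/eqaddoP => _/posnumP[e]; move/eqaddoP: E => /(_ e%:num (gt0 _)) E.
apply: filterS2 fg0 E => h fgh Eh.
rewrite [X in `|X|](_ : _ = (f \o shift x - (cst (f x) + 'd f x)) h) //.
by rewrite /= !fctE /= fgh fgx.
Qed.

(** The rules for ['D_v] hold only at points of [U]; this lets the recursion in [Cr] continue from
    their right-hand sides. Since [U] is open, agreement on [U] is agreement near each of its
    points, which derivatives require. *)
Lemma Cr_ext V W r (U : set V) (f g : V -> W) : open U ->
  (forall x, U x -> f x = g x) -> Cr r U f -> Cr r U g.
Proof.
move=> oU; elim: r f g => [|r IH] f g fg /=.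
  move=> h x Ux; apply: near_eq_continuous (h x Ux).
  by apply: filterS (open_near oU Ux).
move=> [df h]; split => [x Ux|v].
  apply: near_eq_differentiable (df x Ux).
  by apply: filterS (open_near oU Ux).
apply: (IH ('D_v f)) => // x Ux; apply: near_eq_derive.
by apply: filterS (open_near oU Ux).
Qed.

Lemma derive_lin V W W' (L : {linear W -> W'}) (f : V -> W) x v :
  continuous L -> differentiable f x ->
  'D_v (fun y => L (f y)) x = L ('D_v f x).
Proof.
move=> cL df; have dL : differentiable L (f x) by exact: linear_differentiable.
rewrite !deriveE //; last exact: (differentiable_comp df dL).
by rewrite (diff_comp df dL) /= diff_lin.
Qed.

Lemma Cr_lin V W W' r (U : set V) (L : {linear W -> W'}) (f : V -> W) :
  open U -> continuous L -> Cr r U f -> Cr r U (fun x => L (f x)).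
Proof.
move=> oU cL; elim: r f => [|r IH] f /=.
  by move=> h x Ux; apply: continuous_comp; [exact: h|exact: cL].
move=> [df h]; split=> [x Ux|v].
  apply: (differentiable_comp (df x Ux)); exact: linear_differentiable.
apply: (@Cr_ext _ _ _ _ (fun x => L ('D_v f x))) => //; last exact: IH.
by move=> x Ux; rewrite derive_lin //; exact: df.
Qed.

Lemma Cr_cst V W r (U : set V) (a : W) : Cr r U (fun=> a).
Proof.
elim: r a => [|r IH] a /=; first by move=> x Ux; exact: cst_continuous.
split => // v; suff -> : (fun x : V => 'D_v (fun=> a) x) = (fun=> 0) by exact: IH.
by apply/funext => x; rewrite derive_cst.
Qed.

Lemma CrD V W r (U : set V) (f g : V -> W) : open U ->
  Cr r U f -> Cr r U g -> Cr r U (fun x => f x + g x).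
Proof.
move=> oU; elim: r f g => [|r IH] f g /=.
  by move=> hf hg x Ux; apply: continuousD; [exact: hf|exact: hg].
move=> [df hf] [dg hg]; split=> [x Ux|v].
  by apply: differentiableD; [exact: df|exact: dg].
apply: (@Cr_ext _ _ _ _ (fun x => 'D_v f x + 'D_v g x)) => //; last exact: IH.
by move=> x Ux; rewrite deriveD //; apply: diff_derivable; auto.
Qed.

Lemma CrM V r (U : set V) (f g : V -> R) : open U ->
  Cr r U f -> Cr r U g -> Cr r U (fun x => f x * g x).
Proof.
move=> oU; elim: r f g => [|r IH] f g.
  by move=> hf hg x Ux; apply: continuousM; [exact: hf|exact: hg].
move=> hf0 hg0; have [df hf] := hf0; have [dg hg] := hg0.
split=> [x Ux|v].
  by apply: differentiableM; [exact: df|exact: dg].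
apply: (@Cr_ext _ _ _ _ (fun x => f x * 'D_v g x + g x * 'D_v f x)) => //.
  by move=> x Ux; rewrite deriveM //; apply: diff_derivable; [exact: df|exact: dg].
by apply: CrD => //; apply: IH; [exact: CrW|exact: hg|exact: CrW|exact: hf].
Qed.

Lemma CrV V r (U : set V) (f : V -> R) : open U ->
  (forall x, U x -> f x != 0) -> Cr r U f -> Cr r U (fun x => (f x)^-1).
Proof.
move=> oU f0; elim: r => [|r IH].
  by move=> hf x Ux; apply: continuousV; [exact: f0|exact: hf].
move=> hf0; have [df hf] := hf0.
split=> [x Ux|v].
  by apply: differentiableV; [exact: df|exact: f0].
apply: (@Cr_ext _ _ _ _ (fun x => (- 1) * ((f x)^-1 * (f x)^-1) * 'D_v f x)) => //.
  move=> x Ux; rewrite deriveV; [|exact: f0|by apply: diff_derivable; exact: df].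
  by rewrite mulN1r -expr2 exprVn.
(* The derivative of the inverse contains the inverse itself, but one order lower: the induction is
   on the order with [f] fixed. *)
have /IH hi := CrW hf0.
apply: CrM => //; last exact: hf.
by apply: CrM => //; [exact: Cr_cst|apply: CrM].
Qed.

Lemma Cr_sum V r (U : set V) (I : Type) (s : seq I) (P : pred I) (f : I -> V -> R) :
  open U -> (forall i, P i -> Cr r U (f i)) ->
  Cr r U (fun x => \sum_(i <- s | P i) f i x).
Proof.
move=> oU h; elim: s => [|a s IH].
  by under eq_fun do rewrite big_nil; exact: Cr_cst.
under eq_fun do rewrite big_cons.
by case Pa: (P a) => //; apply: CrD => //; exact: h.
Qed.

Lemma Cr_linear V W r (U : set V) (L : {linear V -> W}) : open U ->
  continuous L -> Cr r U L.
Proof.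
move=> oU cL; case: r => [|r] /=; first by move=> x _; exact: cL.
split=> [x _|v]; first exact: linear_differentiable.
suff -> : (fun x => 'D_v L x) = (fun=> L v) by exact: Cr_cst.
by apply/funext => x; rewrite deriveE ?diff_lin //; exact: linear_differentiable.
Qed.

End CrCalculus.

(** One interface for both ['cV[R]_k] and its product with the time axis. The bound [fco_le] yields
    continuity of the coordinates and all estimates on monomials. *)
Record frame (R : realType) (V : normedModType R) := Frame {
  fidx : finType;
  fbas : fidx -> V;
  fco : fidx -> {linear V -> R};
  fco_sum : forall v, v = \sum_i fco i v *: fbas i;
  fco_le : forall i v, `|fco i v| <= `|v| }.
Arguments fbas {R V} f i.
Arguments fco {R V} f i.

Section Frames.
Context {R : realType}.
Implicit Types V W : normedModType R.

Definition ccoord n (i : 'I_n) (v : 'cV[R]_n) : R := v i 0.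

Lemma ccoord_linear n (i : 'I_n) : linear (@ccoord n i : _ -> R^o).
Proof. by move=> a u v; rewrite /ccoord !mxE. Qed.

HB.instance Definition _ n (i : 'I_n) :=
  GRing.isLinear.Build R 'cV[R]_n R^o _ (@ccoord n i) (ccoord_linear i).

(* [None] stands for the time coordinate. *)
Definition pcoord n (j : option 'I_n) (p : 'cV[R]_n * R) : R :=
  if j is Some i then p.1 i 0 else p.2.

Lemma pcoord_linear n (j : option 'I_n) : linear (@pcoord n j : _ -> R^o).
Proof. by case: j => [i|] a u v //=; rewrite !mxE. Qed.

HB.instance Definition _ n (j : option 'I_n) :=
  GRing.isLinear.Build R ('cV[R]_n * R)%type R^o _ (@pcoord n j) (pcoord_linear j).

Lemma cV_sum n (v : 'cV[R]_n) : v = \sum_i ccoord i v *: delta_mx i 0.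
Proof.
apply/matrixP => i j; rewrite ord1 summxE (bigD1 i) //= !mxE !eqxx mulr1.
rewrite big1 ?addr0 // => l li; rewrite !mxE eq_sym (negbTE li) /=.
by rewrite mulr0.
Qed.

Lemma ccoord_le n (i : 'I_n) (v : 'cV[R]_n) : `|ccoord i v| <= `|v|.
Proof.
rewrite /Num.norm /= mx_normrE; apply/bigmax_geP; right.
by exists (i, 0).
Qed.

Definition cV_frame n : frame 'cV[R]_n :=
  @Frame R _ 'I_n (fun i => delta_mx i 0) (fun i => @ccoord n i) (@cV_sum n)
   (@ccoord_le n).

Definition pbas n (j : option 'I_n) : 'cV[R]_n * R :=
  if j is Some i then (delta_mx i 0, 0) else (0, 1).

Lemma big_option n (M : nmodType) (f : option 'I_n -> M) :
  \sum_j f j = f None + \sum_i f (Some i).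
Proof.
rewrite (bigD1 None) //=; congr (_ + _).
rewrite (reindex_omap Some id) /=; last by case.
by apply: eq_bigl => i; rewrite eqxx.
Qed.

Lemma pV_sum n (p : 'cV[R]_n * R) : p = \sum_j pcoord j p *: pbas j.
Proof.
rewrite big_option /=; case: p => v e /=.
have -> : \sum_i pcoord (Some i) (v, e) *: pbas (Some i) = (v, 0).
  rewrite {2}(cV_sum v); apply: (big_ind2 (fun (x : 'cV[R]_n * R) y => x = (y, 0))) => //.
    by move=> _ x2 _ y2 -> ->; congr pair; rewrite /= addr0.
  by move=> i _; congr pair; rewrite /= scaler0.
by congr pair; rewrite /= ?scaler0 ?add0r // [_ *: _]mulr1 addr0.
Qed.

Lemma pcoord_le n (j : option 'I_n) (p : 'cV[R]_n * R) : `|pcoord j p| <= `|p|.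
Proof.
rewrite /Num.norm /= le_max; case: j => [i|] /=; last by rewrite lexx orbT.
by rewrite (ccoord_le i p.1).
Qed.

Definition pV_frame n : frame ('cV[R]_n * R)%type :=
  @Frame R _ (option 'I_n) (@pbas n) (fun i => @pcoord n i) (@pV_sum n)
   (@pcoord_le n).

Lemma fco_continuous V (F : frame V) i : continuous (fco F i).
Proof.
apply: bounded_linear_continuous; apply/linear_boundedP; exists 1.
by split => // M M1 x; rewrite (le_trans (fco_le _ _)) // ler_peMl // ltW.
Qed.

Lemma frame_differentiable V W (F : frame W) (g : V -> W) x :
  (forall i, differentiable (fun y => fco F i (g y)) x) -> differentiable g x.
Proof.
move=> h; have -> : g = \sum_i (fun y => fco F i (g y) *: fbas F i).
  by apply/funext => y; rewrite fct_sumE {1}(fco_sum F (g y)).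
elim/big_ind : _ => [|g1 g2 h1 h2|i _]; first exact: differentiable_cst.
  exact: differentiableD.
exact: differentiableZl.
Qed.

Lemma frame_continuous V W (F : frame W) (g : V -> W) x :
  (forall i, {for x, continuous (fun y => fco F i (g y))}) ->
  {for x, continuous g}.
Proof.
move=> h; have -> : g = \sum_i (fun y => fco F i (g y) *: fbas F i).
  by apply/funext => y; rewrite fct_sumE {1}(fco_sum F (g y)).
elim/big_ind : _ => [|g1 g2 h1 h2|i _]; first exact: cst_continuous.
  exact: continuousD.
by apply: cvgZr_tmp; exact: h.
Qed.

Lemma derive_frame V (F : frame V) (f : V -> R) x v : differentiable f x ->
  'D_v f x = \sum_i fco F i v * 'D_(fbas F i) f x.
Proof.
move=> df; rewrite deriveE // {1}(fco_sum F v) linear_sum /=.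
by apply: eq_bigr => i _; rewrite linearZ /= deriveE.
Qed.

Lemma derive_comp V W (F : frame W) (f : W -> R) (g : V -> W) x v :
  differentiable f (g x) -> (forall i, differentiable (fun y => fco F i (g y)) x) ->
  'D_v (fun y => f (g y)) x =
    \sum_i 'D_v (fun y => fco F i (g y)) x * 'D_(fbas F i) f (g x).
Proof.
move=> df dgi; have dg : differentiable g x by exact: (frame_differentiable dgi).
rewrite deriveE; last exact: (differentiable_comp dg df).
rewrite (diff_comp dg df) /= -deriveE // -deriveE // (derive_frame F) //.
apply: eq_bigr => i _; rewrite derive_lin //; exact: fco_continuous.
Qed.

(** The outer map is scalar, so that the chain rule is a sum of products of real functions:
    derivatives of the coordinates of [g], and partial derivatives of [f] after [g], to which the
    induction applies. *)
Lemma Cr_comp V W (F : frame W) r (U : set V) (U' : set W) (f : W -> R) (g : V -> W) :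
  open U -> (forall x, U x -> U' (g x)) ->
  (forall i, Cr r U (fun y => fco F i (g y))) -> Cr r U' f ->
  Cr r U (fun x => f (g x)).
Proof.
move=> oU gU; elim: r f => [|r IH] f hg hf.
  move=> x Ux; apply: continuous_comp; last exact: hf (gU _ Ux).
  by apply: (frame_continuous (F := F)) => i; exact: hg.
have [df hf'] := hf.
have dg i x : U x -> differentiable (fun y => fco F i (g y)) x.
  by case: (hg i) => + _; apply.
split=> [x Ux|v].
  apply: (differentiable_comp (frame_differentiable _)); last exact: df (gU _ Ux).
  by move=> i; exact: dg.
apply: (@Cr_ext _ _ _ _ _ (fun x => \sum_i 'D_v (fun y => fco F i (g y)) x *
   'D_(fbas F i) f (g x))) => //.
  by move=> x Ux; rewrite (derive_comp (F := F)) //; [exact: df (gU _ Ux)|move=> i; exact: dg].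
apply: Cr_sum => // i _; apply: CrM => //.
  by case: (hg i) => _; apply.
by apply: (IH ('D_(fbas F i) f)) => [j|]; [exact: CrW|exact: hf'].
Qed.

End Frames.

Section MeanValue.
Context {R : realType}.

(** The derivative is asked for inside the interval only, which suits curves given on a closed
    interval. *)
Lemma MVT_le (f df : R -> R) (a b C : R) : a <= b ->
  (forall t, a < t < b -> is_derive t 1 f (df t)) ->
  {within `[a, b], continuous f} ->
  (forall t, a < t < b -> `|df t| <= C) -> `|f b - f a| <= C * (b - a).
Proof.
rewrite le_eqVlt => /predU1P[-> _ _ _|ab hd cf hC].
  by rewrite !subrr normr0 mulr0.
have hd' t : t \in `]a, b[ -> is_derive t 1 f (df t) by rewrite in_itv; exact: hd.
have [c cab ->] := MVT ab hd' cf.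
rewrite normrM [`|b - a|]gtr0_norm ?subr_gt0 // ler_wpM2r //.
  by rewrite subr_ge0 ltW.
by apply: hC; move: cab; rewrite in_itv.
Qed.

Lemma is_derive_line (V : normedModType R) (f : V -> R) (a v : V) (t : R) :
  differentiable f (a + t *: v) ->
  is_derive t 1 (fun s : R => f (a + s *: v)) ('D_v f (a + t *: v)).
Proof.
pose l := cst a + *:%R^~ v : R -> V => df.
have dl : differentiable l t by apply: differentiableD => //; exact: differentiableZl.
have dc : differentiable (f \o l) t := differentiable_comp dl df.
apply: DeriveDef; first exact: diff_derivable.
rewrite [LHS](_ : _ = 'D_1 (f \o l) t) // deriveE // (diff_comp dl df) /= deriveE //.
congr ('d f _ _); rewrite -deriveE // deriveD; last 2 first.
- exact: derivable_cst.
- by apply: diff_derivable; exact: differentiableZl.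
by rewrite derive_cst add0r deriveE // diff_val scale1r.
Qed.

End MeanValue.

(** * Germs of C^r functions *)

Section Germs.
Context {R : realType}.
Implicit Types V W : normedModType R.

Definition CrAt V W r (x : V) (f : V -> W) :=
  exists U : set V, [/\ open U, U x & Cr r U f].

Lemma near_forall V (x : V) (J : finType) (P : J -> set V) :
  (forall j, \forall y \near x, P j y) -> \forall y \near x, forall j, P j y.
Proof. exact: filter_forall. Qed.

Lemma near_all V (x : V) (P : set V) : (forall y, P y) -> \forall y \near x, P y.
Proof. exact: nearW. Qed.

Lemma near_open V (x : V) (P : set V) :
  (\forall y \near x, P y) -> exists U, [/\ open U, U x & U `<=` P].
Proof. by move=> h; have : nbhs x P := h; rewrite nbhsE => -[U [oU Ux] s]; exists U. Qed.

Lemma CrAt_near_eq V W r (x : V) (f g : V -> W) :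
  (\forall y \near x, f y = g y) -> CrAt r x f -> CrAt r x g.
Proof.
move=> /near_open[U' [oU' U'x fg]] [U [oU Ux h]].
exists (U `&` U'); split => //; first exact: openI.
apply: (@Cr_ext _ _ _ _ _ f); first exact: openI.
  by move=> y [_ /fg].
by apply: Cr_sub h => y [].
Qed.

Lemma CrAt_le V W r r' (x : V) (f : V -> W) :
  (r' <= r)%N -> CrAt r x f -> CrAt r' x f.
Proof. by move=> rr [U [? ? h]]; exists U; split => //; exact: Cr_le h. Qed.

Lemma CrAt_near V W r (x : V) (f : V -> W) :
  CrAt r x f -> \forall y \near x, CrAt r y f.
Proof.
move=> [U [oU Ux h]]; apply: filterS (open_near oU Ux) => y Uy.
by exists U.
Qed.

Lemma CrAt_derive V W r (x v : V) (f : V -> W) :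
  CrAt r.+1 x f -> CrAt r x ('D_v f).
Proof. by move=> [U [? ? [_ h]]]; exists U; split => //; exact: h. Qed.

Lemma CrAt_continuous V W r (x : V) (f : V -> W) :
  CrAt r x f -> {for x, continuous f}.
Proof. by move=> /(@CrAt_le _ _ _ 0%N _ _ isT) [U [_ Ux]]; apply. Qed.

Lemma CrAt_differentiable V W r (x : V) (f : V -> W) :
  CrAt r.+1 x f -> differentiable f x.
Proof. by move=> [U [_ Ux []]] + _; apply. Qed.

Lemma CrAt_cst V W r (x : V) (a : W) : CrAt r x (fun=> a).
Proof. by exists setT; split => //; [exact: openT|exact: Cr_cst]. Qed.

Lemma CrAt_linear V W r (x : V) (L : {linear V -> W}) :
  continuous L -> CrAt r x L.
Proof.
by exists setT; split => //; [exact: openT|apply: Cr_linear => //; exact: openT].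
Qed.

Lemma CrAt_lin V W W' r (x : V) (L : {linear W -> W'}) (f : V -> W) :
  continuous L -> CrAt r x f -> CrAt r x (fun y => L (f y)).
Proof. by move=> cL [U [oU Ux h]]; exists U; split => //; exact: Cr_lin. Qed.

Lemma CrAtD V W r (x : V) (f g : V -> W) :
  CrAt r x f -> CrAt r x g -> CrAt r x (fun y => f y + g y).
Proof.
move=> [U [oU Ux h]] [U' [oU' U'x h']]; exists (U `&` U'); split => //.
  exact: openI.
by apply: CrD; [exact: openI|apply: Cr_sub h => ? []|apply: Cr_sub h' => ? []].
Qed.

Lemma CrAtM V r (x : V) (f g : V -> R) :
  CrAt r x f -> CrAt r x g -> CrAt r x (fun y => f y * g y).
Proof.
move=> [U [oU Ux h]] [U' [oU' U'x h']]; exists (U `&` U'); split => //.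
  exact: openI.
by apply: CrM; [exact: openI|apply: Cr_sub h => ? []|apply: Cr_sub h' => ? []].
Qed.

Lemma CrAtB V r (x : V) (f g : V -> R) :
  CrAt r x f -> CrAt r x g -> CrAt r x (fun y => f y - g y).
Proof.
move=> hf hg; apply: CrAtD => //.
under eq_fun do rewrite -mulN1r.
by apply: CrAtM => //; exact: CrAt_cst.
Qed.

Lemma CrAt_sum V r (x : V) (I : Type) (s : seq I) (P : pred I) (f : I -> V -> R) :
  (forall i, P i -> CrAt r x (f i)) ->
  CrAt r x (fun y => \sum_(i <- s | P i) f i y).
Proof.
move=> h; elim: s => [|a s IH].
  by under eq_fun do rewrite big_nil; exact: CrAt_cst.
under eq_fun do rewrite big_cons.
by case Pa : (P a) => //; apply: CrAtD => //; exact: h.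
Qed.

Lemma CrAt_prod V r (x : V) (I : Type) (s : seq I) (P : pred I) (f : I -> V -> R) :
  (forall i, P i -> CrAt r x (f i)) ->
  CrAt r x (fun y => \prod_(i <- s | P i) f i y).
Proof.
move=> h; elim: s => [|a s IH].
  by under eq_fun do rewrite big_nil; exact: CrAt_cst.
under eq_fun do rewrite big_cons.
by case Pa : (P a) => //; apply: CrAtM => //; exact: h.
Qed.

Lemma CrAtV V r (x : V) (f : V -> R) :
  f x != 0 -> CrAt r x f -> CrAt r x (fun y => (f y)^-1).
Proof.
move=> fx0 hf; have cf := CrAt_continuous hf; move: hf => [U [oU Ux h]].
have : \forall y \near x, f y != 0 by exact: (cvgr_neq0 _ cf).
move=> /near_open[U' [oU' U'x f0]].
exists (U `&` U'); split => //; first exact: openI.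
by apply: CrV; [exact: openI|move=> y [_ /f0]|apply: Cr_sub h => ? []].
Qed.

Lemma near_comp V W (f : V -> W) x (P : set W) :
  {for x, continuous f} -> (\forall y \near f x, P y) -> \forall y \near x, P (f y).
Proof. by move=> cf hP; exact: cf hP. Qed.

Lemma CrAt_comp V W (F : frame W) r (x : V) (f : W -> R) (g : V -> W) :
  (forall i, CrAt r x (fun y => fco F i (g y))) -> CrAt r (g x) f ->
  CrAt r x (fun y => f (g y)).
Proof.
move=> hg [U' [oU' U'gx hf]].
have cg : {for x, continuous g}.
  by apply: (frame_continuous (F := F)) => i; exact: CrAt_continuous (hg i).
have [U hU] := choice hg.
have : \forall y \near x, U' (g y) /\ forall i, U i y.
  apply: filterI; first exact: (near_comp cg (open_near oU' U'gx)).
  by apply: filter_forall => i; have [oU Ux _] := hU i; exact: open_near.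
move=> /near_open[U0 [oU0 U0x sU0]].
exists U0; split => //; apply: (Cr_comp (F := F) (U' := U')) => //.
  by move=> y /sU0 [].
move=> i; have [_ _] := hU i; apply: Cr_sub => y /sU0 [_]; exact.
Qed.

(** The partial derivatives are continuous, hence bounded near [x]; balls are convex, and the mean
    value theorem along a segment gives the constant, a sum over coordinates since [fco_le] bounds
    each coordinate of the direction. *)
Lemma CrAt1_lipschitz V (F : frame V) (x : V) (f : V -> R) : CrAt 1 x f ->
  exists rho L : R, [/\ 0 < rho, 0 <= L &
    forall y y', ball x rho y -> ball x rho y' -> `|f y - f y'| <= L * `|y - y'|].
Proof.
move=> [U [oU Ux [df hf]]].
have bd i : \forall y \near x, `|'D_(fbas F i) f y| <= `|'D_(fbas F i) f x| + 1.
  have /cvgr_norm_le := hf (fbas F i) x Ux.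
  by apply; rewrite ltrDl.
have /nbhs_ballP[rho /= rho0 hrho] : \forall y \near x, U y /\
    forall i, `|'D_(fbas F i) f y| <= `|'D_(fbas F i) f x| + 1.
  by apply: filterI; [exact: open_near|apply: filter_forall].
exists rho, (\sum_i (`|'D_(fbas F i) f x| + 1)); split => //.
  by apply: sumr_ge0 => i _; rewrite addr_ge0.
move=> y y' hy hy'.
pose g (t : R) := f (y' + t *: (y - y')).
have seg (t : R) : 0 <= t <= 1 -> ball x rho (y' + t *: (y - y')).
  move=> /andP[t0 t1]; move: hy hy'; rewrite -ball_normE /= => hy hy'.
  have -> : x - (y' + t *: (y - y')) = t *: (x - y) + (1 - t) *: (x - y').
    rewrite scalerBl scale1r addrCA -scalerBr opprD addrA -scalerN opprB.
    by congr (_ + _ *: _); rewrite opprB [RHS]addrC addrA subrK.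
  rewrite (le_lt_trans (ler_normD _ _)) // !normrZ (ger0_norm t0) ger0_norm ?subr_ge0 //.
  (* The strict inequality is taken from the first summand, so [t = 0] is settled apart, by the
     second one. *)
  have [->|t0'] := eqVneq t 0; first by rewrite mul0r add0r subr0 mul1r.
  have : t * `|x - y| < t * rho by rewrite ltr_pM2l // lt_neqAle eq_sym t0'.
  have : (1 - t) * `|x - y'| <= (1 - t) * rho by rewrite ler_wpM2l ?subr_ge0 // ltW.
  lra.
have -> : f y = g 1 by rewrite /g scale1r addrC subrK.
have -> : f y' = g 0 by rewrite /g scale0r addr0.
have dg (t : R) : 0 <= t <= 1 -> is_derive t 1 g ('D_(y - y') f (y' + t *: (y - y'))).
  by move=> /seg/hrho [Ut _]; apply: is_derive_line; exact: df.
set C := \sum_i _; suff : `|g 1 - g 0| <= C * `|y - y'| * (1 - 0) by rewrite subr0 mulr1.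
apply: (MVT_le (df := fun t => 'D_(y - y') f (y' + t *: (y - y')))) => //.
- by move=> t /andP[t0 t1]; apply: dg; rewrite !ltW.
- apply: derivable_within_continuous => t; rewrite in_itv /= => /dg [+ _]; exact.
move=> t /andP[t0 t1]; have /seg/hrho [Ut hd] : 0 <= t <= 1 by rewrite !ltW.
rewrite (derive_frame F); last exact: df.
rewrite (le_trans (ler_norm_sum _ _ _)) // mulr_suml ler_sum // => i _.
by rewrite normrM mulrC ler_pM // fco_le.
Qed.

Lemma CrAt_fco V (F : frame V) r (x : V) i : CrAt r x (fun y => fco F i y).
Proof. by apply: CrAt_linear; exact: fco_continuous. Qed.

Definition mxAt V r m n (x : V) (M : V -> 'M[R]_(m, n)) :=
  forall i j, CrAt r x (fun y => M y i j).

Lemma mxAt_cst V r m n (x : V) (M : 'M[R]_(m, n)) : mxAt r x (fun=> M).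
Proof. by move=> i j; exact: CrAt_cst. Qed.

Lemma mxAtM V r m n p (x : V) (M : V -> 'M[R]_(m, n)) (N : V -> 'M[R]_(n, p)) :
  mxAt r x M -> mxAt r x N -> mxAt r x (fun y => M y *m N y).
Proof.
move=> hM hN i j; under eq_fun do rewrite mxE.
by apply: CrAt_sum => l _; exact: CrAtM.
Qed.

Lemma mxAtB V r m n (x : V) (M N : V -> 'M[R]_(m, n)) :
  mxAt r x M -> mxAt r x N -> mxAt r x (fun y => M y - N y).
Proof.
by move=> hM hN i j; under eq_fun do rewrite !mxE; exact: CrAtB.
Qed.

Lemma CrAt_det V r n (x : V) (M : V -> 'M[R]_n) :
  mxAt r x M -> CrAt r x (fun y => \det (M y)).
Proof.
move=> hM; apply: CrAt_sum => s _; apply: CrAtM; first exact: CrAt_cst.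
by apply: CrAt_prod => i _; exact: hM.
Qed.

(** Cramer's rule, valid where the determinant is nonzero, hence near [x]. *)
Lemma mxAtV V r n (x : V) (M : V -> 'M[R]_n) :
  M x \in unitmx -> mxAt r x M -> mxAt r x (fun y => invmx (M y)).
Proof.
move=> uM hM i j; have hd := CrAt_det hM.
have d0 : \det (M x) != 0 by move: uM; rewrite unitmxE unitfE.
apply: (@CrAt_near_eq _ _ _ _ (fun y => (\det (M y))^-1 * cofactor (M y) j i)).
  have : \forall y \near x, \det (M y) != 0.
    by apply: (cvgr_neq0 _ (CrAt_continuous hd)).
  by apply: filterS => y dy; rewrite /invmx unitmxE unitfE dy !mxE.
apply: CrAtM; first exact: CrAtV.
apply: CrAtM; first exact: CrAt_cst.
apply: CrAt_det => a b; under eq_fun do rewrite !mxE; exact: hM.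
Qed.

End Germs.

(** * Polynomial expansions *)

Section Expansions.
Context {R : realType}.
Implicit Types V W : normedModType R.

Definition mdeg (I : finType) (a : {ffun I -> nat}) : nat := (\sum_i a i)%N.

Definition mone (I : finType) (i : I) : {ffun I -> nat} := [ffun j => (j == i) : nat].

Definition madd (I : finType) (a b : {ffun I -> nat}) : {ffun I -> nat} :=
  [ffun j => a j + b j]%N.

Lemma mdeg_add (I : finType) (a b : {ffun I -> nat}) :
  mdeg (madd a b) = (mdeg a + mdeg b)%N.
Proof. by rewrite /mdeg -big_split; apply: eq_bigr => i _; rewrite ffunE. Qed.

Lemma mdeg_one (I : finType) (i : I) : mdeg (mone i) = 1%N.
Proof.
rewrite /mdeg (bigD1 i) //= ffunE eqxx big1 // => j ji.
by rewrite ffunE (negbTE ji).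
Qed.

Section OneFrame.
Variables (V : normedModType R) (F : frame V).
Local Notation I := (fidx F).

Definition mono (a : {ffun I -> nat}) (v : V) : R := \prod_i fco F i v ^+ a i.

(** Lists may repeat monomials and have no normal form: polynomials are only evaluated, added,
    multiplied, filtered by exponent and integrated term by term. *)
Definition peval (s : seq (R * {ffun I -> nat})) (v : V) : R :=
  \sum_(t <- s) t.1 * mono t.2 v.

(** The degree of [s] is not bounded by [l], so sums and products of expansions go without
    truncation; [expands_trunc] performs it when a jet is finally formed. *)
Definition expands (l : nat) (D : set V) (a : V) (f : V -> R)
    (s : seq (R * {ffun I -> nat})) : Prop :=
  forall eps : R, 0 < eps ->
    \forall p \near a, D p -> `|f p - peval s (p - a)| <= eps * `|p - a| ^+ l.

Lemma mono_add a b v : mono (madd a b) v = mono a v * mono b v.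
Proof.
by rewrite /mono -big_split; apply: eq_bigr => i _; rewrite ffunE exprD.
Qed.

Lemma mono_one i v : mono (mone i) v = fco F i v.
Proof.
rewrite /mono (bigD1 i) //= ffunE eqxx big1 ?mulr1 // => j ji.
by rewrite ffunE (negbTE ji).
Qed.

Lemma mono_zero v : mono [ffun=> 0%N] v = 1.
Proof. by rewrite /mono big1 // => i _; rewrite ffunE. Qed.

Lemma mono_scale a (t : R) v : mono a (t *: v) = t ^+ mdeg a * mono a v.
Proof.
rewrite /mono /mdeg -prodrXr -big_split; apply: eq_bigr => i _ /=.
by rewrite linearZ /= exprMn.
Qed.

Lemma mono_le a v : `|mono a v| <= `|v| ^+ mdeg a.
Proof.
rewrite /mono /mdeg -prodrXr normr_prod; apply: ler_prod => i _.
by rewrite normr_ge0 normrX lerXn2r ?nnegrE // fco_le.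
Qed.

Lemma peval_cat s s' v : peval (s ++ s') v = peval s v + peval s' v.
Proof. by rewrite /peval big_cat. Qed.

Lemma peval_nil v : peval [::] v = 0.
Proof. by rewrite /peval big_nil. Qed.

Lemma peval_cons t s v : peval (t :: s) v = t.1 * mono t.2 v + peval s v.
Proof. by rewrite /peval big_cons. Qed.

Definition pmul (s s' : seq (R * {ffun I -> nat})) :=
  [seq (t.1 * t'.1, madd t.2 t'.2) | t <- s, t' <- s'].

Lemma peval_mul s s' v : peval (pmul s s') v = peval s v * peval s' v.
Proof.
rewrite /peval big_allpairs_dep mulr_suml; apply: eq_bigr => t _.
by rewrite mulr_sumr; apply: eq_bigr => t' _; rewrite mono_add /= mulrACA.
Qed.

Lemma peval_bounded s : exists2 B : R, 0 <= B & forall v, `|v| <= 1 -> `|peval s v| <= B.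
Proof.
exists (\sum_(t <- s) `|t.1|); first by apply: sumr_ge0.
move=> v v1; rewrite (le_trans (ler_norm_sum _ _ _)) // ler_sum // => t _.
by rewrite normrM ler_piMr // (le_trans (mono_le _ _)) // exprn_ile1.
Qed.

Lemma near_ball1 (a : V) : \forall p \near a, `|p - a| <= 1.
Proof.
have := nbhsx_ballx a 1 ltr01.
by apply: filterS => p; rewrite -ball_normE /= distrC => /ltW.
Qed.

Lemma expands_le l l' D a f s : (l' <= l)%N -> expands l D a f s -> expands l' D a f s.
Proof.
move=> ll h eps eps0; apply: filterS2 (near_ball1 a) (h _ eps0) => p p1 + Dp.
move=> /(_ Dp) /le_trans; apply; rewrite ler_pM2l //.
exact: ler_wiXn2l.
Qed.

Lemma expands_near l (D D' : set V) a f g s :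
  (\forall p \near a, D' p -> D p /\ f p = g p) ->
  expands l D a f s -> expands l D' a g s.
Proof.
move=> DD h eps eps0; apply: filterS2 DD (h _ eps0) => p + + D'p.
by move=> /(_ D'p)[Dp <-]; exact.
Qed.

(** Two expansions of the same [g] differ by o(|p - a|^l), so one may replace the other inside an
    expansion of [f] even if they are different polynomials. The list [s'] is constrained by its
    values only, which leaves its form free. *)
Lemma expands_change l D a f g s s0 s1 : expands l D a f s ->
  expands l D a g s0 -> expands l D a g s1 ->
  forall s', (forall v, peval s' v = peval s v - peval s0 v + peval s1 v) ->
  expands l D a f s'.
Proof.
move=> h h0 h1 s' E eps eps0.
have e3 : 0 < eps / 3 by lra.
apply: filterS3 (h _ e3) (h0 _ e3) (h1 _ e3) => p H H0 H1 Dp.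
move: (H Dp) (H0 Dp) (H1 Dp) => {}H {}H0 {}H1; rewrite E.
set x := `|p - a| ^+ l in H H0 H1 *.
move: H H0 H1; rewrite !ler_norml => /andP[? ?] /andP[? ?] /andP[? ?].
apply/andP; split; lra.
Qed.

Lemma expands_cst l D a c : expands l D a (fun=> c) [:: (c, [ffun=> 0%N])].
Proof.
move=> eps eps0; apply: nearW => p _.
rewrite peval_cons peval_nil mono_zero mulr1 addr0 subrr normr0.
by rewrite mulr_ge0 // ltW.
Qed.

Lemma expands_coord l D a i : expands l D a (fun p => fco F i (p - a)) [:: (1, mone i)].
Proof.
move=> eps eps0; apply: nearW => p _.
rewrite peval_cons peval_nil mono_one mul1r addr0 subrr normr0.
by rewrite mulr_ge0 // ltW.
Qed.

Lemma expandsD l D a f g s s' : expands l D a f s -> expands l D a g s' ->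
  expands l D a (fun p => f p + g p) (s ++ s').
Proof.
move=> h h' eps eps0; have e2 : 0 < eps / 2 by lra.
apply: filterS2 (h _ e2) (h' _ e2) => p H H' Dp.
move: (H Dp) (H' Dp) => {}H {}H'; rewrite peval_cat.
set x := `|p - a| ^+ l in H H' *.
move: H H'; rewrite !ler_norml => /andP[? ?] /andP[? ?].
apply/andP; split; lra.
Qed.

Lemma expands_near_bounded l D a f s : expands l D a f s ->
  exists2 B : R, 0 <= B & \forall p \near a, D p -> `|f p| <= B.
Proof.
move=> h; have [B B0 hB] := peval_bounded s; exists (B + 1); first lra.
apply: filterS2 (h _ ltr01) (near_ball1 a) => p H p1 Dp.
rewrite -[f p](subrK (peval s (p - a))) addrC.
rewrite (le_trans (ler_normD _ _)) // lerD ?hB // (le_trans (H Dp)) //.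
by rewrite mul1r exprn_ile1.
Qed.

Lemma expandsM l D a f g s s' : expands l D a f s -> expands l D a g s' ->
  expands l D a (fun p => f p * g p) (pmul s s').
Proof.
move=> h h' eps eps0.
have [B B0 hB] := expands_near_bounded h; have [B' B'0 hB'] := peval_bounded s'.
(* [B] bounds [f] near [a] and [B'] bounds the second polynomial on the unit ball; they are the
   factors by which the remainders of [g] and of [f] get multiplied. *)
have C0 : 0 < B + B' + 1 by lra.
have e2 : 0 < eps / (B + B' + 1) by rewrite divr_gt0.
near=> p => Dp; rewrite peval_mul.
have p1 : `|p - a| <= 1 by near: p; exact: near_ball1.
have H : `|f p - peval s (p - a)| <= eps / (B + B' + 1) * `|p - a| ^+ l.
  by move: Dp; near: p; exact: h.
have H' : `|g p - peval s' (p - a)| <= eps / (B + B' + 1) * `|p - a| ^+ l.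
  by move: Dp; near: p; exact: h'.
have Hf : `|f p| <= B by move: Dp; near: p.
have Hg := hB' _ p1.
have -> : f p * g p - peval s (p - a) * peval s' (p - a) =
  f p * (g p - peval s' (p - a)) + (f p - peval s (p - a)) * peval s' (p - a) by ring.
rewrite (le_trans (ler_normD _ _)) // !normrM.
apply: (@le_trans _ _ (B * (eps / (B + B' + 1) * `|p - a| ^+ l) +
  (eps / (B + B' + 1) * `|p - a| ^+ l) * B')).
  by rewrite lerD // ler_pM.
have x0 : 0 <= `|p - a| ^+ l by exact: exprn_ge0.
have -> : B * (eps / (B + B' + 1) * `|p - a| ^+ l) + eps / (B + B' + 1) * `|p - a| ^+ l * B'
  = (B + B') / (B + B' + 1) * (eps * `|p - a| ^+ l) by ring.
rewrite ler_piMl ?mulr_ge0 ?(ltW eps0) // ler_pdivrMr // mul1r; lra.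
Unshelve. all: by end_near. Qed.

Lemma expandsZ l D a f s c : expands l D a f s ->
  exists s', expands l D a (fun p => c * f p) s'.
Proof.
move=> h; exists (pmul [:: (c, [ffun=> 0%N])] s).
exact: expandsM (expands_cst _ _ _ _) h.
Qed.

Lemma expands_prod l D a (J : Type) (r : seq J) (f : J -> V -> R) :
  (forall j, exists s, expands l D a (f j) s) ->
  exists s, expands l D a (fun p => \prod_(j <- r) f j p) s.
Proof.
move=> h; elim: r => [|j r [s' hs']].
  by exists [:: (1, [ffun=> 0%N])]; under eq_fun do rewrite big_nil; exact: expands_cst.
have [s hs] := h j; exists (pmul s s'); under eq_fun do rewrite big_cons.
exact: expandsM.
Qed.

Lemma expands_exp l D a f n : (exists s, expands l D a f s) ->
  exists s, expands l D a (fun p => f p ^+ n) s.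
Proof.
move=> h; have [s hs] := @expands_prod l D a _ (iota 0 n) (fun=> f) (fun=> h).
exists s; move: hs; congr expands; apply/funext => p.
by rewrite big_const_seq count_predT size_iota iter_mulr_1.
Qed.

(** A term of degree above [l] is O(|p - a|^(l+1)), which falls below any positive multiple of |p -
    a|^l close to [a]. *)
Lemma expands_trunc l D a f s : expands l D a f s ->
  expands l D a f [seq t <- s | (mdeg t.2 <= l)%N].
Proof.
move=> h eps eps0; have e2 : 0 < eps / 2 by lra.
pose B := \sum_(t <- s) `|t.1|.
have B0 : 0 <= B by exact: sumr_ge0.
have e3 : 0 < eps / 2 / (B + 1) by rewrite divr_gt0 //; lra.
near=> p => Dp.
have H : `|f p - peval s (p - a)| <= eps / 2 * `|p - a| ^+ l.
  by move: Dp; near: p; exact: h.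
have p1 : `|p - a| <= 1 by near: p; exact: near_ball1.
have pe : `|p - a| <= eps / 2 / (B + 1).
  near: p; have := nbhsx_ballx a _ e3.
  by apply: filterS => p; rewrite -ball_normE /= distrC => /ltW.
have H2 : `|peval s (p - a) - peval [seq t <- s | (mdeg t.2 <= l)%N] (p - a)|
   <= eps / 2 * `|p - a| ^+ l.
  rewrite /peval big_filter (bigID (fun t => (mdeg t.2 <= l)%N)) /= addrC addrK.
  rewrite (le_trans (ler_norm_sum _ _ _)) //.
  apply: (@le_trans _ _ (\sum_(t <- s) `|t.1| * `|p - a| ^+ l.+1)).
    rewrite [leRHS](bigID (fun t => (mdeg t.2 <= l)%N)) /= ler_wpDl //.
      by apply: sumr_ge0 => t _; rewrite mulr_ge0 // exprn_ge0.
    apply: ler_sum => t; rewrite -ltnNge => tl.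
    rewrite normrM ler_wpM2l // (le_trans (mono_le _ _)) //; exact: ler_wiXn2l.
  rewrite -mulr_suml exprS mulrA ler_wpM2r ?exprn_ge0 //.
  apply: (@le_trans _ _ ((B + 1) * (eps / 2 / (B + 1)))).
    by apply: ler_pM => //; rewrite -/B; lra.
  rewrite mulrC divfK //; lra.
rewrite -[f p](subrK (peval s (p - a))) -addrA (le_trans (ler_normD _ _)) //.
by rewrite [eps](splitr) mulrDl lerD.
Unshelve. all: by end_near. Qed.

End OneFrame.

(** Substitution into the polynomial [T] uses only sums and products of expansions. The remainder of
    [f] is o(|g p - b|^l), and the linear bound on g p - b turns it into o(|p - a|^l). *)
Lemma expands_comp V (F : frame V) W (E : frame W) l (D : set V) (D' : set W)
    (a : V) (b : W) (f : W -> R) (g : V -> W) T (C : R) :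
  expands (F := E) l D' b f T ->
  (forall i, exists s, expands (F := F) l D a (fun p => fco E i (g p - b)) s) ->
  (\forall p \near a, D p -> D' (g p) /\ `|g p - b| <= C * `|p - a|) ->
  exists s, expands (F := F) l D a (fun p => f (g p)) s.
Proof.
move=> hT hs hC.
have [s hs'] : exists s, expands (F := F) l D a (fun p => peval T (g p - b)) s.
  elim: T {hT} => [|t T [s IH]].
    exists [:: (0, [ffun=> 0%N])]; under eq_fun do rewrite peval_nil.
    exact: expands_cst.
  have [s1 h1] : exists s, expands (F := F) l D a (fun p => mono t.2 (g p - b)) s.
    by apply: expands_prod => j; exact: expands_exp.
  have [s2 h2] := expandsZ t.1 h1.
  exists (s2 ++ s); under eq_fun do rewrite peval_cons.
  exact: expandsD.
exists s => eps eps0.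
(* [C] may be zero or negative, while a positive constant is needed as a divisor. *)
pose C' := `|C| + 1; have C'0 : 0 < C' by rewrite /C' ltr_wpDl.
have e2 : 0 < eps / 2 by lra.
have e3 : 0 < eps / 2 / C' ^+ l by rewrite divr_gt0 // exprn_gt0.
have /nbhs_ballP[d /= d0 hd] : nbhs b [set q | D' q ->
    `|f q - peval T (q - b)| <= eps / 2 / C' ^+ l * `|q - b| ^+ l].
  exact: hT.
near=> p => Dp.
have H : `|peval T (g p - b) - peval s (p - a)| <= eps / 2 * `|p - a| ^+ l.
  by move: Dp; near: p; exact: hs'.
have [Dg gC] : D' (g p) /\ `|g p - b| <= C * `|p - a| by move: Dp; near: p.
have gC' : `|g p - b| <= C' * `|p - a|.
  rewrite (le_trans gC) // ler_wpM2r // /C' (le_trans (ler_norm _)) //; lra.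
have pd : `|p - a| < d / C'.
  near: p; have := nbhsx_ballx a (d / C') (divr_gt0 d0 C'0).
  by apply: filterS => p; rewrite -ball_normE /= distrC.
have H1 : `|f (g p) - peval T (g p - b)| <= eps / 2 * `|p - a| ^+ l.
  have : ball b d (g p).
    rewrite -ball_normE /= distrC (le_lt_trans gC') //.
    by rewrite mulrC -ltr_pdivlMr.
  move=> /hd /(_ Dg) /le_trans; apply; rewrite -mulrA ler_pM2l //.
  rewrite mulrC ler_pdivrMr ?exprn_gt0 // mulrC -exprMn.
  by rewrite lerXn2r // nnegrE // mulr_ge0 // ltW.
rewrite -[f _](subrK (peval T (g p - b))) -addrA (le_trans (ler_normD _ _)) //.
by rewrite [eps](splitr) mulrDl lerD.
Unshelve. all: by end_near. Qed.

End Expansions.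

(** * Taylor's theorem and integration in time *)

Section Taylor.
Context {R : realType}.
Implicit Types V W : normedModType R.

Lemma is_derive_bigsum V W (J : Type) (s : seq J) (P : pred J) (f : J -> V -> W)
    (df : J -> W) (t v : V) :
  (forall j, P j -> is_derive t v (f j) (df j)) ->
  is_derive t v (fun x => \sum_(j <- s | P j) f j x) (\sum_(j <- s | P j) df j).
Proof.
move=> h; elim: s => [|j s IH].
  by rewrite big_nil; under eq_fun do rewrite big_nil; exact: is_derive_cst.
rewrite big_cons; under eq_fun do rewrite big_cons.
by case Pj : (P j) => //; apply: is_deriveD => //; exact: h.
Qed.

Lemma is_derive_monom (c t : R) (d : nat) :
  is_derive t 1 (fun x => c / d.+1%:R * x ^+ d.+1) (c * t ^+ d).
Proof.
have h : is_derive t 1 (fun x : R => x ^+ d.+1) (d.+1%:R * t ^+ d).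
  apply: DeriveDef; first exact: exprn_derivable.
  by rewrite exp_derive /= [_ *: 1]mulr1.
have -> : c * t ^+ d = c / d.+1%:R *: (d.+1%:R * t ^+ d).
  by rewrite /GRing.scale /= mulrA divfK // pnatr_eq0.
exact: is_deriveZ.
Qed.

Variables (V : normedModType R) (F : frame V).
Local Notation I := (fidx F).
Local Notation expands := (expands (F := F)).

(** Primitive, along rays from the origin, of the i-th coordinate times [s]. The sum over [i] of
    such primitives may fail to have the given polynomials as partial derivatives; only its
    derivative along rays matters. *)
Definition radint (i : I) (s : seq (R * {ffun I -> nat})) :=
  [seq (t.1 / (mdeg t.2).+1%:R, madd t.2 (mone i)) | t <- s].

Lemma peval_radint i s (t : R) v :
  peval (radint i s) (t *: v) =
  \sum_(m <- s) (m.1 * mono m.2 v * fco F i v) / (mdeg m.2).+1%:R * t ^+ (mdeg m.2).+1.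
Proof.
rewrite /peval big_map; apply: eq_bigr => m _ /=.
rewrite mono_scale mdeg_add mdeg_one addn1 mono_add mono_one; ring.
Qed.

Lemma is_derive_radint i s (t : R) v :
  is_derive t 1 (fun x => peval (radint i s) (x *: v)) (fco F i v * peval s (t *: v)).
Proof.
under eq_fun do rewrite peval_radint.
have -> : fco F i v * peval s (t *: v) =
    \sum_(m <- s) (m.1 * mono m.2 v * fco F i v) * t ^+ mdeg m.2.
  rewrite /peval mulr_sumr; apply: eq_bigr => m _.
  rewrite mono_scale; ring.
by apply: is_derive_bigsum => m _; exact: is_derive_monom.
Qed.

(** Induction on the order: expansions of order l of the partial derivatives are integrated along
    the segment from [a] to [p], and the mean value theorem applied to the difference gains the
    factor |p - a|. *)
Lemma taylor l (a : V) (f : V -> R) : CrAt l a f ->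
  exists s, expands l setT a f s.
Proof.
elim: l f => [|l IH] f hf.
  exists [:: (f a, [ffun=> 0%N])] => eps eps0.
  have /cvgr_dist_le /(_ _ eps0) := CrAt_continuous hf.
  apply: filterS => p H _; rewrite peval_cons peval_nil mono_zero mulr1 addr0.
  by rewrite expr0 mulr1 distrC.
have [s hs] := choice (fun i => IH _ (CrAt_derive (fbas F i) hf)).
exists ((f a, [ffun=> 0%N]) :: flatten [seq radint i (s i) | i <- enum I]).
set S := flatten _.
have ES v : peval S v = \sum_i peval (radint i (s i)) v.
  rewrite /S -[RHS]big_enum /=; elim: (enum I) => [|i r IHr] /=.
    by rewrite peval_nil big_nil.
  by rewrite peval_cat IHr big_cons.
move=> eps eps0.
(* Each coordinate contributes one error term; the added 1 keeps the divisor positive when there are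
   no coordinates. *)
pose e' := eps / (#|I|%:R + 1).
have K0 : 0 < #|I|%:R + 1 :> R by rewrite ltr_wpDl.
have e'0 : 0 < e' by rewrite divr_gt0.
have /nbhs_ballP[d /= d0 hd] : \forall y \near a, CrAt l.+1 y f /\
    forall i, `|'D_(fbas F i) f y - peval (s i) (y - a)| <= e' * `|y - a| ^+ l.
  apply: filterI; first exact: CrAt_near.
  apply: filter_forall => i; have := hs i e' e'0.
  by apply: filterS => p; apply.
apply: filterS (nbhsx_ballx a d d0) => p pd _.
rewrite peval_cons mono_zero mulr1 ES.
pose v := p - a.
have seg (t : R) : 0 <= t <= 1 -> ball a d (a + t *: v).
  move=> /andP[t0 t1]; move: pd; rewrite -!ball_normE /= distrC => pd.
  rewrite opprD addNKr normrN normrZ ger0_norm //.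
  by rewrite (le_lt_trans _ pd) // ler_piMl.
pose g (t : R) := f (a + t *: v) - \sum_i peval (radint i (s i)) (t *: v).
pose dg (t : R) := 'D_v f (a + t *: v) - \sum_i fco F i v * peval (s i) (t *: v).
have hg (t : R) : 0 <= t <= 1 -> is_derive t 1 g (dg t).
  move=> /seg/hd [hy _]; apply: is_deriveB.
    exact: is_derive_line (CrAt_differentiable hy).
  by apply: is_derive_bigsum => i _; exact: is_derive_radint.
have -> : f p - (f a + \sum_i peval (radint i (s i)) (p - a)) = g 1 - g 0.
  rewrite /g !scale1r !scale0r addr0 /v [a + _]addrC subrK.
  rewrite [X in _ - (f a - X)]big1; last first.
    move=> i _; have := peval_radint i (s i) 0 0; rewrite scale0r => ->.
    by rewrite big1 // => m _; rewrite expr0n mulr0.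
  by rewrite subr0 opprD addrA addrAC.
suff : `|g 1 - g 0| <= eps * `|p - a| ^+ l.+1 * (1 - 0) by rewrite subr0 mulr1.
apply: (MVT_le (df := dg)) => //.
- by move=> t /andP[t0 t1]; apply: hg; rewrite !ltW.
- apply: derivable_within_continuous => t; rewrite in_itv /= => /hg [+ _]; exact.
move=> t /andP[t0 t1]; have /seg/hd [hy hs'] : 0 <= t <= 1 by rewrite !ltW.
rewrite /dg (derive_frame F); last exact: CrAt_differentiable hy.
rewrite -sumrB (le_trans (ler_norm_sum _ _ _)) //.
apply: (@le_trans _ _ (\sum_(i : I) e' * `|v| ^+ l.+1)).
  apply: ler_sum => i _; rewrite -mulrBr normrM exprS mulrCA ler_pM //.
    exact: fco_le.
  have := hs' i; rewrite [a + _]addrC addrK => /le_trans; apply.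
  rewrite ler_pM2l // normrZ lerXn2r ?nnegrE ?mulr_ge0 //.
  by rewrite ler_piMl // ger0_norm ltW.
rewrite sumr_const -[X in X <= _]mulr_natl mulrA ler_wpM2r ?exprn_ge0 //.
rewrite /e' mulrCA ler_piMr ?(ltW eps0) // ler_pdivrMr // mul1r; lra.
Qed.

End Taylor.

Section TimeIntegration.
Context {R : realType} {k : nat}.
Local Notation I := (option 'I_k).
Local Notation F := (@pV_frame R k).
Local Notation expands := (expands (F := F)).
Local Notation peval := (peval (F := F)).
Local Notation mono := (mono (F := F)).
Local Notation poly := (seq (R * {ffun I -> nat})).

Definition tint (s : poly) : poly :=
  [seq (t.1 / (t.2 None).+1%:R, madd t.2 (mone None)) | t : R * {ffun I -> nat} <- s].

Lemma mono_time (a : {ffun I -> nat}) (x : 'cV[R]_k) (e : R) :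
  mono a (x, e) = e ^+ a None * \prod_i x i 0 ^+ a (Some i).
Proof.
rewrite /mono (bigD1 None) //=; congr (_ * _).
rewrite (reindex_omap Some id) /=; last by case.
by apply: eq_bigl => i; rewrite eqxx.
Qed.

Lemma peval_tint (s : poly) x (e : R) :
  peval (tint s) (x, e) =
  \sum_(m <- s) (m.1 * \prod_i x i 0 ^+ m.2 (Some i)) / (m.2 None).+1%:R
     * e ^+ (m.2 None).+1.
Proof.
rewrite /peval big_map; apply: eq_bigr => m _ /=.
rewrite mono_add mono_one /= mono_time /= exprSr; ring.
Qed.

Lemma is_derive_tint (s : poly) x (e : R) :
  is_derive e 1 (fun t => peval (tint s) (x, t)) (peval s (x, e)).
Proof.
under eq_fun do rewrite peval_tint.
have -> : peval s (x, e) =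
    \sum_(m <- s) (m.1 * \prod_i x i 0 ^+ m.2 (Some i)) * e ^+ m.2 None.
  by apply: eq_bigr => m _; rewrite mono_time; ring.
by apply: is_derive_bigsum => m _; exact: is_derive_monom.
Qed.

Lemma peval_tint0 (s : poly) x : peval (tint s) (x, 0) = 0.
Proof. by rewrite peval_tint big1 // => m _; rewrite expr0n mulr0. Qed.

(** The vertical segments down to time zero are those along which the mean value theorem in time is
    applied. *)
Definition time_star (D : set ('cV[R]_k * R)) : Prop :=
  forall p, D p -> 0 <= p.2 /\ forall s, 0 <= s <= p.2 -> D (p.1, s).

Lemma norm_time_le (x : 'cV[R]_k) (s e : R) : 0 <= s <= e -> `|(x, s)| <= `|(x, e)|.
Proof.
move=> /andP[s0 se]; rewrite /Num.norm /= ge_max !le_max lexx /= orbC.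
by rewrite !ger0_norm ?se // (le_trans s0).
Qed.

(** The mean value theorem in time is applied to [f] minus the primitive of [J]: a velocity error
    o(d^l), with d the distance to [(x0, 0)], is multiplied by the elapsed time, itself at most
    d. *)
Lemma expands_tint l (D : set ('cV[R]_k * R)) (x0 : 'cV[R]_k)
    (f H : 'cV[R]_k * R -> R) (J B : poly) : time_star D ->
  (\forall p \near (x0, 0), D p ->
     {within `[0, p.2], continuous (fun s => f (p.1, s))} /\
     forall s, 0 < s < p.2 -> is_derive s 1 (fun s => f (p.1, s)) (H (p.1, s))) ->
  expands l D (x0, 0) H J ->
  (forall e x, peval B (x, e) = peval B (x, 0)) ->
  expands l.+1 D (x0, 0) (fun p => f (p.1, 0)) B ->
  expands l.+1 D (x0, 0) f (B ++ tint J).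
Proof.
move=> sD hf hJ EB hB eps eps0; have e2 : 0 < eps / 2 by lra.
have /nbhs_ballP[d /= d0 hd] := hJ _ e2.
near=> p => Dp; have [p2 sp] := sD _ Dp.
have pd : ball (x0, 0) d p by near: p; exact: nbhsx_ballx.
have [cf df] : {within `[0, p.2], continuous (fun s => f (p.1, s))} /\
     forall s, 0 < s < p.2 -> is_derive s 1 (fun s => f (p.1, s)) (H (p.1, s)).
  by move: Dp; near: p.
have H0 : `|f (p.1, 0) - peval B (p - (x0, 0))| <= eps / 2 * `|p - (x0, 0)| ^+ l.+1.
  by move: Dp; near: p; exact: hB.
rewrite peval_cat.
have Ep (s : R) : (p.1, s) - (x0, 0) = (p.1 - x0, s).
  by congr pair; rewrite /= ?subr0.
have Epp : p - (x0, 0) = (p.1 - x0, p.2) by rewrite -Ep; case: (p).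
pose g s := f (p.1, s) - peval (tint J) (p.1 - x0, s).
pose dg s := H (p.1, s) - peval J (p.1 - x0, s).
have H1 : `|g p.2 - g 0| <= eps / 2 * `|p - (x0, 0)| ^+ l * (p.2 - 0).
  apply: (MVT_le (df := dg)) => //.
  - by move=> s sp2; apply: is_deriveB; [exact: df|exact: is_derive_tint].
  - rewrite (_ : g = (fun s => f (p.1, s)) - (fun s => peval (tint J) (p.1 - x0, s))) //.
    move=> s; apply: continuousB _; first exact: cf.
    apply: continuous_subspaceT => {}s.
    apply: differentiable_continuous; apply/derivable1_diffP.
    by have [] := is_derive_tint J (p.1 - x0) s.
  (* Lowering the time does not increase the distance to [(x0, 0)], so the estimate on the ball
     holds along the whole segment. *)
  move=> s /andP[s0 s1]; have sp2 : 0 <= s <= p.2 by rewrite !ltW.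
  have : ball (x0, 0) d (p.1, s).
    move: pd; rewrite -!ball_normE /= distrC Epp distrC Ep.
    exact/le_lt_trans/norm_time_le.
  move=> /hd /(_ (sp _ sp2)); rewrite Ep => /le_trans; apply.
  by rewrite ler_pM2l // lerXn2r ?nnegrE // Epp norm_time_le.
have -> : f p - (peval B (p - (x0, 0)) + peval (tint J) (p - (x0, 0))) =
  (f (p.1, 0) - peval B (p - (x0, 0))) + (g p.2 - g 0).
  rewrite /g peval_tint0 Epp; case: (p) => x e /=; ring.
rewrite (le_trans (ler_normD _ _)) // [X in _ <= X * _](splitr eps) mulrDl lerD //.
rewrite (le_trans H1) // subr0 exprSr mulrA ler_wpM2l ?mulr_ge0 ?exprn_ge0 ?(ltW e2) ?(ltW eps0) //.
by rewrite Epp (le_trans _ (pcoord_le None (p.1 - x0, p.2))) //= ler_norm //.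
Unshelve. all: by end_near. Qed.

Definition tzero (s : poly) : poly := [seq t : R * {ffun I -> nat} <- s | t.2 None == 0%N].
Definition tpos (s : poly) : poly := [seq t : R * {ffun I -> nat} <- s | t.2 None != 0%N].

Lemma peval_tzero (s : poly) x e : peval (tzero s) (x, e) = peval s (x, 0).
Proof.
rewrite /peval big_filter [RHS](bigID (fun t : R * {ffun I -> nat} => t.2 None == 0%N)) /=.
rewrite [X in _ = _ + X]big1 ?addr0; last first.
  by move=> t t0; rewrite mono_time expr0n (negbTE t0) mul0r mulr0.
by apply: eq_bigr => t /eqP t0; rewrite !mono_time t0 !expr0.
Qed.

Lemma peval_tpos (s : poly) p : peval (tpos s) p = peval s p - peval (tzero s) p.
Proof.
rewrite /peval !big_filter [in RHS](bigID (fun t : R * {ffun I -> nat} => t.2 None == 0%N)) /=.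
by rewrite [X in X - _]addrC addrK.
Qed.

(** The point (x, 0) lies in [D] and is no farther from the base point than (x, e), so the estimate
    there is at least as good; setting e to zero kills the terms carrying e. *)
Lemma expands_freeze l (D : set ('cV[R]_k * R)) (x0 : 'cV[R]_k) (f : 'cV[R]_k * R -> R)
    (s : poly) : time_star D ->
  expands l D (x0, 0) f s -> expands l D (x0, 0) (fun p => f (p.1, 0)) (tzero s).
Proof.
move=> sD h eps eps0; have /nbhs_ballP[d /= d0 hd] := h _ eps0.
apply: filterS (nbhsx_ballx (x0, 0) d d0) => -[x e] pd Dp /=.
have [/= p2 sp] := sD _ Dp.
have E : (x, e) - (x0, 0) = (x - x0, e) by congr pair; rewrite /= subr0.
have E0 : (x, 0) - (x0, 0) = (x - x0, 0 : R) by congr pair; rewrite /= subr0.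
have e0 : (0 : R) <= 0 <= e by rewrite lexx.
have : ball (x0, 0) d (x, 0 : R).
  move: pd; rewrite -!ball_normE /= distrC E distrC E0.
  exact/le_lt_trans/norm_time_le.
move=> /hd /(_ (sp _ e0)); rewrite E0 E peval_tzero => /le_trans; apply.
by rewrite ler_pM2l // lerXn2r ?nnegrE // norm_time_le.
Qed.

(* The terms of order at most one in e are dictated by the initial value f(x, 0)
   and the initial velocity X(x): those of J are replaced by those of T. *)
Lemma expands_velocity l (D : set ('cV[R]_k * R)) (x0 : 'cV[R]_k)
    (f H : 'cV[R]_k * R -> R) (X : 'cV[R]_k -> R) (J T B : poly) : time_star D ->
  (\forall p \near (x0, 0), D p ->
     {within `[0, p.2], continuous (fun s => f (p.1, s))} /\
     forall s, 0 < s < p.2 -> is_derive s 1 (fun s => f (p.1, s)) (H (p.1, s))) ->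
  (\forall p \near (x0, 0), D p -> H (p.1, 0) = X p.1) ->
  expands l D (x0, 0) H J ->
  expands l D (x0, 0) (fun p => X p.1) T ->
  (forall e x, peval B (x, e) = peval B (x, 0)) ->
  expands l.+1 D (x0, 0) (fun p => f (p.1, 0)) B ->
  expands l.+1 D (x0, 0) f (B ++ tint (tzero T) ++ tint (tpos J)).
Proof.
move=> sD hf hX hJ hT EB hB.
have -> : tint (tzero T) ++ tint (tpos J) = tint (tzero T ++ tpos J).
  by rewrite /tint map_cat.
apply: (expands_tint sD hf) => //.
have hT' : expands l D (x0, 0) (fun p => H (p.1, 0)) (tzero T).
  apply: expands_near (expands_freeze sD hT).
  by apply: filterS hX => p + Dp; move=> /(_ Dp) ->.
apply: (expands_change hJ (expands_freeze sD hJ) hT') => v.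
by rewrite peval_cat peval_tpos addrC.
Qed.

End TimeIntegration.

(** * From expansions to jets *)

Section Jets.
Context {R : realType} {k : nat}.
Local Notation I := (option 'I_k).
Local Notation F := (@pV_frame R k).
Local Notation expands := (expands (F := F)).
Local Notation peval := (peval (F := F)).
Local Notation mono := (mono (F := F)).
Local Notation poly := (seq (R * {ffun I -> nat})).

(** A list may repeat a monomial while a jet has one coefficient for each, hence the sum. *)
Definition jet_of (l : nat) (s : 'I_k -> poly) : jet R k l := fun a m =>
  \col_i \sum_(t <- s i | (t.2 None == m) && [forall j, t.2 (Some j) == a j]) t.1.

Arguments jet_of l s a m : clear implicits.

Lemma mdeg_time (a : {ffun I -> nat}) : mdeg a = (\sum_i a (Some i) + a None)%N.
Proof.
rewrite /mdeg (bigD1 None) //= addnC; congr addn.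
rewrite (reindex_omap Some id) /=; last by case.
by apply: eq_bigl => i; rewrite eqxx.
Qed.

Lemma jet_of_eval l (s : 'I_k -> poly) p i :
  (forall t, t \in s i -> (mdeg t.2 <= l)%N) ->
  jet_eval (jet_of l s) p i 0 = peval (s i) p.
Proof.
move=> hs; rewrite /jet_eval summxE.
under eq_bigr => a _ do rewrite summxE.
transitivity (\sum_(a : {ffun 'I_k -> 'I_l.+1})
    \sum_(m : 'I_l.+1 | (\sum_i a i + m <= l)%N) \sum_(t <- s i)
      if (t.2 None == m) && [forall j, t.2 (Some j) == a j] then t.1 * mono t.2 p else 0).
  apply: eq_bigr => a _; apply: eq_bigr => m _.
  rewrite !mxE mulr_sumr big_mkcond /=; apply: eq_bigr => t _.
  case: ifP => // /andP[/eqP tm /forallP ta].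
  case: p => x e; rewrite mono_time /= tm mulrC; congr (_ * (_ * _)).
  by apply: eq_bigr => j _; rewrite (eqP (ta j)).
transitivity (\sum_(t <- s i) \sum_(a : {ffun 'I_k -> 'I_l.+1})
    \sum_(m : 'I_l.+1 | (\sum_i a i + m <= l)%N)
      if (t.2 None == m) && [forall j, t.2 (Some j) == a j] then t.1 * mono t.2 p else 0).
  rewrite exchange_big /=; apply: eq_bigr => a _; by rewrite exchange_big.
rewrite /peval !big_seq; apply: eq_bigr => t /hs; rewrite mdeg_time => tl.
have tN : (t.2 None < l.+1)%N by rewrite ltnS (leq_trans _ tl) // leq_addl.
have tS j : (t.2 (Some j) < l.+1)%N.
  by rewrite ltnS (leq_trans _ tl) // (bigD1 j) //= -addnA leq_addr.
(* Under the degree bound each term of the list matches exactly one pair of exponents: this one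
   together with [Ordinal tN]. *)
pose a0 : {ffun 'I_k -> 'I_l.+1} := [ffun j => Ordinal (tS j)].
have Ea0 : (\sum_j a0 j = \sum_j t.2 (Some j))%N.
  by apply: eq_bigr => j _; rewrite ffunE.
rewrite (bigD1 a0) //= (bigD1 (Ordinal tN)) /=; last by rewrite Ea0.
rewrite eqxx /=; have -> : [forall j, t.2 (Some j) == a0 j].
  by apply/forallP => j; rewrite ffunE.
rewrite big1 ?addr0; last first.
  move=> m /andP[_ mt]; case: ifP => // /andP[/eqP tm _].
  by move: mt; rewrite -val_eqE /= tm eqxx.
rewrite big1 ?addr0 // => a aa; rewrite big1 // => m _.
case: ifP => // /andP[_ /forallP ta]; move: aa => /eqP[]; apply/ffunP => j.
by apply: val_inj; rewrite ffunE /= (eqP (ta j)).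
Qed.

Lemma cV_norm_le n (v : 'cV[R]_n) (C : R) : 0 <= C ->
  (forall i, `|v i 0| <= C) -> `|v| <= C.
Proof.
move=> C0 h; rewrite /Num.norm /= mx_normrE; apply/bigmax_leP; split => //.
by move=> [i j] _ /=; rewrite ord1.
Qed.

Definition ptrunc l (s : poly) : poly :=
  [seq t : R * {ffun I -> nat} <- s | (mdeg t.2 <= l)%N].

Lemma ptrunc_cat l s s' : ptrunc l (s ++ s') = ptrunc l s ++ ptrunc l s'.
Proof. exact: filter_cat. Qed.

Lemma is_jet_of l l' (D : set ('cV[R]_k * R)) (a : 'cV[R]_k * R)
    (f : 'cV[R]_k * R -> 'cV[R]_k) (s : 'I_k -> poly) :
  (l <= l')%N -> (forall i, expands l' D a (fun p => f p i 0) (s i)) ->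
  is_jet D f a (jet_of l (fun i => ptrunc l (s i))).
Proof.
move=> ll h eps eps0.
have : \forall p \near a, forall i, D p ->
    `|f p i 0 - peval (ptrunc l (s i)) (p - a)| <= eps * `|p - a| ^+ l.
  apply: (@near_forall _ _ _ _ (fun i p => D p ->
    `|f p i 0 - peval (ptrunc l (s i)) (p - a)| <= eps * `|p - a| ^+ l)) => i.
  exact: (expands_trunc (expands_le ll (h i)) eps0).
rewrite near_withinE; apply: filterS => p hp Dp.
apply: cV_norm_le => [|i]; first by rewrite mulr_ge0 // ?exprn_ge0 // ltW.
rewrite !mxE jet_of_eval; first exact: hp.
by move=> t; rewrite mem_filter => /andP[].
Qed.

Definition order2 (s : poly) : bool := all (fun t : R * {ffun I -> nat} => 1 < t.2 None)%N s.

(** A term that already carries time receives one more factor of it by integration. *)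
Lemma order2_tint_tpos (s : poly) : order2 (tint (tpos s)).
Proof.
rewrite /order2 all_map; apply/allP => t; rewrite mem_filter => /andP[t0 _] /=.
by rewrite !ffunE eqxx addn1 ltnS lt0n.
Qed.

Lemma order2_ptrunc l s : order2 s -> order2 (ptrunc l s).
Proof. by move=> /allP h; apply/allP => t; rewrite mem_filter => /andP[_ /h]. Qed.

(** A factor e^2 forces degree at least two: this is why the 1-jets coincide exactly. *)
Lemma order2_ptrunc1 s : order2 s -> ptrunc 1 s = [::].
Proof.
move=> /allP h; rewrite /ptrunc (eq_in_filter (a2 := pred0)) ?filter_pred0 //.
move=> t /h tN; apply/negbTE; rewrite -ltnNge mdeg_time.
exact: leq_trans tN (leq_addl _ _).
Qed.

Lemma peval_order2 (s : poly) : order2 s -> exists C : R, 0 <= C /\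
  forall p, `|p| <= 1 -> `|peval s p| <= C * p.2 ^+ 2.
Proof.
move=> /allP h; exists (\sum_(t <- s) `|t.1|); split; first exact: sumr_ge0.
move=> p p1; rewrite /peval (le_trans (ler_norm_sum _ _ _)) //.
rewrite mulr_suml !big_seq ler_sum // => t /h tN.
rewrite normrM ler_wpM2l //.
have p2 : `|p.2| <= 1 by rewrite (le_trans (pcoord_le None p)).
rewrite -real_normK ?num_real //.
case: p p1 p2 => x e p1 /= e1; rewrite mono_time normrM normrX.
apply: (@le_trans _ _ (`|e| ^+ 2 * 1)); last by rewrite mulr1.
apply: ler_pM => //; first exact: ler_wiXn2l.
rewrite normr_prod prodr_ile1 // => i _; rewrite normr_ge0 normrX exprn_ile1 //.
exact: le_trans (pcoord_le (Some i) (x, e)) p1.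
Qed.

(** The slow map and the flow have different domains, whence [D] and [D']. The common part [B]
    cancels after truncation, and only the [order2] parts remain, which are bounded by a multiple of
    e^2 on the unit ball. *)
Lemma jets_agree l r (D D' : set ('cV[R]_k * R)) (a : 'cV[R]_k * R)
    (f f' : 'cV[R]_k * R -> 'cV[R]_k) (B Q Q' : 'I_k -> poly) :
  (l <= r)%N ->
  (forall i, order2 (Q i)) -> (forall i, order2 (Q' i)) ->
  (forall i, expands r D a (fun p => f p i 0) (B i ++ Q i)) ->
  (forall i, expands r D' a (fun p => f' p i 0) (B i ++ Q' i)) ->
  exists c c' : jet R k l, [/\ is_jet D f a c, is_jet D' f' a c',
    l = 1%N -> forall p, jet_eval c p = jet_eval c' p &
    exists C : R, forall p, `|p| <= 1 ->
      `|jet_eval c p - jet_eval c' p| <= C * p.2 ^+ 2].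
Proof.
move=> lr hQ hQ' h h'.
exists (jet_of l (fun i => ptrunc l (B i ++ Q i))).
exists (jet_of l (fun i => ptrunc l (B i ++ Q' i))).
have E s p i : jet_eval (jet_of l (fun i => ptrunc l (s i))) p i 0 = peval (ptrunc l (s i)) p.
  by rewrite jet_of_eval // => t; rewrite mem_filter => /andP[].
split; [exact: is_jet_of lr h|exact: is_jet_of lr h'| |].
  move=> l1 p; apply/matrixP => i j; rewrite ord1 !E l1 !ptrunc_cat.
  by rewrite (order2_ptrunc1 (hQ i)) (order2_ptrunc1 (hQ' i)).
have [C hC] := choice (fun i => peval_order2 (order2_ptrunc l (hQ i))).
have [C' hC'] := choice (fun i => peval_order2 (order2_ptrunc l (hQ' i))).
exists (\sum_i (C i + C' i)) => p p1.
have CC i : 0 <= C i + C' i by rewrite addr_ge0 //; [case: (hC i)|case: (hC' i)].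
apply: cV_norm_le => [|i]; first by rewrite mulr_ge0 ?sqr_ge0 ?sumr_ge0.
rewrite !mxE !E !ptrunc_cat !peval_cat opprD addrACA subrr add0r.
apply: (@le_trans _ _ ((C i + C' i) * p.2 ^+ 2)).
  rewrite (le_trans (ler_normB _ _)) // mulrDl lerD //.
    by case: (hC i) => _ hCi; exact: hCi.
  by case: (hC' i) => _ hCi; exact: hCi.
rewrite ler_wpM2r ?sqr_ge0 // (bigD1 i) //= lerDl; exact: sumr_ge0.
Qed.

End Jets.

(** * Picard iteration *)

Section Flow.
Context {R : realType}.

Lemma antiderivative (f : R -> R) : continuous f ->
  exists F : R -> R, F 0 = 0 /\ forall t : R, 0 <= t -> is_derive t 1 F (f t).
Proof.
(* Starting the integral at -1 rather than at 0 makes 0 an interior point, so that the derivative at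
   0 is two-sided. *)
move=> cf; pose F0 (y : R) := (\int[@lebesgue_measure R]_(t in `[- 1, y]) (f t))%R.
exists (fun t => F0 t - F0 0); split; first by rewrite subrr.
move=> t t0.
have t1 : t < t + 1 by rewrite ltrDl.
have m1 : -1 < t by lra.
have ci : (@lebesgue_measure R).-integrable `[-1, t + 1] (EFin \o f).
  apply: continuous_compact_integrable; first exact: segment_compact.
  exact: continuous_subspaceT.
have [dF EF] := continuous_FTC1_closed t1 ci m1 (cf t).
have h : is_derive t 1 F0 (f t) by apply: DeriveDef; [exact: dF|rewrite -derive1E EF].
rewrite -[f t]subr0; apply: is_deriveB => //; exact: is_derive_cst.
Qed.

(** Passes to the limit in an inequality with geometric error; 2^n >= n reduces it to the
    Archimedean property. *)
Lemma le_of_geometric (a b c : R) : (forall n, a <= b + c / 2 ^+ n) -> a <= b.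
Proof.
move=> h; rewrite leNgt; apply/negP => ba.
have [c0|c0] := leP c 0.
  by have := h 0%N; rewrite expr0 divr1; lra.
have [n hn] : exists n : nat, c / (a - b) < n%:R.
  by exists (Num.bound (c / (a - b))); apply: le_lt_trans (archi_boundP _) => //;
     rewrite divr_ge0 // ?subr_ge0 ltW.
have n2 : n%:R <= 2 ^+ n :> R by rewrite -natrX ler_nat ltnW // ltn_expl.
have := h n; rewrite leNgt => /negP; apply.
rewrite -ltrBrDl ltr_pdivrMr ?exprn_gt0 // mulrC -ltr_pdivrMr ?subr_gt0 //.
exact: lt_le_trans hn n2.
Qed.

(** Nested intervals: 2c/2^n is the sum of the bounds on all later steps, so the intervals of that
    radius around [a n] decrease, and the supremum of their left ends lies in all of them. The rate
    of convergence comes with the limit. *)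
Lemma geometric_cauchy (a : nat -> R) (c : R) :
  (forall n, `|a n.+1 - a n| <= c / 2 ^+ n) ->
  exists l, forall n, `|a n - l| <= 2 * c / 2 ^+ n.
Proof.
move=> h.
have E n : 2 * c / 2 ^+ n.+1 = c / 2 ^+ n.
  by rewrite exprS invfM mulrACA divff ?mul1r // pnatr_eq0.
have E' n : 2 * c / 2 ^+ n = c / 2 ^+ n + c / 2 ^+ n by ring.
pose lo n := a n - 2 * c / 2 ^+ n; pose hi n := a n + 2 * c / 2 ^+ n.
have loS n : lo n <= lo n.+1.
  by rewrite /lo E E'; have := h n; rewrite ler_norml => /andP[? ?]; lra.
have hiS n : hi n.+1 <= hi n.
  by rewrite /hi E E'; have := h n; rewrite ler_norml => /andP[? ?]; lra.
have lohi n : lo n <= hi n.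
  rewrite /lo /hi; have : 0 <= c / 2 ^+ n by exact: le_trans (h n).
  by rewrite E'; lra.
have lom n m : lo n <= hi m.
  have lomono p q : (p <= q)%N -> lo p <= lo q.
    by move=> /subnK <-; elim: (q - p)%N => // d IH; rewrite addSn (le_trans IH).
  have himono p q : (p <= q)%N -> hi q <= hi p.
    by move=> /subnK <-; elim: (q - p)%N => // d IH; rewrite addSn (le_trans (hiS _)).
  apply: (le_trans (lomono n (maxn n m) _)); first exact: leq_maxl.
  apply: (le_trans (lohi _)); apply: himono; exact: leq_maxr.
have hs : has_sup [set lo n | n in [set: nat]].
  by split; [exists (lo 0%N), 0%N|exists (hi 0%N) => _ [n _ <-]].
exists (sup [set lo n | n in [set: nat]]) => n.
have h1 : lo n <= sup [set lo n | n in [set: nat]].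
  by apply: sup_upper_bound => //; exists n.
have h2 : sup [set lo n | n in [set: nat]] <= hi n.
  by apply: ge_sup; [exists (lo 0%N), 0%N|move=> _ [m _ <-]].
by move: h1 h2; rewrite /lo /hi ler_norml => ? ?; apply/andP; split; lra.
Qed.

Variables (k : nat) (Z : 'cV[R]_k -> 'cV[R]_k) (L M : R).
Hypothesis L0 : 0 <= L.
Hypothesis ZL : forall y y', `|Z y - Z y'| <= L * `|y - y'|.
Hypothesis ZM : forall y, `|Z y| <= M.

Lemma coord_le (v : 'cV[R]_k) i : `|v i 0| <= `|v|.
Proof. exact: ccoord_le. Qed.

Lemma M_ge0 : 0 <= M.
Proof. exact: le_trans (ZM 0). Qed.

Variable tau : R.
Hypothesis tau0 : 0 < tau.
Hypothesis tauL : L * tau <= 2^-1.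

(** Freezing time outside [0, tau] makes curves total on R, with continuity and Lipschitz bounds
    free of any restriction to an interval. The same function later retracts space onto a cube. *)
Definition clamp (t : R) : R := Num.max 0 (Num.min t tau).

Lemma clamp_itv t : 0 <= clamp t <= tau.
Proof. by rewrite /clamp le_max lexx /= ge_max (ltW tau0) ge_min lexx orbT. Qed.

Lemma clamp_id t : 0 <= t <= tau -> clamp t = t.
Proof. by move=> /andP[t0 tt]; rewrite /clamp min_l // max_r. Qed.

Lemma clamp_lip s t : `|clamp s - clamp t| <= `|s - t|.
Proof.
have h1 := ler_norm (s - t); have h2 := ler_norm (t - s); rewrite distrC in h2.
have t0 := tau0; rewrite ler_norml /clamp.
by case: (leP s tau) => ?; case: (leP t tau) => ?; case: (leP 0 tau) => ?;
  case: (leP 0 s) => ?; case: (leP 0 t) => ?; apply/andP; split; lra.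
Qed.

(** [y'] is the Picard image of [y], that is, x plus the integral of Z(y). It is a relation because
    the image is obtained by an existence statement, for Lipschitz [y]; a solution is a curve
    related to itself. *)
Definition is_picard (x : 'cV[R]_k) (y y' : R -> 'cV[R]_k) : Prop :=
  [/\ y' 0 = x, forall t, y' t = y' (clamp t),
      forall s t, `|y' s - y' t| <= M * `|s - t| &
      forall i (t : R), 0 < t < tau -> is_derive t 1 (fun s => y' s i 0) (Z (y t) i 0)].

Lemma lipschitz_coord_continuous (y : R -> 'cV[R]_k) i :
  (forall s t, `|y s - y t| <= M * `|s - t|) -> continuous (fun t => y t i 0).
Proof.
move=> hy t; apply/cvgrPdist_le => e e0.
have M1 : 0 < M + 1 by rewrite ltr_wpDl // M_ge0.
near=> s; have -> : y t i 0 - y s i 0 = (y t - y s) i 0 by rewrite !mxE.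
rewrite (le_trans (coord_le _ _)) // (le_trans (hy _ _)) //.
apply: (@le_trans _ _ ((M + 1) * `|t - s|)); first by rewrite ler_wpM2r //; lra.
rewrite mulrC -ler_pdivlMr //.
near: s; apply: cvgr_dist_le; [exact: cvg_id|exact: divr_gt0].
Unshelve. all: by end_near. Qed.

Lemma Z_coord_continuous (y : R -> 'cV[R]_k) i :
  (forall s t, `|y s - y t| <= M * `|s - t|) -> continuous (fun t => Z (y t) i 0).
Proof.
move=> hy t; apply/cvgrPdist_le => e e0.
have M1 : 0 < L * M + 1 by rewrite ltr_wpDl // mulr_ge0 // M_ge0.
near=> s; have -> : Z (y t) i 0 - Z (y s) i 0 = (Z (y t) - Z (y s)) i 0 by rewrite !mxE.
rewrite (le_trans (coord_le _ _)) // (le_trans (ZL _ _)) //.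
rewrite (le_trans (ler_wpM2l L0 (hy _ _))) // mulrA.
apply: (@le_trans _ _ ((L * M + 1) * `|t - s|)); first by rewrite ler_wpM2r //; lra.
rewrite mulrC -ler_pdivlMr //.
near: s; apply: cvgr_dist_le; [exact: cvg_id|exact: divr_gt0].
Unshelve. all: by end_near. Qed.

Lemma picard_step x (y : R -> 'cV[R]_k) :
  (forall s t, `|y s - y t| <= M * `|s - t|) -> exists y', is_picard x y y'.
Proof.
move=> hy.
have [F hF] := choice (fun i => antiderivative (@Z_coord_continuous y i hy)).
have lipF i s t : 0 <= s -> s <= t -> `|F i t - F i s| <= M * (t - s).
  move=> s0 st; have [_ dF] := hF i.
  apply: (MVT_le (df := fun t => Z (y t) i 0)) => //.
  - by move=> u /andP[su _]; apply: dF; lra.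
  - apply: derivable_within_continuous => u; rewrite in_itv /= => /andP[su _].
    by have [] := dF u (le_trans s0 su).
  by move=> u _; exact: le_trans (coord_le _ _) (ZM _).
(* Clamping the time freezes the curve outside [0, tau], where the primitive is not controlled for
   negative times. *)
exists (fun t => x + \col_i F i (clamp t)); split.
- apply/matrixP => i j; rewrite !mxE clamp_id ?lexx ?ltW //.
  by have [-> _] := hF i; rewrite addr0 ord1.
- by move=> t; rewrite (clamp_id (clamp_itv t)).
- move=> s t; apply: cV_norm_le => [|i]; first by rewrite mulr_ge0 // M_ge0.
  rewrite !mxE opprD addrACA subrr add0r.
  apply: (@le_trans _ _ (M * `|clamp s - clamp t|)); last first.
    by rewrite ler_wpM2l ?M_ge0 // clamp_lip.
  have /andP[s0 _] := clamp_itv s; have /andP[t0 _] := clamp_itv t.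
  have [st|/ltW st] := leP (clamp s) (clamp t).
    by rewrite distrC [`|clamp s - _|]distrC [`|clamp t - _|]ger0_norm ?subr_ge0 // lipF.
  by rewrite [`|clamp s - _|]ger0_norm ?subr_ge0 // lipF.
move=> i t /andP[t0 tt].
have [_ dF] := hF i.
apply: (@near_eq_is_derive _ _ _ (fun s => x i 0 + F i s)).
  near=> s; rewrite !mxE clamp_id //; apply/andP; split.
    by rewrite ltW //; near: s; exact: lt_nbhsr.
  by rewrite ltW //; near: s; exact: lt_nbhsl.
have dFt : is_derive t 1 (F i) (Z (y t) i 0) by apply: dF; exact: ltW.
rewrite -[Z (y t) i 0]add0r.
exact: (@is_deriveD _ _ _ (cst (x i 0)) (F i)).
Unshelve. all: by end_near. Qed.

(** The mean value theorem gives L d tau for each coordinate, at most d / 2 by [tauL]; in the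
    maximum norm no factor from the dimension appears. *)
Lemma picard_contract x (y1 y2 y1' y2' : R -> 'cV[R]_k) d : 0 <= d ->
  is_picard x y1 y1' -> is_picard x y2 y2' ->
  (forall t, `|y1 t - y2 t| <= d) -> forall t, `|y1' t - y2' t| <= d / 2.
Proof.
move=> d0 [z1 c1 l1 h1] [z2 c2 l2 h2] hd t; rewrite c1 c2.
have /andP[s0 st] := clamp_itv t; set s := clamp t in s0 st *.
apply: cV_norm_le => [|i]; first lra.
pose g u := y1' u i 0 - y2' u i 0.
have -> : (y1' s - y2' s) i 0 = g s - g 0 by rewrite /g z1 z2 !mxE; ring.
have H : `|g s - g 0| <= L * d * (s - 0).
  apply: (MVT_le (df := fun u => Z (y1 u) i 0 - Z (y2 u) i 0)) => //.
  - move=> u /andP[u0 us]; have ut : 0 < u < tau by rewrite u0 (lt_le_trans us).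
    by apply: is_deriveB; [exact: h1|exact: h2].
  - apply: continuous_subspaceT => u.
    by apply: cvgB; exact: lipschitz_coord_continuous.
  move=> u _; have -> : Z (y1 u) i 0 - Z (y2 u) i 0 = (Z (y1 u) - Z (y2 u)) i 0 by rewrite !mxE.
  by rewrite (le_trans (coord_le _ _)) // (le_trans (ZL _ _)) // ler_wpM2l.
rewrite (le_trans H) // subr0 mulrAC [leRHS]mulrC ler_wpM2r //.
exact: le_trans (ler_wpM2l L0 st) tauL.
Qed.

Lemma picard (x : 'cV[R]_k) : exists y, is_picard x y y.
Proof.
(* Guarding the property by the Lipschitz bound makes the step total, so that choice yields an
   operator to iterate. *)
have h0 y : exists y', (forall s t, `|y s - y t| <= M * `|s - t|) -> is_picard x y y'.
  have [hy|hy] := pselect (forall s t : R, `|y s - y t| <= M * `|s - t|).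
    by have [y' hy'] := picard_step x hy; exists y'.
  by exists y.
have [Phi hPhi] := choice h0.
pose Y n := iter n Phi (fun=> x).
have YL n s t : `|Y n s - Y n t| <= M * `|s - t|.
  elim: n s t => [|n IH] s t /=; first by rewrite subrr normr0 mulr_ge0 // M_ge0.
  by have [_ _ + _] := hPhi _ IH; apply.
have YS n : is_picard x (Y n) (Y n.+1) by exact: hPhi (YL n).
(* The first iterate stays within [M * tau] of the constant curve [x]; each further step halves the
   distance. *)
pose c := M * tau; have c0 : 0 <= c by rewrite mulr_ge0 ?M_ge0 // ltW.
have Yc n t : `|Y n.+1 t - Y n t| <= c / 2 ^+ n.
  elim: n t => [|n IH] t.
    have [z cl l _] := YS 0%N; rewrite expr0 divr1 cl (_ : Y 0%N t = Y 1%N 0); last by rewrite z.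
    rewrite (le_trans (l _ _)) // subr0 ler_wpM2l ?M_ge0 //.
    by have /andP[? ?] := clamp_itv t; rewrite ger0_norm.
  rewrite exprSr invfM mulrA; apply: (picard_contract _ (YS n.+1) (YS n)) => //.
  by rewrite divr_ge0 // exprn_ge0.
have hlim t : exists l : 'cV[R]_k, forall n i, `|Y n t i 0 - l i 0| <= 2 * c / 2 ^+ n.
  have hl i : exists l, forall n, `|Y n t i 0 - l| <= 2 * c / 2 ^+ n.
    apply: geometric_cauchy => n; apply: le_trans (Yc n t).
    by apply: le_trans (coord_le _ i); rewrite !mxE.
  have [l {}hl] := choice hl; exists (\col_i l i) => n i; rewrite mxE; exact: hl.
have [y hy] := choice hlim.
have e0 n : 0 <= 2 * c / 2 ^+ n by rewrite divr_ge0 ?exprn_ge0 // mulr_ge0.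
have Yy n t : `|Y n t - y t| <= 2 * c / 2 ^+ n.
  by apply: cV_norm_le => [|i]; rewrite // !mxE; exact: hy.
have yL s t : `|y s - y t| <= M * `|s - t|.
  apply: (@le_of_geometric _ _ (4 * c)) => n.
  have -> : y s - y t = (y s - Y n s) + (Y n s - Y n t) + (Y n t - y t).
    by rewrite !addrA !subrK.
  apply: (le_trans (ler_normD _ _)).
  have := Yy n t; have := Yy n s; rewrite [`|Y n s - _|]distrC.
  have := ler_normD (y s - Y n s) (Y n s - Y n t); have := YL n s t.
  have -> : 4 * c / 2 ^+ n = 2 * c / 2 ^+ n + 2 * c / 2 ^+ n by ring.
  lra.
(* Both the limit [y] and its image [y'] are within a multiple of c/2^n of the iterate [Y n.+1], so
   they coincide. *)
have [y' hy'] := picard_step x yL.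
exists y; suff E : y' = y by rewrite -{2}E.
apply/funext => t; apply/eqP; rewrite -subr_eq0 -normr_le0.
apply: (@le_of_geometric _ _ (3 * c)) => n; rewrite add0r.
have H : `|y' t - Y n.+1 t| <= 2 * c / 2 ^+ n / 2.
  by apply: (picard_contract (e0 n) hy' (YS n)) => u; rewrite distrC.
have H' := Yy n.+1 t.
have -> : y' t - y t = (y' t - Y n.+1 t) + (Y n.+1 t - y t) by rewrite !addrA !subrK.
apply: (le_trans (ler_normD _ _)); apply: (le_trans (lerD H H')).
have c2 : 0 <= c / 2 ^+ n by rewrite divr_ge0 // exprn_ge0.
rewrite exprS invfM; move: c2; set q := (2 ^+ n)^-1; lra.
Qed.

End Flow.

(** * Openness of the normally hyperbolic part *)

Section UnitCircle.
Context {R : realType}.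

Lemma eigenvalue_det (K : fieldType) m (g : 'M[K]_m) a :
  eigenvalue g a = (\det (g - a%:M) == 0).
Proof.
rewrite /eigenvalue /eigenspace kermx_eq0 row_free_unit unitmxE unitfE.
by rewrite negbK.
Qed.

Lemma mul_shift (K : comNzRingType) m (g : 'M[K]_m) (x y : K) :
  (g - x%:M) *m (g - y%:M) = g *m g - (x + y) *: g + (x * y)%:M.
Proof.
rewrite mulmxBl !mulmxBr mul_mx_scalar !mul_scalar_mx scale_scalar_mx.
by rewrite opprB scalerDl opprD !addrA addrAC -!addrA; congr (_ + _); rewrite addrCA.
Qed.

(* Real form of |det (A - (a + i b))|^2. *)
Definition quad_det m (A : 'M[R]_m) (a b : R) : R :=
  \det ((A - a%:M) *m (A - a%:M) + (b ^+ 2)%:M).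

Lemma quad_detE m (A : 'M[R]_m) (a b : R) :
  real_complex R (quad_det A a b) =
  \det (map_mx (real_complex R) A - (a +i* b)%C%:M) *
  \det (map_mx (real_complex R) A - (a -i* b)%C%:M).
Proof.
rewrite /quad_det -det_map_mx -det_mulmx; congr (\det _).
rewrite map_mxD map_mxM map_mxB !map_scalar_mx /= !mul_shift -addrA.
congr (_ - _ *: _ + _); last rewrite -raddfD /=; last congr (_%:M).
  by apply/eqP; rewrite eq_complex /=; apply/andP; split; apply/eqP; ring.
by apply/eqP; rewrite eq_complex /=; apply/andP; split; apply/eqP; ring.
Qed.

(** Trades complex eigenvalues for the zeros of a real function, continuous jointly in the matrix
    and the point of the circle, to which a compactness argument applies. *)
Lemma unit_circle_eigen m (A : 'M[R]_m) :
  (forall mu, eigenvalue (map_mx (real_complex R) A) mu -> `|mu| != 1) <->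
  (forall a b, a ^+ 2 + b ^+ 2 = 1 -> quad_det A a b != 0).
Proof.
split=> [h a b ab|h [a b]].
  have n1 (b' : R) : b' ^+ 2 = b ^+ 2 -> `|(a +i* b')%C| = 1.
    by move=> bb; rewrite normc_def /= bb ab sqrtr1.
  apply/negP => /eqP d0; have := quad_detE A a b; rewrite d0 rmorph0 => /esym/eqP.
  rewrite mulf_eq0 => /orP[] /eqP d.
    have /h : eigenvalue (map_mx (real_complex R) A) (a +i* b)%C.
      by rewrite eigenvalue_det d.
    by rewrite n1 // eqxx.
  have /h : eigenvalue (map_mx (real_complex R) A) (a -i* b)%C.
    by rewrite eigenvalue_det d.
  by rewrite n1 ?sqrrN // eqxx.
rewrite eigenvalue_det => /eqP d; apply/negP => /eqP; rewrite normc_def /= => -[] n1.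
have ab : a ^+ 2 + b ^+ 2 = 1.
  by rewrite -[LHS]sqr_sqrtr ?n1 ?expr1n // addr_ge0 // sqr_ge0.
move: (h _ _ ab) => /eqP; apply; apply: (@complexI R).
by rewrite quad_detE d mul0r rmorph0.
Qed.

Lemma CrAt0_continuous (V W : normedModType R) (x : V) (f : V -> W) :
  continuous f -> CrAt 0 x f.
Proof.
by move=> cf; exists setT; split => //; [exact: openT|move=> y _; exact: cf].
Qed.

Lemma unit_circle_near n m (A : 'cV[R]_n -> 'M[R]_m) (z0 : 'cV[R]_n) :
  (forall i j, continuous (fun z => A z i j)) ->
  (forall mu, eigenvalue (map_mx (real_complex R) (A z0)) mu -> `|mu| != 1) ->
  \forall z \near z0, forall mu, eigenvalue (map_mx (real_complex R) (A z)) mu -> `|mu| != 1.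
Proof.
move=> cA /unit_circle_eigen h0.
(* Compactness is taken on a square containing the circle; near points off the circle the condition
   is vacuous. *)
pose K := (`[-1, 1] `*` `[-1, 1])%classic : set (R * R).
have cK : compact K by apply: compact_setX; exact: segment_compact.
have cQ (p : (R * R) * 'cV[R]_n) :
    CrAt 0 p (fun p : (R * R) * 'cV[R]_n => quad_det (A p.2) p.1.1 p.1.2).
  have ca : CrAt 0 p (fun p : (R * R) * 'cV[R]_n => p.1.1).
    apply: CrAt0_continuous => q; apply: continuous_comp; exact: cvg_fst.
  have cb : CrAt 0 p (fun p : (R * R) * 'cV[R]_n => p.1.2).
    by apply: CrAt0_continuous => q; apply: continuous_comp; [exact: cvg_fst|exact: cvg_snd].
  have cM : mxAt 0 p (fun p : (R * R) * 'cV[R]_n => A p.2 - p.1.1%:M).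
    move=> i j; under eq_fun do rewrite !mxE; apply: CrAtB.
      apply: CrAt0_continuous => q.
      by apply: (@continuous_comp _ _ _ snd (fun z => A z i j)); [exact: cvg_snd|exact: cA].
    by case: (i == j) => /=; [exact: ca|under eq_fun do rewrite mulr0n; exact: CrAt_cst].
  apply: CrAt_det => i j.
  under eq_fun do rewrite mxE [X in _ + X]mxE.
  apply: CrAtD; first exact: mxAtM.
  case: (i == j) => /=; last by under eq_fun do rewrite mulr0n; exact: CrAt_cst.
  by under eq_fun do rewrite expr2 mulr1n; exact: CrAtM.
have cN (p : R * R) : CrAt 0 p (fun p : R * R => p.1 * p.1 + p.2 * p.2).
  by apply: CrAtD; apply: CrAtM; apply: CrAt0_continuous => q; (exact: cvg_fst || exact: cvg_snd).
have : \forall z \near z0, K `<=` (fun ab => ab.1 ^+ 2 + ab.2 ^+ 2 = 1 ->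
   quad_det (A z) ab.1 ab.2 != 0).
  have nK : near_covering K by exact/compact_near_coveringP.
  apply: (nK _ (nbhs z0) (fun z ab => ab.1 ^+ 2 + ab.2 ^+ 2 = 1 ->
    quad_det (A z) ab.1 ab.2 != 0)) => -[a b] _.
  have [ab1|ab1] := eqVneq (a ^+ 2 + b ^+ 2) 1.
    have : \forall p \near ((a, b), z0), quad_det (A p.2) p.1.1 p.1.2 != 0.
      apply: (cvgr_neq0 _ (CrAt_continuous (cQ ((a, b), z0)))) => /=; exact: h0.
    by apply: filterS => -[[a' b'] z] /= H _.
  have : \forall ab \near (a, b), ab.1 * ab.1 + ab.2 * ab.2 - 1 != 0 :> R.
    have := CrAtB (cN (a, b)) (@CrAt_cst R _ R 0 (a, b) (1 : R)) => /CrAt_continuous H.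
    by apply: (cvgr_neq0 _ H) => /=; rewrite -!expr2 subr_eq0.
  move=> H; exists ([set ab : R * R | ab.1 * ab.1 + ab.2 * ab.2 - 1 != 0 :> R], setT) => /=.
    by split => //; exact: filterT.
  by move=> [[a' b'] z] /= [H' _] E; move: H'; rewrite -!expr2 E subrr eqxx.
apply: filterS => z Hz; apply/unit_circle_eigen => a b ab.
apply: (Hz (a, b)) => //; split => /=; rewrite in_itv /= -ler_norml.
  by rewrite -(@ler_pXn2r _ 2) ?nnegrE // expr1n real_normK ?num_real // -ab lerDl sqr_ge0.
by rewrite -(@ler_pXn2r _ 2) ?nnegrE // expr1n real_normK ?num_real // -ab lerDr sqr_ge0.
Qed.

End UnitCircle.

(** * Oblique projections and tangent vectors *)

Section LinearAlgebra.
Context {F : fieldType}.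

(* Rewriting the projection through the product A = N B only, which is smoother
   than its factors. *)
Lemma oblique_projection_product n m (N E : 'M[F]_(n, m)) (B E' : 'M[F]_(m, n)) :
  B *m N \in unitmx -> B *m E \in unitmx -> E' *m N \in unitmx ->
  N *m invmx (B *m N) *m B =
  (N *m B) *m E *m invmx (E' *m (N *m B) *m ((N *m B) *m E)) *m (E' *m (N *m B)).
Proof.
move=> uBN uBE uEN.
have -> : E' *m (N *m B) *m (N *m B *m E) = (E' *m N) *m ((B *m N) *m (B *m E)).
  by rewrite !mulmxA.
have inv (X Y : 'M[F]_m) : X \in unitmx -> Y \in unitmx ->
    invmx (X *m Y) = invmx Y *m invmx X.
  move=> uX uY; rewrite -[RHS]mulmx1.
  have uXY : X *m Y \in unitmx by rewrite unitmx_mul uX.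
  rewrite -(mulmxV uXY) mulmxA -[invmx Y *m _ *m _]mulmxA (mulmxA (invmx X)).
  by rewrite (mulVmx uX) mul1mx (mulVmx uY) mul1mx.
rewrite !inv ?unitmx_mul ?uBN ?uBE //.
rewrite -!mulmxA (mulmxA (invmx (E' *m N))) (mulmxA (invmx (E' *m N) *m E')).
rewrite -[invmx (E' *m N) *m E' *m N]mulmxA mulVmx // mul1mx.
rewrite (mulmxA B E) (mulmxA (B *m E)) mulmxV // mul1mx.
by [].
Qed.

(** By its left inverse [P] has rank k, so its columns span the k-dimensional kernel of [B], and on
    that span P C is the identity. With [B] = Df, [P] = Dpsi and [C] the derivative of the chart, a
    tangent vector is recovered from its chart expression. *)
Lemma tangent_recovery n k (B : 'M[F]_(n - k, n)) (P : 'M[F]_(n, k))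
    (C : 'M[F]_(k, n)) (x : 'cV[F]_n) : (k <= n)%N ->
  \rank B = (n - k)%N -> C *m P = 1%:M -> B *m P = 0 -> B *m x = 0 ->
  P *m (C *m x) = x.
Proof.
move=> kn rB CP BP Bx.
have rP : \rank P^T = k.
  apply/eqP; rewrite eqn_leq rank_leq_row /=.
  have := mxrankM_maxr C P; rewrite CP mxrank1 => /leq_trans; apply.
  by rewrite mxrank_tr.
have sP : (P^T <= kermx B^T)%MS by apply/sub_kermxP; rewrite -trmx_mul BP trmx0.
have sx : (x^T <= kermx B^T)%MS by apply/sub_kermxP; rewrite -trmx_mul Bx trmx0.
have : (kermx B^T <= P^T)%MS.
  rewrite -(mxrank_leqif_sup sP) rP mxrank_ker mxrank_tr rB.
  by rewrite subKn.
move=> /(submx_trans sx) /submxP[w Ew].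
have -> : x = P *m w^T by rewrite -[x]trmxK Ew trmx_mul trmxK.
by rewrite (mulmxA C) CP mul1mx.
Qed.

End LinearAlgebra.

(** * One-sided derivatives, products and Jacobians *)

Section Derivatives.
Context {R : realType}.
Implicit Types V W : normedModType R.

(** A two-sided derivative may be computed from the right. This serves for smooth extensions, whose
    values are known for e >= 0 only. *)
Lemma derive_right (g : R -> R) (c : R) : derivable g 0 1 ->
  (forall eps, 0 < eps -> \forall e \near 0^'+, `|g e - g 0 - e * c| <= eps * e) ->
  'D_1 g 0 = c.
Proof.
move=> dg h.
have cg : h^-1 *: (g (h *: 1 + 0) - g 0) @[h --> 0^'+] --> 'D_1 g 0.
  apply: cvg_trans dg; apply: cvg_app => A.
  move=> hA; have {}hA : \forall x \near (0 : R), x != 0 -> A x by exact: hA.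
  suff : \forall x \near (0 : R), 0 < x -> A x by [].
  by apply: filterS hA => x hA x0; apply: hA; rewrite gt_eqF.
suff cc : h^-1 *: (g (h *: 1 + 0) - g 0) @[h --> 0^'+] --> c.
  by rewrite -(cvg_lim _ cg) //; exact: (cvg_lim _ cc).
apply/cvgrPdist_le => eps eps0.
near=> e.
have e0 : 0 < e by near: e; exact: nbhs_right_gt.
have He : `|g e - g 0 - e * c| <= eps * e by near: e; exact: h.
rewrite addr0 [e *: 1]mulr1 distrC -(ler_pM2r e0) -[X in _ * X](gtr0_norm e0) -normrM.
by rewrite mulrBl /GRing.scale /= mulrAC mulVf ?gt_eqF // mul1r [c * e]mulrC.
Unshelve. all: by end_near. Qed.

(** Where [w] vanishes, the difference quotient of the product is u(x + h v) times that of [w], so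
    continuity of [u] suffices. With [u] an entry of N and [w] one of f, it gives Dh = N Df on S. *)
Lemma derive_mul0 V (u w : V -> R) (x v : V) :
  {for x, continuous u} -> differentiable w x -> w x = 0 ->
  is_derive x v (fun y => u y * w y) (u x * 'D_v w x).
Proof.
move=> cu dw w0.
have dwv : derivable w x v by exact: diff_derivable.
suff H : h^-1 *: (u (h *: v + x) * w (h *: v + x) - u x * w x) @[h --> 0^'] --> u x * 'D_v w x.
  apply: DeriveDef; first by apply/cvg_ex; eexists; exact: H.
  exact: (cvg_lim _ H).
have -> : (fun h : R => h^-1 *: (u (h *: v + x) * w (h *: v + x) - u x * w x)) =
   (fun h : R => u (h *: v + x) * (h^-1 *: (w (h *: v + x) - w x))).
  by apply/funext => h; rewrite w0 mulr0 !subr0 /GRing.scale /= mulrCA.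
apply: cvgM; last exact: dwv.
apply: cvg_comp; last exact: cu.
have : (h *: v + x) @[h --> (0 : R)] --> (0 : R) *: v + x.
  by apply: cvgD; [apply: cvgZr_tmp; exact: cvg_id|exact: cvg_cst].
rewrite scale0r add0r => H; apply: cvg_trans H; apply: cvg_app; exact: cvg_within.
Qed.

Lemma derive_coord V n (f : V -> 'cV[R]_n) x v i : differentiable f x ->
  'D_v (fun y => f y i 0) x = ('D_v f x) i 0.
Proof.
move=> df; apply: (@derive_lin _ _ _ _ (@ccoord R n i)) => //.
exact: (fco_continuous (F := cV_frame n)).
Qed.

Lemma differentiable_cVP V n (f : V -> 'cV[R]_n) x :
  (forall i, differentiable (fun y => f y i 0) x) -> differentiable f x.
Proof. by move=> h; apply: (frame_differentiable (F := cV_frame n)). Qed.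

Lemma Jac_mul n m (f : 'cV[R]_n -> 'cV[R]_m) z v : differentiable f z ->
  'D_v f z = Jac f z *m v.
Proof.
move=> df; rewrite deriveE // {1}(cV_sum v) linear_sum /=.
apply/matrixP => i j; rewrite ord1 summxE mxE; apply: eq_bigr => l _.
by rewrite linearZ /= !mxE -deriveE // mulrC.
Qed.

Lemma Jac_comp n m p (g : 'cV[R]_m -> 'cV[R]_p) (f : 'cV[R]_n -> 'cV[R]_m) z :
  differentiable f z -> differentiable g (f z) ->
  Jac (fun y => g (f y)) z = Jac g (f z) *m Jac f z.
Proof.
move=> df dg; apply/matrixP => i j; rewrite mxE.
rewrite deriveE; last exact: differentiable_comp.
rewrite (diff_comp df dg) /= -deriveE // Jac_mul // mxE [RHS]mxE.
by apply: eq_bigr => l _; congr (_ * _); rewrite mxE deriveE.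
Qed.

Lemma Jac_id n (z : 'cV[R]_n) : Jac id z = 1%:M.
Proof.
apply/matrixP => i j; rewrite !mxE derive_id mxE eqxx andbT.
by rewrite eq_sym.
Qed.

Lemma near_eq_Jac n m (f g : 'cV[R]_n -> 'cV[R]_m) z :
  (\forall y \near z, f y = g y) -> Jac f z = Jac g z.
Proof. by move=> fg; apply/matrixP => i j; rewrite !mxE (near_eq_derive _ fg). Qed.

Lemma CrAt_coord V n r (f : V -> 'cV[R]_n) x i : CrAt r x f ->
  CrAt r x (fun y => f y i 0).
Proof.
apply: (@CrAt_lin _ _ _ _ _ _ (@ccoord R n i)).
exact: (fco_continuous (F := cV_frame n)).
Qed.

Lemma mxAt_Jac n m r (f : 'cV[R]_n -> 'cV[R]_m) z : CrAt r.+1 z f ->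
  mxAt r z (Jac f).
Proof.
move=> hf i j; under eq_fun do rewrite mxE.
by apply: CrAt_coord; exact: CrAt_derive.
Qed.

End Derivatives.

(** * The reduced vector field *)

Section FastSlowFacts.
Context {R : realType} {n k r : nat}.
Hypothesis hkn : (k < n)%N.
Hypothesis hr : (2 <= r)%N.
Variables (ebar : R) (N : 'cV[R]_n -> 'M[R]_(n, n - k)).
Variables (f : 'cV[R]_n -> 'cV[R]_(n - k)) (G : 'cV[R]_n -> R -> 'cV[R]_n).
Variable S : set 'cV[R]_n.
Hypothesis hebar : 0 < ebar.
Hypothesis hfs : fast_slow N f G r ebar S.

Lemma CrAt_setT (V W : normedModType R) l (g : V -> W) x : Cr l setT g -> CrAt l x g.
Proof. by move=> h; exists setT; split => //; exact: openT. Qed.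

Lemma f_differentiable z : differentiable f z.
Proof. exact: CrAt_differentiable (CrAt_setT z (fs_f_C1 hfs)). Qed.

Lemma Jac_f_continuous i j : continuous (fun z => Jac f z i j).
Proof.
by move=> z; exact: CrAt_continuous (mxAt_Jac (CrAt_setT z (fs_f_C1 hfs)) i j).
Qed.

Lemma N_continuous i j : continuous (fun z => N z i j).
Proof.
move=> z; apply: (@continuous_comp _ _ _ N (fun M => M i j)).
  exact: (fs_N_cont hfs).
exact: coord_continuous.
Qed.

(** The matrix I + Df N is continuous, so the absence of multipliers on the unit circle persists
    nearby. *)
Lemma Snh_near z0 : Snh N f S z0 -> \forall z \near z0, S z -> Snh N f S z.
Proof.
move=> [_ h]; have cA i j : continuous (fun z => (1%:M + Jac f z *m N z) i j).
  move=> z; apply: CrAt_continuous => //.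
  under eq_fun do rewrite mxE.
  apply: CrAtD; first exact: CrAt_cst.
  by apply: mxAtM => a b; apply: CrAt0_continuous;
    [exact: Jac_f_continuous|exact: N_continuous].
by apply: filterS (unit_circle_near cA h) => z hz Sz; split.
Qed.

Lemma f_zero z : S z -> f z = 0.
Proof. by rewrite (fs_S_eq hfs). Qed.

Lemma fast_part_differentiable z : differentiable (fast_part N f) z.
Proof.
apply: (@CrAt_differentiable _ _ _ r.-1).
by rewrite prednK ?(ltn_trans _ hr) //; exact: CrAt_setT (fs_h_smooth hfs).
Qed.

Lemma Jac_fast_part z : S z -> Jac (fast_part N f) z = N z *m Jac f z.
Proof.
move=> Sz; apply/matrixP => i j; rewrite mxE -derive_coord; last exact: fast_part_differentiable.
have h l : is_derive z (delta_mx j 0) (fun y => N y i l * f y l 0) (N z i l * Jac f z l j).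
  rewrite (_ : Jac f z l j = 'D_(delta_mx j 0) (fun y => f y l 0) z); last first.
    by rewrite mxE derive_coord //; exact: f_differentiable.
  apply: derive_mul0; first exact: N_continuous.
    exact: (CrAt_differentiable (CrAt_coord l (CrAt_setT z (fs_f_C1 hfs)))).
  by rewrite f_zero // mxE.
have H := is_derive_bigsum (index_enum _) (P := xpredT) (fun l _ => h l).
rewrite [RHS]mxE -(@derive_val _ _ _ _ _ _ _ H).
by congr (derive _ _ _); apply/funext => y; rewrite mxE.
Qed.

(** The multiplier 1 lies on the unit circle; excluding it means that 0 is no eigenvalue of Df N. *)
Lemma DfN_unit z : Snh N f S z -> Jac f z *m N z \in unitmx.
Proof.
move=> [_ h]; rewrite unitmxE unitfE; apply/eqP => d0.
have := h 1; rewrite /nontrivial_multiplier eigenvalue_det normr1 eqxx => h1.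
suff E : \det (map_mx (real_complex R) (1%:M + Jac f z *m N z) - 1%:M) == 0.
  by have := h1 E.
have -> : map_mx (real_complex R) (1%:M + Jac f z *m N z) - 1%:M =
   map_mx (real_complex R) (Jac f z *m N z).
  by rewrite map_mxD map_mx1 addrC addKr.
by rewrite det_map_mx d0 rmorph0.
Qed.

Lemma reduced_tangent z : Snh N f S z -> Jac f z *m reduced_field N f G z = 0.
Proof.
move=> hz; rewrite /reduced_field /Proj mulmxA mulmxBr mulmx1 !mulmxA.
by rewrite mulmxV ?DfN_unit // mul1mx subrr mul0mx.
Qed.

Lemma CrAt_line (z0 : 'cV[R]_n) l (F : 'cV[R]_n * R -> R) :
  CrAt l (z0, 0) F -> CrAt l z0 (fun z => F (z, 0)).
Proof.
apply: (CrAt_comp (F := pV_frame n) (g := fun z => (z, 0))) => -[i|] /=.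
  exact: (@CrAt_fco _ _ (cV_frame n) l z0 i).
exact: CrAt_cst.
Qed.

Lemma time_lineE (z : 'cV[R]_n) (e : R) : (z, 0) + e *: (0, 1) = (z, e) :> 'cV[R]_n * R.
Proof. by congr pair; rewrite /= ?scaler0 ?addr0 // add0r [_ *: _]mulr1. Qed.

Lemma is_derive_time (z : 'cV[R]_n) (e : R) (F : 'cV[R]_n * R -> R) :
  differentiable F (z, e) ->
  is_derive e 1 (fun s => F (z, s)) ('D_(0, 1) F (z, e)).
Proof.
move=> dF; have := @is_derive_line _ _ F (z, 0) (0, 1) e.
rewrite time_lineE => /(_ dF).
by congr is_derive; apply/funext => s; rewrite time_lineE.
Qed.

Lemma near_slice (z0 : 'cV[R]_n) (P : set ('cV[R]_n * R)) :
  (\forall p \near (z0, 0 : R), P p) -> \forall z \near z0, P (z, 0 : R).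
Proof.
move=> h; have c : {for z0, continuous (fun z : 'cV[R]_n => (z, 0 : R))}.
  by apply: differentiable_continuous; exact: differentiable_pair.
exact: (@near_comp _ _ ('cV[R]_n * R)%type (fun z => (z, 0 : R)) z0 P c h).
Qed.

Lemma near_time (z : 'cV[R]_n) (P : set ('cV[R]_n * R)) :
  (\forall p \near (z, 0 : R), P p) -> \forall e \near 0^'+, P (z, e).
Proof.
move=> h; have : \forall e \near (0 : R), P (z, e).
  have c : {for (0 : R), continuous (fun e : R => (z, e))}.
    by apply: differentiable_continuous; exact: differentiable_pair.
  exact: (@near_comp _ _ ('cV[R]_n * R)%type (fun e => (z, e)) 0 P c h).
exact: cvg_within.
Qed.

(** [G] itself is only continuous. The candidate is the e-derivative at e = 0 of a smooth extension
    of e G: its difference quotient for e > 0 is G(z, e), which tends to G(z, 0). *)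
Lemma slow_source_smooth z0 : exists g : 'cV[R]_n -> 'cV[R]_n,
  (forall i, CrAt r.-1 z0 (fun z => g z i 0)) /\ \forall z \near z0, g z = G z 0.
Proof.
have A0 z : [set p : 'cV[R]_n * R | 0 <= p.2 <= ebar] (z, 0) by rewrite /= lexx ltW.
have [U [F [oU Uz hF EF]]] := fs_eG_smooth hfs (A0 z0).
have hr' : r = r.-1.+1 by rewrite prednK // (ltn_trans _ hr).
have hF0 : CrAt r (z0, 0) F by exists U.
exists (fun z => 'D_(0, 1) F (z, 0)); split.
  move=> i; apply: (CrAt_line (F := fun p => 'D_(0, 1) F p i 0)).
  by apply: CrAt_coord; apply: CrAt_derive; rewrite -hr'.
have : \forall z \near z0, U (z, 0) by apply: near_slice; exact: open_near.
apply: filterS => z Uz0; apply/matrixP => i j; rewrite ord1.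
have dF : differentiable F (z, 0).
  by move: hF; rewrite hr' => -[+ _]; apply.
have dFi : differentiable (fun p => F p i 0) (z, 0).
  apply: (@CrAt_differentiable _ _ _ r.-1); apply: CrAt_coord; rewrite -hr'.
  by exists U.
rewrite -derive_coord //.
have [dt <-] := is_derive_time dFi.
apply: derive_right => // eps eps0.
have nU : \forall e \near 0^'+, U (z, e) by apply: near_time; exact: open_near.
have nG : \forall e \near 0^'+, 0 <= e <= ebar -> `|G z 0 - G z e| <= eps.
  have /subspace_continuousP /(_ _ (A0 z)) /cvgrPdist_le /(_ _ eps0) := fs_G_cont hfs.
  by rewrite near_withinE => /near_time.
near=> e.
have e0 : 0 < e by near: e; exact: nbhs_right_gt.
have e1 : 0 <= e <= ebar.
  by rewrite ltW //= ltW //; near: e; exact: nbhs_right_lt.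
have Ue : U (z, e) by near: e.
rewrite (EF _ (A0 z) Uz0) (EF (z, e) e1 Ue) /= scale0r !mxE subr0 -mulrBr.
rewrite normrM gtr0_norm // mulrC ler_wpM2r ?(ltW e0) //.
rewrite distrC (_ : _ - _ = (G z 0 - G z e) i 0); last by rewrite !mxE.
by rewrite (le_trans (coord_le _ _)) //; move: e1; near: e.
Unshelve. all: by end_near. Qed.

Lemma reduced_field_smooth z0 : Snh N f S z0 -> exists X : 'cV[R]_n -> 'cV[R]_n,
  (forall i, CrAt r.-1 z0 (fun z => X z i 0)) /\
  \forall z \near z0, Snh N f S z -> X z = reduced_field N f G z.
Proof.
move=> hz0; have [g [hg Eg]] := slow_source_smooth z0.
have hr' : r = r.-1.+1 by rewrite prednK // (ltn_trans _ hr).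
pose A z := Jac (fast_part N f) z.
have hA : mxAt r.-1 z0 A.
  by apply: mxAt_Jac; rewrite -hr'; exact: CrAt_setT (fs_h_smooth hfs).
(* With these factors frozen at [z0], [M] and [X] depend on z through Dh and [g] only, and [M z0] is
   the cube of the invertible matrix Df N. *)
pose E := N z0; pose E' := Jac f z0.
pose M z := E' *m A z *m (A z *m E).
pose X z := g z - A z *m E *m invmx (M z) *m (E' *m A z) *m g z.
have S0 : S z0 by case: hz0.
have u0 := DfN_unit hz0.
have uM : M z0 \in unitmx.
  rewrite /M /A Jac_fast_part // (_ : _ *m _ = (E' *m E) *m (E' *m E) *m (E' *m E)).
    by rewrite !unitmx_mul !u0.
  by rewrite !mulmxA.
have hc m p (C : 'M[R]_(m, p)) : mxAt r.-1 z0 (fun=> C) by exact: mxAt_cst.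
have hAE : mxAt r.-1 z0 (fun z => A z *m E) by exact: mxAtM.
have hEA : mxAt r.-1 z0 (fun z => E' *m A z) by exact: mxAtM.
have hM : mxAt r.-1 z0 (fun z => invmx (M z)) by apply: mxAtV => //; exact: mxAtM.
have hg' : mxAt r.-1 z0 g by move=> i j; rewrite ord1; exact: hg.
have hX : mxAt r.-1 z0 X.
  by apply: mxAtB => //; apply: mxAtM => //; apply: mxAtM => //; apply: mxAtM.
exists X; split; first by move=> i; exact: hX.
have nu (P : 'cV[R]_n -> 'M[R]_(n - k)) : mxAt 0 z0 P -> P z0 \in unitmx ->
    \forall z \near z0, P z \in unitmx.
  move=> hP; rewrite unitmxE unitfE => d0.
  have : \forall z \near z0, \det (P z) != 0.
    exact: (cvgr_neq0 _ (CrAt_continuous (CrAt_det hP))).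
  by apply: filterS => z; rewrite unitmxE unitfE.
have cB : mxAt 0 z0 (Jac f) by move=> i j; apply: CrAt0_continuous; exact: Jac_f_continuous.
have cN : mxAt 0 z0 N by move=> i j; apply: CrAt0_continuous; exact: N_continuous.
have n1 : \forall z \near z0, Jac f z *m E \in unitmx.
  exact: (nu (fun z => Jac f z *m E) (mxAtM cB (mxAt_cst 0 z0 E)) u0).
have n2 : \forall z \near z0, E' *m N z \in unitmx.
  exact: (nu (fun z => E' *m N z) (mxAtM (mxAt_cst 0 z0 E') cN) u0).
apply: filterS3 Eg n1 n2 => z Egz uz1 uz2 hz.
have Sz : S z by case: hz.
have P := oblique_projection_product (DfN_unit hz) uz1 uz2.
by rewrite /X Egz /M /A (Jac_fast_part Sz) /reduced_field /Proj mulmxBl mul1mx P.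
Qed.

End FastSlowFacts.

(** * The reduced flow *)

Section Curves.
Context {R : realType}.

Lemma differentiable_ccoord (V : normedModType R) n (f : V -> 'cV[R]_n) x i :
  differentiable f x -> differentiable (fun y => f y i 0) x.
Proof.
move=> df; exact: (differentiable_comp df (differentiable_coord (f x) i 0)).
Qed.

Lemma is_derive_coord n (g : R -> 'cV[R]_n) (t : R) (v : 'cV[R]_n) i :
  is_derive t 1 g v -> is_derive t 1 (fun s => g s i 0) (v i 0).
Proof.
move=> [dg <-]; have dg' : differentiable g t by exact/derivable1_diffP.
apply: DeriveDef; last by rewrite derive_coord.
by apply: diff_derivable; exact: differentiable_ccoord.
Qed.

Lemma is_derive_cV n (g : R -> 'cV[R]_n) (t : R) (v : 'cV[R]_n) :
  (forall i, is_derive t 1 (fun s => g s i 0) (v i 0)) -> is_derive t 1 g v.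
Proof.
move=> h; have dg : differentiable g t.
  by apply: differentiable_cVP => i; apply/derivable1_diffP; case: (h i).
apply: DeriveDef; first exact: diff_derivable.
apply/matrixP => i j; rewrite ord1 -derive_coord //.
by case: (h i).
Qed.

Lemma clamp_continuous (V : normedModType R) (g : R -> V) :
  {within `[0, 1], continuous g} -> continuous (fun t => g (clamp 1 t)).
Proof.
move=> /subspace_continuousP cg t; have ct := clamp_itv ltr01 t.
have c1 : `[0, 1]%classic (clamp 1 t) by rewrite /= in_itv.
apply/cvgrPdist_le => eps eps0.
have /cvgrPdist_le /(_ _ eps0) := cg _ c1.
rewrite near_withinE => /nbhs_ballP[d /= d0 hd].
apply: filterS (nbhsx_ballx t d d0) => s ts.
apply: hd; last by rewrite /= in_itv /= clamp_itv.
move: ts; rewrite -!ball_normE /=; apply: le_lt_trans; exact: clamp_lip.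
Qed.

Lemma lipschitz_near n m (X : 'cV[R]_n -> 'cV[R]_m) x0 :
  (forall i, CrAt 1 x0 (fun y => X y i 0)) ->
  exists rho L, [/\ 0 < rho, 0 <= L &
    forall y y', ball x0 rho y -> ball x0 rho y' -> `|X y - X y'| <= L * `|y - y'|].
Proof.
move=> h; have h' i := CrAt1_lipschitz (cV_frame n) (h i).
have [rho hrho] := choice h'; have [L hL] := choice hrho.
have /nbhs_ballP[d /= d0 hd] : \forall y \near x0, forall i, ball x0 (rho i) y.
  by apply: near_forall => i; apply: nbhsx_ballx; case: (hL i).
have L0 i : 0 <= L i by case: (hL i).
exists d, (\sum_i L i); split => //; first exact: sumr_ge0.
move=> y y' /hd hy /hd hy'.
apply: cV_norm_le => [|i]; first by rewrite mulr_ge0 // sumr_ge0.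
have [_ _ /(_ y y' (hy i) (hy' i))] := hL i.
rewrite !mxE => /le_trans; apply; rewrite ler_wpM2r //.
by rewrite (bigD1 i) //= lerDl sumr_ge0.
Qed.

Section Uniqueness.
Variables (n : nat) (M0 : set 'cV[R]_n) (X : 'cV[R]_n -> 'cV[R]_n) (z0 : 'cV[R]_n).
Variables (rho L B e : R).
Hypothesis L0 : 0 <= L.
Hypothesis B0 : 0 <= B.
Hypothesis e0 : 0 <= e.
Hypothesis XL : forall z z', M0 z -> M0 z' -> ball z0 rho z -> ball z0 rho z' ->
  `|X z - X z'| <= L * `|z - z'|.
Hypothesis XB : forall z, M0 z -> ball z0 rho z -> `|X z| <= B.
Hypothesis eB : e * B < rho / 2.
Hypothesis eL : e * L < 1.

(** First exit time: before leaving the ball the speed is at most e B, so the curve moves less than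
    rho / 2, too little to get out from the smaller ball. *)
Lemma curve_confined g : integral_curve M0 (fun z => e *: X z) g ->
  ball z0 (rho / 2) (g 0) -> forall t, 0 <= t <= 1 -> ball z0 rho (g t).
Proof.
move=> [gM cg dg] g0 t1 ht1; apply: contrapT => nb.
have cg' := clamp_continuous cg.
(* The times spent outside the ball form a compact set, whose minimum is the exit time. *)
pose T : set R := `[0, 1]%classic `&` [set t | rho <= `|g (clamp 1 t) - z0| ].
have nrm t : ball z0 rho (g t) <-> `|g t - z0| < rho.
  by rewrite -ball_normE /= distrC.
have cT : compact T.
  apply: (subclosed_compact _ (@segment_compact R 0 1)); last by move=> t [].
  apply: closedI; first exact: interval_closed.
  apply: (@closed_comp _ _ (fun t => `|g (clamp 1 t) - z0|) [set y | rho <= y]).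
    move=> t _; apply: cvg_norm; apply: cvgB; [exact: cg'|exact: cvg_cst].
  exact: closed_ge.
have T0 : T !=set0.
  exists t1; split; first by rewrite /= in_itv.
  by rewrite /= clamp_id // leNgt; apply/negP => /nrm.
have [ts + hmin] := compact_EVT_min T0 cT (@continuous_subspaceT _ _ T id (fun x => @cvg_id _ _)).
rewrite inE => -[/= + hts]; rewrite in_itv /= => /andP[ts0 ts1].
have {}hts : rho <= `|g ts - z0| by move: hts; rewrite /= clamp_id // ts0.
have ins t : 0 <= t < ts -> ball z0 rho (g t).
  move=> /andP[t0 tts]; apply/nrm; rewrite ltNge; apply/negP => H.
  have : T t.
    have t01 : 0 <= t <= 1 by rewrite t0 (le_trans (ltW tts)).
    by split; [rewrite /= in_itv|rewrite /= clamp_id].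
  by move=> Tt; have := hmin t; rewrite inE => /(_ Tt); rewrite leNgt tts.
have : `|g ts - g 0| <= e * B.
  apply: cV_norm_le => [|i]; first exact: mulr_ge0.
  have H : `|g (clamp 1 ts) i 0 - g (clamp 1 0) i 0| <= e * B * (ts - 0).
    apply: (MVT_le (f := fun t => g (clamp 1 t) i 0) (df := fun t => (e *: X (g t)) i 0)) => //.
    - move=> t /andP[t0 tts].
      have t1' : t \in `]0, 1[ by rewrite in_itv /= t0 (lt_le_trans tts).
      apply: (@near_eq_is_derive _ _ _ (fun s => g s i 0)).
        near=> s; rewrite clamp_id //; apply/andP; split.
          by rewrite ltW //; near: s; exact: lt_nbhsr.
        by rewrite ltW //; near: s; apply: lt_nbhsl; exact: lt_le_trans ts1.
      exact: is_derive_coord (dg _ t1').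
    - apply: continuous_subspaceT => t.
      apply: (@continuous_comp _ _ _ (fun t => g (clamp 1 t)) (fun v => v i 0)).
        exact: cg'.
      exact: coord_continuous.
    move=> t /andP[t0 tts]; rewrite mxE normrM ger0_norm // ler_wpM2l //.
    rewrite (le_trans (coord_le _ _)) //; apply: XB; last by apply: ins; rewrite ltW.
    by apply: gM; rewrite in_itv /= ltW //= (le_trans (ltW tts)).
  have c0 : ((0 : R) <= 0) && ((0 : R) <= 1) by rewrite lexx ler01.
  have c1 : 0 <= ts <= 1 by rewrite ts0.
  rewrite !mxE; move: H; rewrite (clamp_id c0) (clamp_id c1) subr0 => /le_trans; apply.
  by rewrite ler_piMr // mulr_ge0.
move: g0; rewrite -ball_normE /= => g0 H.
have := ler_normD (g ts - g 0) (g 0 - z0); rewrite addrA subrK [`|g 0 - z0|]distrC.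
move=> h3; have h4 := eB; lra.
Unshelve. all: by end_near. Qed.

(** The largest distance D of the two curves satisfies D <= e L D with e L < 1, so it is zero; small
    [e] takes the place of Gronwall's inequality. *)
Lemma curve_unique g1 g2 : integral_curve M0 (fun z => e *: X z) g1 ->
  integral_curve M0 (fun z => e *: X z) g2 -> g1 0 = g2 0 ->
  ball z0 (rho / 2) (g1 0) -> g1 1 = g2 1.
Proof.
move=> ig1 ig2 g00 g0.
have b1 := curve_confined ig1 g0.
have b2 : forall t, 0 <= t <= 1 -> ball z0 rho (g2 t).
  by apply: curve_confined ig2 _; rewrite -g00.
have [gM1 cg1 dg1] := ig1; have [gM2 cg2 dg2] := ig2.
have cg1' := clamp_continuous cg1; have cg2' := clamp_continuous cg2.
pose d t := `|g1 (clamp 1 t) - g2 (clamp 1 t)|.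
have cd : continuous d by move=> t; apply: cvg_norm; apply: cvgB; [exact: cg1'|exact: cg2'].
have [c + hmax] := EVT_max ler01 (continuous_subspaceT cd).
rewrite in_itv /= => /andP[c0 c1].
have dle t : 0 <= t <= 1 -> `|g1 t - g2 t| <= d c.
  by move=> t01; have := hmax t; rewrite in_itv /d [clamp 1 t]clamp_id //; apply.
have d0 : 0 <= d c by exact: normr_ge0.
have : d c <= e * L * d c.
  rewrite {1}/d clamp_id ?c0 //; apply: cV_norm_le => [|i]; first by rewrite !mulr_ge0.
  pose u t := g1 (clamp 1 t) i 0 - g2 (clamp 1 t) i 0.
  have H : `|u c - u 0| <= e * L * d c * (c - 0).
    apply: (MVT_le (df := fun t => (e *: X (g1 t)) i 0 - (e *: X (g2 t)) i 0)) => //.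
    - move=> t /andP[t0 tc].
      have t1' : t \in `]0, 1[ by rewrite in_itv /= t0 (lt_le_trans tc).
      apply: (@near_eq_is_derive _ _ _ (fun s => g1 s i 0 - g2 s i 0)).
        near=> s; rewrite /u clamp_id //; apply/andP; split.
          by rewrite ltW //; near: s; exact: lt_nbhsr.
        by rewrite ltW //; near: s; apply: lt_nbhsl; exact: lt_le_trans c1.
      apply: is_deriveB.
        exact: is_derive_coord (dg1 _ t1').
      exact: is_derive_coord (dg2 _ t1').
    - apply: continuous_subspaceT => t; apply: cvgB.
        apply: (@continuous_comp _ _ _ (fun t => g1 (clamp 1 t)) (fun v => v i 0)).
          exact: cg1'.
        exact: coord_continuous.
      apply: (@continuous_comp _ _ _ (fun t => g2 (clamp 1 t)) (fun v => v i 0)).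
        exact: cg2'.
      exact: coord_continuous.
    move=> t /andP[t0 tc].
    have t01 : 0 <= t <= 1 by rewrite ltW //= (le_trans (ltW tc)).
    have -> : (e *: X (g1 t)) i 0 - (e *: X (g2 t)) i 0 = e * (X (g1 t) - X (g2 t)) i 0.
      by rewrite !mxE mulrBr.
    rewrite normrM ger0_norm // -mulrA ler_wpM2l // (le_trans (coord_le _ _)) //.
    apply: (@le_trans _ _ (L * `|g1 t - g2 t|)).
      by apply: XL; [apply: gM1|apply: gM2|apply: b1|apply: b2]; rewrite ?in_itv.
    by rewrite ler_wpM2l // dle.
  have c00 : ((0 : R) <= 0) && ((0 : R) <= 1) by rewrite lexx ler01.
  have c01 : 0 <= c <= 1 by rewrite c0.
  move: H; rewrite /u (clamp_id c00) (clamp_id c01) g00 subrr !subr0 !mxE.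
  by move=> /le_trans; apply; rewrite ler_piMr // !mulr_ge0.
rewrite -subr_ge0 -{2}[d c]mul1r -mulrBl => H.
have dc0 : d c = 0.
  apply/eqP; rewrite eq_le d0 andbT leNgt; apply/negP => dpos.
  by move: H; rewrite pmulr_lge0 // subr_ge0 leNgt eL.
apply/eqP; rewrite -subr_eq0 -normr_le0 -dc0; apply: dle.
by rewrite ler01 lexx.
Unshelve. all: by end_near. Qed.

End Uniqueness.

(** Picard iteration is run on a globally Lipschitz bounded field, namely X composed with the
    retraction [cl] onto a cube around [x0]. Curves starting in the half-size cube stay in the cube
    up to time [tau], and there [cl] is the identity. *)
Lemma local_flow k (X : 'cV[R]_k -> 'cV[R]_k) x0 (rho1 : R) : 0 < rho1 ->
  (forall i, CrAt 1 x0 (fun y => X y i 0)) ->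
  exists (d tau M : R) (phi : 'cV[R]_k -> R -> 'cV[R]_k),
    [/\ 0 < d, 0 < tau, 0 <= M &
      forall x, ball x0 d x ->
      [/\ phi x 0 = x, forall s t, `|phi x s - phi x t| <= M * `|s - t|,
          forall t, 0 <= t <= tau -> ball x0 rho1 (phi x t) &
          forall i (t : R), 0 < t < tau ->
            is_derive t 1 (fun s => phi x s i 0) (X (phi x t) i 0)]].
Proof.
move=> r1 hX; have [rho [L [rho0 L0 XL]]] := lipschitz_near hX.
pose dl := Num.min rho rho1 / 2.
have dl0 : 0 < dl by rewrite divr_gt0 // lt_min rho0.
have dlr : dl < rho by rewrite /dl; have : Num.min rho rho1 <= rho by [rewrite ge_min lexx|]; lra.
have dlr1 : dl < rho1.
  by rewrite /dl; have : Num.min rho rho1 <= rho1 by [rewrite ge_min lexx orbT|]; lra.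
(* Each coordinate is clamped to within [dl] of that of [x0]; the shifts by [dl] compensate for
   [clamp] starting at 0. *)
pose cl (y : 'cV[R]_k) : 'cV[R]_k := x0 + \col_i (clamp (2 * dl) (y i 0 - x0 i 0 + dl) - dl).
have dl2 : 0 < 2 * dl by rewrite mulr_gt0.
have cl_id y : `|y - x0| <= dl -> cl y = y.
  move=> hy; apply/matrixP => i j; rewrite ord1 !mxE clamp_id; first by ring.
  have := le_trans (coord_le (y - x0) i) hy; rewrite !mxE ler_norml => /andP[? ?].
  by apply/andP; split; lra.
have cl_ball y : ball x0 rho (cl y).
  rewrite -ball_normE /= distrC; apply: (le_lt_trans _ dlr).
  apply: cV_norm_le => [|i]; first exact: ltW.
  rewrite !mxE addrAC subrr add0r ler_norml.
  have /andP[? ?] := clamp_itv dl2 (y i 0 - x0 i 0 + dl).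
  by apply/andP; split; lra.
have cl_lip y y' : `|cl y - cl y'| <= `|y - y'|.
  apply: cV_norm_le => // i; rewrite !mxE.
  set A := clamp _ _; set A' := clamp _ _.
  have -> : x0 i 0 + (A - dl) - (x0 i 0 + (A' - dl)) = A - A' by ring.
  rewrite (le_trans (clamp_lip dl2 _ _)) //.
  have -> : y i 0 - x0 i 0 + dl - (y' i 0 - x0 i 0 + dl) = (y - y') i 0.
    by rewrite !mxE; ring.
  exact: coord_le.
pose Z y := X (cl y).
have ZL y y' : `|Z y - Z y'| <= L * `|y - y'|.
  by rewrite (le_trans (XL _ _ (cl_ball y) (cl_ball y'))) // ler_wpM2l.
pose M := `|X x0| + L * rho.
have ZM y : `|Z y| <= M.
  rewrite -[Z y](subrK (X x0)) addrC (le_trans (ler_normD _ _)) // lerD2l.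
  rewrite (le_trans (XL _ _ (cl_ball y) (ballxx x0 rho0))) // ler_wpM2l //.
  by have := cl_ball y; rewrite -ball_normE /= distrC => /ltW.
have M0 : 0 <= M := le_trans (normr_ge0 _) (ZM 0).
(* The first bound gives the contraction, the second keeps the displacement [M * tau] at most
   [dl / 2]. *)
pose tau := Num.min (2^-1 / (L + 1)) (dl / 2 / (M + 1)).
have L1 : 0 < L + 1 by rewrite ltr_wpDl.
have M1 : 0 < M + 1 by rewrite ltr_wpDl.
have tau0 : 0 < tau.
  by rewrite /tau lt_min (divr_gt0 _ L1) ?(divr_gt0 _ M1) ?(divr_gt0 dl0) ?invr_gt0.
have tauL : L * tau <= 2^-1.
  apply: (@le_trans _ _ ((L + 1) * (2^-1 / (L + 1)))); last first.
    by rewrite mulrC divfK ?gt_eqF.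
  by apply: ler_pM => //; [exact: ltW|rewrite lerDl|rewrite /tau ge_min lexx].
have tauM : M * tau <= dl / 2.
  apply: (@le_trans _ _ ((M + 1) * (dl / 2 / (M + 1)))); last first.
    by rewrite mulrC divfK ?gt_eqF.
  by apply: ler_pM => //; [exact: ltW|rewrite lerDl|rewrite /tau ge_min lexx orbT].
have [phi hphi] := choice (picard L0 ZL ZM tau0 tauL).
exists (dl / 2), tau, M, phi; split => //; first exact: divr_gt0.
move=> x; rewrite -ball_normE /= => xd.
have [p0 pc pl pd] := hphi x.
have pin t : 0 <= t <= tau -> `|phi x t - x0| <= dl.
  move=> /andP[t0 tt]; have := ler_normD (phi x t - phi x 0) (phi x 0 - x0).
  rewrite addrA subrK p0 [`|x - x0|]distrC.
  have := pl t 0; rewrite subr0 p0 (ger0_norm t0).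
  have := ler_wpM2l M0 tt; lra.
split; [exact: p0|exact: pl| |].
  by move=> t /pin h; rewrite distrC (le_lt_trans h).
move=> i t tt; have := pd i t tt; rewrite /Z cl_id //; apply: pin.
by case/andP: tt => ? ?; rewrite !ltW.
Qed.

End Curves.

(** * Expansion of the flow in the initial point and time *)

Section FlowExpansion.
Context {R : realType} {k : nat}.
Local Notation I := (option 'I_k).
Local Notation F := (@pV_frame R k).
Local Notation expands := (expands (F := F)).
Local Notation peval := (peval (F := F)).
Local Notation poly := (seq (R * {ffun I -> nat})).

Definition xpoly (x0 : 'cV[R]_k) (i : 'I_k) : poly :=
  [:: (x0 i 0, [ffun=> 0%N])] ++ [:: (1, mone (Some i : I))].

Lemma xpoly_time x0 i e x : peval (xpoly x0 i) (x, e) = peval (xpoly x0 i) (x, 0).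
Proof.
by rewrite /xpoly !peval_cat !peval_cons !peval_nil !mono_zero !mono_one.
Qed.

Lemma expands_xpoly l D x0 i : expands l D (x0, 0) (fun p => p.1 i 0) (xpoly x0 i).
Proof.
have := expandsD (@expands_cst _ _ F l D (x0, 0) (x0 i 0))
  (@expands_coord _ _ F l D (x0, 0) (Some i)).
apply: expands_near; apply: near_all => p Dp; split => //=.
by rewrite !mxE; ring.
Qed.

Variables (r : nat) (x0 : 'cV[R]_k) (X : 'cV[R]_k -> 'cV[R]_k) (T : 'I_k -> poly).
Variables (phi : 'cV[R]_k -> R -> 'cV[R]_k) (D : set ('cV[R]_k * R)) (M : R).
Hypothesis M0 : 0 <= M.
Hypothesis hT : forall i, expands r setT (x0, 0) (fun p => X p.1 i 0) (T i).
Hypothesis sD : time_star D.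
Hypothesis phi0 : forall p, D p -> phi p.1 0 = p.1.
Hypothesis phiL : forall p, D p -> forall s t, `|phi p.1 s - phi p.1 t| <= M * `|s - t|.
Hypothesis dphi : forall p, D p -> forall i (s : R), 0 < s < p.2 ->
  is_derive s 1 (fun s => phi p.1 s i 0) (X (phi p.1 s) i 0).

(** This is the linear bound under which the flow may be substituted into the expansion of [X]; it
    also starts the induction at order zero. *)
Lemma flow_near_start p : D p -> `|phi p.1 p.2 - x0| <= (M + 1) * `|p - (x0, 0)|.
Proof.
move=> Dp; have [p2 _] := sD Dp.
have := ler_normD (phi p.1 p.2 - phi p.1 0) (phi p.1 0 - x0).
rewrite addrA subrK; move/le_trans; apply; rewrite mulrDl mul1r phi0 //.
apply: lerD.
  have := phiL Dp p.2 0; rewrite phi0 // => /le_trans; apply; rewrite ler_wpM2l //.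
  have := pcoord_le None (p - (x0, 0)); rewrite /= !subr0; exact.
by rewrite /Num.norm /= le_max lexx.
Qed.

Lemma expands_flow_velocity l :
  (forall i, exists s, expands l D (x0, 0) (fun p => phi p.1 p.2 i 0) s) ->
  (l <= r)%N ->
  forall i, exists J, expands l D (x0, 0) (fun p => X (phi p.1 p.2) i 0) J.
Proof.
move=> hs lr i.
pose W : normedModType R := ('cV[R]_k * R)%type.
(* [X] is regarded as a function of (x, e) constant in e and evaluated at (phi, 0), so that [T], an
   expansion over the product space, can be substituted into. *)
apply: (@expands_comp R W F W F l D setT (x0, 0) (x0, 0)
   (fun q => X q.1 i 0) (fun p => (phi p.1 p.2, 0 : R)) (T i) (M + 1)).
- exact: expands_le lr (hT i).
- case=> [j|] /=.
    have [s h] := hs j; exists (s ++ [:: (- x0 j 0, [ffun=> 0%N])]).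
    have := expandsD h (@expands_cst _ _ F l D (x0, 0) (- x0 j 0)).
    by apply: expands_near; apply: near_all => p Dp; rewrite !mxE.
  exists [:: (0, [ffun=> 0%N])]; have := @expands_cst _ _ F l D (x0, 0) 0.
  by apply: expands_near; apply: near_all => p Dp; rewrite subrr.
apply: near_all => p Dp; split => //.
rewrite (_ : _ - _ = (phi p.1 p.2 - x0, 0)); last by congr pair; rewrite /= subrr.
apply: le_trans (flow_near_start Dp).
by rewrite [leLHS]/Num.norm /= ge_max lexx normr0 normr_ge0.
Qed.

Lemma expands_flow_step l i J : expands l D (x0, 0) (fun p => X (phi p.1 p.2) i 0) J ->
  (l <= r)%N ->
  expands l.+1 D (x0, 0) (fun p => phi p.1 p.2 i 0)
    (xpoly x0 i ++ tint (tzero (T i)) ++ tint (tpos J)).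
Proof.
move=> hJ lr.
apply: (expands_velocity (H := fun p => X (phi p.1 p.2) i 0) (X := fun x => X x i 0) sD) => //.
- apply: near_all => p Dp; split; last by move=> s; exact: dphi.
  apply: continuous_subspaceT.
  (* The lemma takes a field bounded by [M]; the zero field is one because [M] is nonnegative. *)
  apply: (@lipschitz_coord_continuous _ _ (fun=> 0) M _ (phi p.1)).
    by move=> y; rewrite normr0.
  exact: phiL.
- by apply: near_all => p Dp; rewrite /= phi0.
- apply: expands_near (expands_le lr (hT i)); exact: near_all.
- exact: xpoly_time.
apply: expands_near (expands_xpoly _ _ _ _).
by apply: near_all => p Dp; split => //=; rewrite phi0.
Qed.

(** Each turn passes from the flow to its velocity without loss of order and back with a gain of
    one. Since [X] is expanded to order [r], a last turn from order [r] reaches r + 1. *)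
Lemma expands_flow : exists J : 'I_k -> poly, forall i,
  expands r.+1 D (x0, 0) (fun p => phi p.1 p.2 i 0)
    (xpoly x0 i ++ tint (tzero (T i)) ++ tint (tpos (J i))).
Proof.
have h l : (l <= r)%N -> forall i, exists s, expands l D (x0, 0) (fun p => phi p.1 p.2 i 0) s.
  elim: l => [_ i|l IH lr i].
    exists [:: (x0 i 0, [ffun=> 0%N])] => eps eps0.
    have M1 : 0 < M + 1 by rewrite ltr_wpDl.
    near=> p => Dp.
    rewrite peval_cons peval_nil mono_zero mulr1 addr0 expr0 mulr1.
    have -> : phi p.1 p.2 i 0 - x0 i 0 = (phi p.1 p.2 - x0) i 0 by rewrite !mxE.
    rewrite (le_trans (coord_le _ _)) // (le_trans (flow_near_start Dp)) //.
    rewrite mulrC -ler_pdivlMr // distrC.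
    near: p; have := nbhsx_ballx (x0, 0 : R) _ (divr_gt0 eps0 M1).
    by apply: filterS => p; rewrite -ball_normE => /ltW.
  have [J hJ] := expands_flow_velocity (IH (ltnW lr)) (ltnW lr) i.
  by eexists; exact: expands_flow_step hJ (ltnW lr).
have [J hJ] := choice (expands_flow_velocity (h r (leqnn r)) (leqnn r)).
by exists J => i; exact: expands_flow_step.
Unshelve. all: by end_near. Qed.

End FlowExpansion.

(** * The reduced field and its flow in a chart *)

Section Chart.
Context {R : realType} {n k r : nat}.
Hypothesis hkn : (k < n)%N.
Hypothesis hr : (2 <= r)%N.
Variables (ebar : R) (N : 'cV[R]_n -> 'M[R]_(n, n - k)).
Variables (f : 'cV[R]_n -> 'cV[R]_(n - k)) (G : 'cV[R]_n -> R -> 'cV[R]_n).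
Variable S : set 'cV[R]_n.
Hypothesis hebar : 0 < ebar.
Hypothesis hfs : fast_slow N f G r ebar S.
Variables (z0 : 'cV[R]_n) (W : set 'cV[R]_n) (V : set 'cV[R]_k).
Variables (chi : 'cV[R]_n -> 'cV[R]_k) (psi : 'cV[R]_k -> 'cV[R]_n).
Hypothesis hz0 : Snh N f S z0.
Hypothesis hchart : local_chart r S z0 W V chi psi.
Local Notation x0 := (chi z0).
Local Notation red := (reduced_field N f G).
Local Notation Sn := (Snh N f S).
Local Notation F := (@pV_frame R k).
Local Notation expands := (expands (F := F)).

Lemma smooth_germ (V1 W1 : normedModType R) l (A : set V1) (g : V1 -> W1) x :
  smooth_on l A g -> A x ->
  exists g', CrAt l x g' /\ \forall y \near x, A y -> g' y = g y.
Proof.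
move=> h /h [U [g' [oU Ux hg' E]]]; exists g'; split; first by exists U.
by apply: filterS (open_near oU Ux) => y Uy Ay; exact: E.
Qed.

Lemma near_interior (V1 : normedModType R) (x : V1) (P : set V1) :
  (\forall y \near x, P y) -> \forall y \near x, \forall y' \near y, P y'.
Proof. exact: nbhs_interior. Qed.

Lemma small_factor (c a : R) : 0 <= c -> 0 < a -> exists2 e, 0 < e & e * c < a.
Proof.
move=> c0 a0; exists (a / 2 / (c + 1)); first by rewrite !divr_gt0 // ltr_wpDl.
have c1 : 0 < c + 1 by rewrite ltr_wpDl.
rewrite mulrAC ltr_pdivrMr //.
by rewrite mulrDr mulr1; have := mulr_ge0 (ltW a0) c0; lra.
Qed.

Lemma rE : r = r.-1.+1.
Proof. by rewrite prednK // (ltn_trans _ hr). Qed.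

Lemma S_z0 : S z0. Proof. by case: hz0. Qed.

Lemma chart_to z : S z -> W z -> V (chi z) /\ psi (chi z) = z.
Proof. by case: hchart => _ _ _ [_ _ h _] Sz Wz; apply: h. Qed.

Lemma chart_from y : V y -> [/\ S (psi y), W (psi y) & chi (psi y) = y].
Proof. by case: hchart => _ _ _ [_ _ _ h] /h [[]]. Qed.

Lemma W_z0 : W z0. Proof. by case: hchart. Qed.

Lemma psi_x0 : psi x0 = z0.
Proof. by have [] := chart_to S_z0 W_z0. Qed.

Lemma V_near : \forall y \near x0, V y.
Proof.
case: hchart => _ _ oV _; apply: open_near => //.
by have [] := chart_to S_z0 W_z0.
Qed.

Lemma psi_smooth : CrAt r x0 psi.
Proof.
have [_ _ _ [_ h _ _]] := hchart.
have [g [hg E]] := smooth_germ h (nbhs_singleton V_near).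
apply: CrAt_near_eq hg; apply: filterS2 V_near E => y Vy; exact.
Qed.

Lemma near_psi (P : set 'cV[R]_n) :
  (\forall z \near z0, P z) -> \forall y \near x0, P (psi y).
Proof.
move=> h; apply: (near_comp (CrAt_continuous psi_smooth)).
by rewrite psi_x0.
Qed.

Lemma chi_extension : exists chiE, CrAt r z0 chiE /\
  \forall z \near z0, W z /\ (S z -> chiE z = chi z).
Proof.
have [oW Wz0 _ [h _ _ _]] := hchart.
have [g [hg E]] := smooth_germ h (conj S_z0 Wz0).
exists g; split => //; apply: filterS2 E (open_near oW Wz0) => z H Wz.
by split => // Sz; exact: H.
Qed.

(** [Xh] is the reduced field pushed to the chart. As that field is tangent to S, [tangent_recovery]
    brings it back, so integral curves may be constructed in the chart and carried over by [psi]. *)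
Lemma chart_field : exists (chiE : 'cV[R]_n -> 'cV[R]_k) (Xh : 'cV[R]_k -> 'cV[R]_k),
  [/\ CrAt r z0 chiE, \forall z \near z0, W z /\ (S z -> chiE z = chi z),
      forall i, CrAt r.-1 x0 (fun y => Xh y i 0) &
      \forall y \near x0, [/\ Sn (psi y), differentiable psi y,
         Xh y = Jac chiE (psi y) *m red (psi y) &
         Jac psi y *m Xh y = red (psi y)]].
Proof.
have [chiE [hchi Echi]] := chi_extension.
have [X [hX EX]] := reduced_field_smooth hr hebar hfs hz0.
exists chiE, (fun y => Jac chiE (psi y) *m X (psi y)); split => //.
  move=> i; under eq_fun do rewrite mxE; apply: CrAt_sum => j _.
  have hp l : CrAt r.-1 x0 (fun y => fco (cV_frame n) l (psi y)).
    by apply: CrAt_coord; apply: CrAt_le psi_smooth; rewrite leq_pred.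
  have hJ : CrAt r.-1 (psi x0) (fun z => Jac chiE z i j).
    by rewrite psi_x0; apply: mxAt_Jac; rewrite -rE.
  have hXj : CrAt r.-1 (psi x0) (fun z => X z j 0) by rewrite psi_x0.
  exact: CrAtM (CrAt_comp hp hJ) (CrAt_comp hp hXj).
have Vint := near_interior V_near.
have chint := near_interior (near_psi Echi).
have psm := CrAt_near psi_smooth.
have chsm := near_psi (CrAt_near hchi).
have nSn := near_psi (Snh_near hfs hz0).
have nX := near_psi EX.
near=> y.
have Vy' : \forall y' \near y, V y' by near: y.
have Vy := nbhs_singleton Vy'.
have [Sy Wy cy] := chart_from Vy.
have Sny : Sn (psi y) by move: Sy; near: y; exact: nSn.
have dpsi : differentiable psi y.
  by apply: (@CrAt_differentiable _ _ _ r.-1); rewrite -rE; near: y; exact: psm.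
have dchi : differentiable chiE (psi y).
  by apply: (@CrAt_differentiable _ _ _ r.-1); rewrite -rE; near: y; exact: chsm.
have chy : \forall y' \near y, W (psi y') /\ (S (psi y') -> chiE (psi y') = chi (psi y')).
  by near: y; exact: chint.
have EXy : X (psi y) = red (psi y) by move: Sny; near: y; exact: nX.
(* Near [y], [chiE] after [psi] is the identity and [f] after [psi] vanishes; differentiating both
   supplies the data of [tangent_recovery]. *)
have J1 : Jac chiE (psi y) *m Jac psi y = 1%:M.
  rewrite -Jac_comp // -(Jac_id y); apply: near_eq_Jac.
  apply: filterS2 Vy' chy => y' Vy1 [_ h].
  by have [Sy' _ cy'] := chart_from Vy1; rewrite h.
have J2 : Jac f (psi y) *m Jac psi y = 0.
  rewrite -Jac_comp //; last exact: (f_differentiable hfs).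
  transitivity (Jac (fun=> 0 : 'cV[R]_(n - k)) y).
    apply: near_eq_Jac; apply: filterS Vy' => y' Vy1.
    by have [Sy' _ _] := chart_from Vy1; exact: (f_zero hfs).
  by apply/matrixP => i j; rewrite !mxE derive_cst mxE.
split => //; first by rewrite EXy.
rewrite EXy; apply: (tangent_recovery (ltnW hkn) (fs_Df_rank hfs Sy) J1 J2).
exact: (reduced_tangent _ Sny).
Unshelve. all: by end_near. Qed.

Variables (chiE : 'cV[R]_n -> 'cV[R]_k) (Xh : 'cV[R]_k -> 'cV[R]_k).
Hypothesis hchi : CrAt r z0 chiE.
Hypothesis Echi : \forall z \near z0, W z /\ (S z -> chiE z = chi z).
Hypothesis hXh : forall i, CrAt r.-1 x0 (fun y => Xh y i 0).
Hypothesis EXh : \forall y \near x0, [/\ Sn (psi y), differentiable psi y,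
         Xh y = Jac chiE (psi y) *m red (psi y) &
         Jac psi y *m Xh y = red (psi y)].

(** Slowing time by the factor e turns a curve of X over [0, e] into a curve of e X over [0, 1]. *)
Lemma chart_curve (rho1 tau e M : R) (phi : R -> 'cV[R]_k) :
  (forall y, ball x0 rho1 y -> [/\ Sn (psi y), differentiable psi y &
     Jac psi y *m Xh y = red (psi y)]) ->
  (forall s t, `|phi s - phi t| <= M * `|s - t|) -> 0 <= M ->
  (forall t, 0 <= t <= tau -> ball x0 rho1 (phi t)) ->
  (forall i (t : R), 0 < t < tau -> is_derive t 1 (fun s => phi s i 0) (Xh (phi t) i 0)) ->
  0 <= e < tau ->
  integral_curve Sn (fun z => e *: red z) (fun t => psi (phi (e * t))).
Proof.
move=> hrho pL M0 pin pd /andP[e0 et].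
have pet (t : R) : t \in `[0, 1] -> 0 <= e * t <= tau.
  rewrite in_itv /= => /andP[t0 t1]; rewrite mulr_ge0 //=.
  by rewrite (le_trans _ (ltW et)) // ler_piMr.
have pc : continuous phi.
  move=> t; apply: (frame_continuous (F := cV_frame k)) => i.
  apply: (@lipschitz_coord_continuous _ _ (fun=> 0) M _ phi) => // y.
  by rewrite normr0.
have ec : continuous (fun t : R => e * t).
  by move=> t; apply: cvgM; [exact: cvg_cst|exact: cvg_id].
split.
- by move=> t /pet /pin /hrho [].
- apply: continuous_in_subspaceT => t; rewrite inE => /pet /pin /hrho [_ dp _].
  apply: (@continuous_comp _ _ _ (fun t => phi (e * t)) psi).
    by apply: (@continuous_comp _ _ _ (fun t => e * t) phi); [exact: ec|exact: pc].
  exact: differentiable_continuous.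
move=> t t01; have t01' : t \in `[0, 1].
  by move: t01; rewrite !in_itv /= => /andP[? ?]; rewrite !ltW.
have [_ dp E] := hrho _ (pin _ (pet _ t01')).
pose u s := phi (e * s).
have hu : is_derive t 1 u (e *: Xh (u t)).
  (* For e = 0 the curve is constant; [pd] speaks of positive times only and does not reach this
     case. *)
  move: e0; rewrite le_eqVlt => /predU1P[e0|e0].
    rewrite (_ : u = cst (phi 0)); last by apply/funext => s; rewrite /u -e0 mul0r.
    by rewrite -e0 scale0r; exact: is_derive_cst.
  apply: is_derive_cV => i.
  have ett : 0 < e * t < tau.
    move: t01; rewrite in_itv /= => /andP[t0 t1].
    by rewrite mulr_gt0 //= (lt_trans _ et) // gtr_pMr.
  have [d1 _] := pd i _ ett.
  have dd : differentiable (fun s => phi s i 0) (0 + t *: e).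
    by rewrite add0r [t *: e]mulrC; apply/derivable1_diffP.
  have := is_derive_line dd.
  have -> : (fun s : R => phi (0 + s *: e) i 0) = (fun s => u s i 0).
    by apply/funext => s; rewrite /u add0r [s *: e]mulrC.
  rewrite (_ : 'D_e _ _ = (e *: Xh (u t)) i 0) //.
  rewrite deriveE // -[X in 'd _ _ X](mulr1 e) -[e * 1]/(e *: 1) linearZ /=.
  rewrite -deriveE // mxE add0r [t *: e]mulrC.
  by have [_ ->] := pd i _ ett.
have du : differentiable u t by case: hu => /derivable1_diffP.
have dc := differentiable_comp du dp.
apply: DeriveDef; first exact: diff_derivable.
rewrite [LHS](_ : _ = 'D_1 (psi \o u) t) // deriveE // (diff_comp du dp) /=.
have Eu : 'd u t 1 = e *: Xh (u t) by rewrite -deriveE //; case: hu.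
by rewrite Eu -deriveE // Jac_mul // -scalemxAr E.
Qed.

Definition chart_nbhd (d1 : R) : set 'cV[R]_n := Sn `&` W `&` ball z0 d1.

Lemma chart_flow : exists (e0 d1 : R) (phi : 'cV[R]_k -> R -> 'cV[R]_k),
  [/\ 0 < e0, 0 < d1,
      forall z, chart_nbhd d1 z -> `|chi z - x0| <= 1,
      forall z e, chart_nbhd d1 z -> 0 <= e < e0 ->
        V (phi (chi z) e) /\
        time_one_values Sn (fun z => e *: red z) z = [set psi (phi (chi z) e)] &
      forall T, (forall i, expands r.-1 setT (x0, 0) (fun p => Xh p.1 i 0) (T i)) ->
        exists J, forall i, expands r
          [set p | [/\ V p.1, chart_nbhd d1 (psi p.1) & 0 <= p.2 < e0]]
          (x0, 0) (fun p => phi p.1 p.2 i 0)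
          (xpoly x0 i ++ tint (tzero (T i)) ++ tint (tpos (J i)))].
Proof.
have r1 : (1 <= r.-1)%N by rewrite -ltnS -rE.
have /nbhs_ballP[rho1 /= rho10 hrho1] : \forall y \near x0,
    [/\ Sn (psi y), differentiable psi y & Jac psi y *m Xh y = red (psi y)] /\ V y.
  by apply: filterS2 EXh V_near => y [].
have [d [tau [M [phi [d0 tau0 M0 hphi]]]]] :=
  local_flow rho10 (fun i => CrAt_le r1 (hXh i)).
have [X [hX EX]] := reduced_field_smooth hr hebar hfs hz0.
have [rho [L [rho0 L0 XL]]] := lipschitz_near (fun i => CrAt_le r1 (hX i)).
(* On this ball the smooth ambient field [X] agrees with the reduced field along [Sn], which thereby
   inherits the Lipschitz and size bounds that uniqueness requires. *)
have /nbhs_ballP[ra /= ra0 hra] : \forall z \near z0, ball z0 rho z /\ (Sn z -> X z = red z).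
  by apply: filterI => //; exact: nbhsx_ballx.
pose B := `|X z0| + L * rho.
have B0 : 0 <= B by rewrite addr_ge0 // mulr_ge0 // ltW.
have [e2 e20 e2L] := small_factor L0 (ltr01 : 0 < 1 :> R).
have [e3 e30 e3B] := small_factor B0 (divr_gt0 ra0 (ltr0Sn _ 1)).
(* [d] is the radius on which the local flow is defined; the bound 1 prepares the final e^2
   estimate, which holds in the unit ball. *)
have m0 : 0 < Num.min d 1 by rewrite lt_min d0 ltr01.
have r20 : 0 < ra / 2 by rewrite divr_gt0.
have cchi : \forall z \near z0, S z -> ball x0 (Num.min d 1) (chi z).
  have E0 : chiE z0 = x0 by have [_] := nbhs_singleton Echi; apply; exact: S_z0.
  have : \forall z \near z0, ball x0 (Num.min d 1) (chiE z).
    apply: (near_comp (CrAt_continuous hchi)); rewrite E0; exact: nbhsx_ballx.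
  by apply: filterS2 Echi => z [_ h] + Sz; rewrite h.
have /nbhs_ballP[d1 /= d10 hd1] : \forall z \near z0,
    ball z0 (ra / 2) z /\ (S z -> ball x0 (Num.min d 1) (chi z)).
  by apply: filterI => //; exact: nbhsx_ballx.
have inb z : chart_nbhd d1 z ->
    [/\ S z, W z, ball z0 (ra / 2) z, ball x0 d (chi z) & `|chi z - x0| <= 1].
  move=> [[[Sz _] Wz] /hd1[bz /(_ Sz) bc]]; split => //.
    by move: bc; rewrite -!ball_normE /= lt_min => /andP[].
  by move: bc; rewrite -ball_normE /= lt_min distrC => /andP[_ /ltW].
(* [tau] ensures existence, [e2] uniqueness and [e3] confinement. *)
pose e0 := Num.min tau (Num.min e2 e3).
have e00 : 0 < e0 by rewrite !lt_min tau0 e20.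
exists e0, d1, phi; split => //.
- by move=> z /inb [].
- move=> z e Oz /andP[ep]; rewrite !lt_min => /and3P[et ee2 ee3].
  have [Sz Wz bz bc _] := inb _ Oz.
  have [p0 pL pin pd] := hphi _ bc.
  have etau : 0 <= e < tau by rewrite ep.
  have ic : integral_curve Sn (fun z => e *: red z) (fun t => psi (phi (chi z) (e * t))).
    by apply: (chart_curve _ pL M0 pin pd etau) => y /hrho1 [].
  split.
    have : 0 <= e <= tau by rewrite ep ltW.
    by move=> /pin /hrho1 [].
  have pz : psi (phi (chi z) 0) = z by rewrite p0; have [] := chart_to Sz Wz.
  apply/seteqP; split=> w /=; last first.
    by move=> ->; eexists; split; [exact: ic|rewrite /= mulr0|rewrite /= mulr1].
  move=> [g [ig g0 <-]].
  have XL' w1 w2 : Sn w1 -> Sn w2 -> ball z0 ra w1 -> ball z0 ra w2 ->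
      `|red w1 - red w2| <= L * `|w1 - w2|.
    move=> s1 s2 /hra[b1 /(_ s1) <-] /hra[b2 /(_ s2) <-]; exact: XL.
  have XB w1 : Sn w1 -> ball z0 ra w1 -> `|red w1| <= B.
    move=> s1 /hra[b1 /(_ s1) <-]; rewrite -[X w1](subrK (X z0)) addrC.
    rewrite (le_trans (ler_normD _ _)) // lerD2l.
    rewrite (le_trans (XL _ _ b1 (ballxx z0 rho0))) // ler_wpM2l //.
    by move: b1; rewrite -ball_normE /= distrC => /ltW.
  have eB : e * B < ra / 2 by rewrite (le_lt_trans _ e3B) // ler_wpM2r // ltW.
  have eL : e * L < 1 by rewrite (le_lt_trans _ e2L) // ler_wpM2r // ltW.
  rewrite (curve_unique L0 B0 ep XL' XB eB eL ig ic); first by rewrite mulr1.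
    by rewrite g0 mulr0.
  by rewrite g0.
move=> T hT.
pose D : set ('cV[R]_k * R) := [set p | ball x0 d p.1 /\ 0 <= p.2 <= tau].
have sD : time_star D.
  move=> p [bp /andP[p2 pt]]; split => // s /andP[s0 sp]; split => //=.
  by rewrite s0 (le_trans sp).
have phi0 p : D p -> phi p.1 0 = p.1 by move=> [/hphi []].
have phiL p : D p -> forall s t, `|phi p.1 s - phi p.1 t| <= M * `|s - t|.
  by move=> [/hphi []].
have dphi p : D p -> forall i (s : R), 0 < s < p.2 ->
    is_derive s 1 (fun s => phi p.1 s i 0) (Xh (phi p.1 s) i 0).
  move=> [/hphi [_ _ _ h] /andP[_ pt]] i s /andP[s0 sp]; apply: h.
  by rewrite s0 (lt_le_trans sp).
have [J hJ] := expands_flow M0 hT sD phi0 phiL dphi.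
(* [expands_flow] was run with order r - 1, that of the expansion of the field, and returns order
   r. *)
exists J => i; rewrite {1}rE; apply: expands_near (hJ i).
apply: near_all => -[x e] [/= Vx Ox /andP[ep]]; rewrite !lt_min => /and3P[et _ _].
have [Sx Wx cx] := chart_from Vx.
have [_ _ _ bc _] := inb _ Ox; split => //; split; first by rewrite -cx.
by rewrite /= ep ltW.
Qed.

End Chart.

(** * The slow map *)

Section SlowMap.
Context {R : realType} {n k r : nat}.
Hypothesis hkn : (k < n)%N.
Hypothesis hr : (2 <= r)%N.
Variables (ebar : R) (N : 'cV[R]_n -> 'M[R]_(n, n - k)).
Variables (f : 'cV[R]_n -> 'cV[R]_(n - k)) (G : 'cV[R]_n -> R -> 'cV[R]_n).
Variable S : set 'cV[R]_n.
Hypothesis hebar : 0 < ebar.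
Hypothesis hfs : fast_slow N f G r ebar S.
Variables (St O : set 'cV[R]_n) (e1 : R) (Psi Gs : 'cV[R]_n -> R -> 'cV[R]_n).
Hypothesis hSt : St `<=` Snh N f S.
Hypothesis hPsi : slow_manifold N f G r ebar S St e1 O Psi.
Hypothesis hGs : slow_map N f G r S St e1 O Psi Gs.
Variables (z0 : 'cV[R]_n) (W : set 'cV[R]_n) (V : set 'cV[R]_k).
Variables (chi : 'cV[R]_n -> 'cV[R]_k) (psi : 'cV[R]_k -> 'cV[R]_n).
Hypothesis hz0 : St z0.
Hypothesis hchart : local_chart r S z0 W V chi psi.
Local Notation x0 := (chi z0).
Local Notation red := (reduced_field N f G).
Local Notation Sn := (Snh N f S).
Local Notation F := (@pV_frame R k).
Local Notation expands := (expands (F := F)).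
Variables (chiE : 'cV[R]_n -> 'cV[R]_k) (Xh : 'cV[R]_k -> 'cV[R]_k).
Hypothesis hchi : CrAt r z0 chiE.
Hypothesis Echi : \forall z \near z0, W z /\ (S z -> chiE z = chi z).
Hypothesis EXh : \forall y \near x0, [/\ Sn (psi y), differentiable psi y,
         Xh y = Jac chiE (psi y) *m red (psi y) &
         Jac psi y *m Xh y = red (psi y)].

Lemma e1_gt0 : 0 < e1.
Proof. by have /andP[] := sm_e1 hPsi. Qed.

(** At e = 0 the map [Psi] is the identity and the points of S are fixed by the fast-slow map, so
    the conjugacy leaves no choice. *)
Lemma slow_map_time0 z : St z -> Gs z 0 = z.
Proof.
move=> Sz; have e00 : 0 <= (0 : R) < e1 by rewrite lexx e1_gt0.
have [hO] := slow_conj hGs Sz e00; rewrite (sm_0 hPsi hO).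
rewrite (sm_0 hPsi); last by split; [exact: hSt|exact: (sm_sub hPsi)].
move=> ->; rewrite /fsmap scale0r addr0.
have -> : fast_part N f z = 0 by apply: (fs_S_zero hfs); have [] := hSt Sz.
by rewrite addr0.
Qed.

(** A ball around (x, 0) in the maximum norm contains, with each point at nonnegative time, the
    segment down to time zero. *)
Lemma near_star (x : 'cV[R]_k) (P : set ('cV[R]_k * R)) :
  (\forall p \near (x, 0 : R), P p) ->
  \forall p \near (x, 0 : R), forall s, 0 <= s <= p.2 -> P (p.1, s).
Proof.
move=> /nbhs_ballP[d /= d0 hd]; have := nbhsx_ballx (x, 0 : R) d d0.
apply: filterS => -[y e] ye s /= hs; apply: hd.
move: ye; rewrite -!ball_normE /= !(distrC (x, 0 : R)).
rewrite (_ : (y, e) - (x, 0) = (y - x, e)); last by congr pair; rewrite /= subr0.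
rewrite (_ : (y, s) - (x, 0) = (y - x, s)); last by congr pair; rewrite /= subr0.
exact/le_lt_trans/norm_time_le.
Qed.

(** The asymptotic form yields the right derivative, as the error C e^2 is o(e); the extension [Ge]
    is differentiable from both sides, so this is its derivative. *)
Lemma slow_map_velocity Ge z : St z -> CrAt r (z, 0) Ge ->
  (\forall p \near (z, 0 : R), St p.1 /\ 0 <= p.2 < e1 -> Ge p = Gs p.1 p.2) ->
  is_derive (0 : R) 1 (fun s => Ge (z, s)) (red z).
Proof.
move=> Sz hGe EGe; apply: is_derive_cV => j.
have dGe : differentiable (fun p => Ge p j 0) (z, 0).
  by apply: (@CrAt_differentiable _ _ _ r.-1); rewrite -rE //; exact: CrAt_coord.
have [dt _] := is_derive_time dGe.
apply: DeriveDef => //; apply: derive_right => // eps eps0.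
have [C hC] := slow_asymptotics hGs.
have C1 : 0 < `|C| + 1 by rewrite ltr_wpDl.
have E0 : Ge (z, 0) = z.
  by rewrite (nbhs_singleton EGe) /= ?slow_map_time0 // lexx e1_gt0.
have nE := near_time EGe.
near=> e.
have e0 : 0 < e by near: e; exact: nbhs_right_gt.
have ee1 : e < e1 by near: e; apply: nbhs_right_lt; exact: e1_gt0.
have ee : e < eps / (`|C| + 1) by near: e; apply: nbhs_right_lt; exact: divr_gt0.
have Ee : Ge (z, e) = Gs z e.
  have h : St z /\ 0 <= e < e1 by rewrite ltW.
  by move: h; near: e; exact: nE.
have hCe : `|Gs z e - (z + e *: red z)| <= C * e ^+ 2.
  by move: (z) Sz; near: e; exact: hC.
rewrite Ee E0 (_ : _ - _ = (Gs z e - (z + e *: red z)) j 0); last first.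
  by rewrite !mxE; ring.
rewrite (le_trans (coord_le _ _)) // (le_trans hCe) // expr2 mulrA ler_wpM2r ?(ltW e0) //.
apply: (@le_trans _ _ ((`|C| + 1) * e)).
  by rewrite ler_wpM2r ?(ltW e0) // (le_trans (ler_norm _)) // lerDl.
by rewrite mulrC -ler_pdivlMr // ltW.
Unshelve. all: by end_near. Qed.

(** In the chart the slow map extends to the C^r function [Fi] on a full neighbourhood, whose
    e-derivative is C^(r-1) and is expanded by Taylor's theorem. One integration restores order
    r. *)
Lemma slow_map_expansion T :
  (forall i, expands r.-1 setT (x0, 0) (fun p => Xh p.1 i 0) (T i)) ->
  exists J, forall i, expands r
    [set p | [/\ V p.1, St (psi p.1) & 0 <= p.2 < e1]] (x0, 0)
    (fun p => chi (Gs (psi p.1) p.2) i 0)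
    (xpoly x0 i ++ tint (tzero (T i)) ++ tint (tpos (J i))).
Proof.
move=> hT; set D := [set p | _].
have hS0 : Sn z0 := hSt hz0.
have A0 : [set p : 'cV[R]_n * R | St p.1 /\ 0 <= p.2 < e1] (z0, 0).
  by rewrite /= lexx e1_gt0.
have [Ge [hGe EGe]] := smooth_germ (slow_smooth hGs) A0.
have Ge0 : Ge (z0, 0) = z0 by rewrite (nbhs_singleton EGe) //= slow_map_time0.
pose inn (p : 'cV[R]_k * R) : 'cV[R]_n * R := (psi p.1, p.2).
have p0 : psi x0 = z0 := psi_x0 hS0 hchart.
have hpsi := psi_smooth hS0 hchart.
have hinn j : CrAt r (x0, 0 : R) (fun p => fco (pV_frame n) j (inn p)).
  case: j => [j|] /=; last first.
    exact: (@CrAt_fco _ _ F r _ None).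
  apply: (CrAt_comp (F := cV_frame k) (f := fun y => psi y j 0) (g := fst)) => /=.
    by move=> i; exact: (@CrAt_fco _ _ F r _ (Some i)).
  exact: CrAt_coord.
have hGi j : CrAt r (x0, 0 : R) (fun p => fco (cV_frame n) j (Ge (inn p))).
  apply: (CrAt_comp (F := pV_frame n) (f := fun q => Ge q j 0) (g := inn)) => //.
  by rewrite /inn /= p0; exact: CrAt_coord.
pose Fi i p := chiE (Ge (inn p)) i 0.
have hFi i : CrAt r (x0, 0 : R) (Fi i).
  apply: (CrAt_comp (F := cV_frame n) (f := fun q => chiE q i 0) (g := fun p => Ge (inn p))) => //.
  by rewrite /inn /= p0 Ge0; exact: CrAt_coord.
have cinn : {for (x0, 0 : R), continuous inn}.
  by apply: (frame_continuous (F := pV_frame n)) => j; exact: CrAt_continuous (hinn j).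
have cGi : {for (x0, 0 : R), continuous (fun p => Ge (inn p))}.
  by apply: (frame_continuous (F := cV_frame n)) => j; exact: CrAt_continuous (hGi j).
have near_inn (P : set ('cV[R]_n * R)) : (\forall q \near (z0, 0 : R), P q) ->
    \forall p \near (x0, 0 : R), P (inn p).
  by move=> h; apply: (near_comp cinn); rewrite /inn /= p0.
have sD : time_star D.
  move=> p [Vp Sp /andP[p2 pe]]; split => // s /andP[s0 sp]; split => //=.
  by rewrite s0 (le_lt_trans sp).
(* The conjugacy puts the value of the slow map in S, where [chiE] agrees with the chart. *)
have EF : \forall p \near (x0, 0 : R), D p -> forall i, Fi i p = chi (Gs (psi p.1) p.2) i 0.
  have h1 := near_inn _ EGe.
  have h2 : \forall p \near (x0, 0 : R),
      W (Ge (inn p)) /\ (S (Ge (inn p)) -> chiE (Ge (inn p)) = chi (Ge (inn p))).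
    apply: (near_comp cGi (P := fun z => W z /\ (S z -> chiE z = chi z))).
    by rewrite /inn /= p0 Ge0.
  apply: filterS2 h1 h2 => p h1 [_ h2] [Vp Sp pe] i.
  have E : Ge (inn p) = Gs (psi p.1) p.2 by apply: h1.
  rewrite /Fi h2 E //; have [[[]]] := slow_conj hGs Sp pe.
  by [].
have hJ i : exists J, expands r.-1 D (x0, 0) (fun p => 'D_(0, 1) (Fi i) p) J.
  have [J hJ] : exists J, expands r.-1 setT (x0, 0) (fun p => 'D_(0, 1) (Fi i) p) J.
    by apply: taylor; apply: CrAt_derive; rewrite -rE.
  by exists J; apply: expands_near hJ; exact: near_all.
have {hJ}[J hJ] := choice hJ.
exists J => i.
(* At e = 0 the chain rule gives the derivative of [chiE] applied to the reduced field, which is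
   [Xh]. *)
have hvel : \forall p \near (x0, 0 : R), D p -> 'D_(0, 1) (Fi i) (p.1, 0) = Xh p.1 i 0.
  have h1 : \forall p \near (x0, 0 : R), CrAt r p (Fi i) by exact: (CrAt_near (hFi i)).
  have h2 : \forall q \near (z0, 0 : R), CrAt r q Ge /\
     \forall q' \near q, St q'.1 /\ 0 <= q'.2 < e1 -> Ge q' = Gs q'.1 q'.2.
    by apply: filterI; [exact: (CrAt_near hGe)|exact: (near_interior EGe)].
  have {}h2 := near_star (near_inn _ h2).
  have {}h1 := near_star h1.
  have h3 : \forall p \near (x0, 0 : R), CrAt r (psi p.1) chiE /\ Sn (psi p.1) /\
     Xh p.1 = Jac chiE (psi p.1) *m red (psi p.1).
    have c1 : {for (x0, 0 : R), continuous (@fst 'cV[R]_k R)} by exact: cvg_fst.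
    apply: (near_comp c1 (P := fun y => CrAt r (psi y) chiE /\ Sn (psi y) /\
       Xh y = Jac chiE (psi y) *m red (psi y))).
    apply: filterS2 (near_psi hS0 hchart (CrAt_near hchi)) EXh => y ? [? _ ? _].
    by split.
  apply: filterS3 h1 h2 h3 => p h1 h2 [hc [hSn EX]] [Vp Sp /andP[p2 _]].
  have s0 : 0 <= (0 : R) <= p.2 by rewrite lexx.
  have {h2}[hGp EGp] := h2 0 s0; rewrite /inn /= in hGp EGp.
  have dFi : differentiable (Fi i) (p.1, 0).
    by apply: (@CrAt_differentiable _ _ _ r.-1); rewrite -rE //; exact: h1.
  have [_ <-] := is_derive_time dFi.
  pose u s := Ge (psi p.1, s).
  have hu : is_derive (0 : R) 1 u (red (psi p.1)) by exact: slow_map_velocity.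
  have u0 : u 0 = psi p.1.
    by rewrite /u (nbhs_singleton EGp) /= ?slow_map_time0 // lexx e1_gt0.
  have du : differentiable u 0 by case: hu => /derivable1_diffP.
  have dchi : differentiable chiE (u 0).
    by apply: (@CrAt_differentiable _ _ _ r.-1); rewrite -rE // u0.
  have dcu : differentiable (chiE \o u) 0 := differentiable_comp du dchi.
  rewrite [LHS](_ : _ = 'D_1 (fun s => (chiE \o u) s i 0) 0) // derive_coord //.
  rewrite deriveE // (diff_comp du dchi) /=.
  have -> : 'd u 0 1 = red (psi p.1) by rewrite -deriveE //; case: hu.
  by rewrite -deriveE // Jac_mul // u0 EX.
have hmain : expands r.-1.+1 D (x0, 0) (Fi i)
    (xpoly x0 i ++ tint (tzero (T i)) ++ tint (tpos (J i))).
  apply: (expands_velocity (H := fun p => 'D_(0, 1) (Fi i) p) (X := fun x => Xh x i 0) sD) => //.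
  - have h1 := near_star (CrAt_near (hFi i)).
    apply: filterS h1 => p h1 [Vp Sp /andP[p2 _]].
    have dF s : 0 <= s <= p.2 ->
        is_derive s 1 (fun s => Fi i (p.1, s)) ('D_(0, 1) (Fi i) (p.1, s)).
      move=> hs; apply: is_derive_time.
      by apply: (@CrAt_differentiable _ _ _ r.-1); rewrite -rE //; exact: h1.
    split.
      apply: derivable_within_continuous => s; rewrite in_itv /= => /dF [+ _]; exact.
    by move=> s /andP[s0 s1]; apply: dF; rewrite !ltW.
  - apply: expands_near (hT i); exact: near_all.
  - exact: xpoly_time.
  apply: expands_near (expands_xpoly r.-1.+1 setT x0 i).
  have EF0 := near_star EF.
  apply: filterS EF0 => p EFp Dp; split => //.
  have [Vp Sp /andP[p2 _]] := Dp; have s0 : 0 <= (0 : R) <= p.2 by rewrite lexx.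
  have D0 : D (p.1, 0) by have [_] := sD _ Dp; apply.
  rewrite (EFp 0 s0 D0) /= slow_map_time0 //.
  by have [_ _ ->] := chart_from hchart Vp.
rewrite {1}(rE hr); apply: expands_near hmain.
by apply: filterS EF => p EFp Dp; split => //; exact: EFp.
Qed.

End SlowMap.

Theorem theorem2p13 (R : realType) (n k r : nat)
    (hn : (2 <= n)%N) (hk : (0 < k)%N) (hkn : (k < n)%N) (hr : (2 <= r)%N)
    (ebar : R) (hebar : 0 < ebar)
    (N : 'cV[R]_n -> 'M[R]_(n, n - k)) (f : 'cV[R]_n -> 'cV[R]_(n - k))
    (G : 'cV[R]_n -> R -> 'cV[R]_n) (S : set 'cV[R]_n)
    (hfs : fast_slow N f G r ebar S)
    (St : set 'cV[R]_n) (hSt : St `<=` Snh N f S)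
    (hStm : submanifold_with_boundary k r St)
    (hStc : compact St) (hStconn : connected St)
    (e1 : R) (O : set 'cV[R]_n) (Psi Gs : 'cV[R]_n -> R -> 'cV[R]_n)
    (hPsi : slow_manifold N f G r ebar S St e1 O Psi)
    (hGs : slow_map N f G r S St e1 O Psi Gs)
    (z0 : 'cV[R]_n) (hz0 : St z0)
    (W : set 'cV[R]_n) (V : set 'cV[R]_k)
    (chi : 'cV[R]_n -> 'cV[R]_k) (psi : 'cV[R]_k -> 'cV[R]_n)
    (hchart : local_chart r S z0 W V chi psi) :
  let X (e : R) (z : 'cV[R]_n) := e *: reduced_field N f G z in
  let Phi (z : 'cV[R]_n) (e : R) := time_one_map (Snh N f S) (X e) z in
  exists (e0 : R) (Omega : set 'cV[R]_n),
    [/\ 0 < e0 <= e1,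
        Omega z0 /\ Omega `<=` Snh N f S `&` W,
        (exists B : set 'cV[R]_n,
           [/\ open B, B z0 & Snh N f S `&` B `<=` Omega]),
        (forall (z : 'cV[R]_n) (e : R), Omega z -> 0 <= e < e0 ->
           time_one_values (Snh N f S) (X e) z = [set Phi z e]) &
        (exists cG cPhi : jet R k 1,
           [/\ is_local_jet V chi psi St e1 Gs z0 cG,
               is_local_jet V chi psi Omega e0 Phi z0 cPhi &
               forall (z : 'cV[R]_n) (e : R), Omega z -> 0 <= e < e0 ->
                 jet_eval cG (chi z - chi z0, e)
                 = jet_eval cPhi (chi z - chi z0, e)]) /\
        (forall l : nat, (2 <= l <= r)%N ->
         exists cG cPhi : jet R k l,
           [/\ is_local_jet V chi psi St e1 Gs z0 cG,
               is_local_jet V chi psi Omega e0 Phi z0 cPhi &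
               exists C : R, forall (z : 'cV[R]_n) (e : R), Omega z -> 0 <= e < e0 ->
                 `|jet_eval cG (chi z - chi z0, e)
                   - jet_eval cPhi (chi z - chi z0, e)| <= C * e ^+ 2])].
Proof.
move=> X Phi; have hS0 : Snh N f S z0 := hSt _ hz0.
have [chiE [Xh [hchi Echi hXh EXh]]] := chart_field hkn hr hebar hfs hS0 hchart.
have hT i : exists T, expands (F := pV_frame k) r.-1 setT (chi z0, 0) (fun p => Xh p.1 i 0) T.
  apply: taylor; apply: (CrAt_comp (F := cV_frame k) (f := fun y => Xh y i 0) (g := fst)) => //= j.
  exact: (@CrAt_fco _ _ (pV_frame k) r.-1 _ (Some j)).
have {hT}[T hT] := choice hT.
have [JG hJG] := slow_map_expansion hr hfs hSt hPsi hGs hz0 hchart hchi Echi EXh hT.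
have [e2 [d1 [phi [e20 d10 hO1 hval hJ]]]] :=
  chart_flow hr hebar hfs hS0 hchart hchi Echi hXh EXh.
have {hJ}[JP hJP] := hJ T hT.
have e10 := e1_gt0 hPsi.
(* The bound 1 keeps the arguments of the jets in the unit ball, where the e^2 estimate holds; [e1]
   comes from the slow map and [e2] from the flow. *)
pose e0 := Num.min (Num.min e1 1) e2.
have e00 : 0 < e0 by rewrite /e0 !lt_min e10 ltr01.
have e0e1 : e0 <= e1 by rewrite /e0 !ge_min lexx.
have e0lt e : e < e0 -> e < e2 /\ e < 1 by rewrite /e0 !lt_min => /andP[/andP[_ ->] ->].
pose Omega := chart_nbhd N f S z0 W d1.
have EPhi z e : Omega z -> 0 <= e < e0 -> V (phi (chi z) e) /\
    Phi z e = psi (phi (chi z) e) /\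
    time_one_values (Snh N f S) (X e) z = [set Phi z e].
  move=> Oz /andP[ep /e0lt[ee2 _]].
  have ee : 0 <= e < e2 by rewrite ep.
  have [Vp E] := hval z e Oz ee; split => //.
  have EP : Phi z e = psi (phi (chi z) e).
    (* [xget] picks from a singleton; its default [z] is excluded because the set is nonempty. *)
    rewrite /Phi /time_one_map; case: xgetP => [w _|/(_ (psi (phi (chi z) e)))].
      by rewrite E => ->.
    by rewrite E => /(_ erefl).
  by split => //; rewrite EP.
(* Initial position and initial velocity: the part common to both maps, literally the same list
   because both expansions were built on one [T]. *)
pose B i := xpoly (chi z0) i ++ tint (tzero (T i)).
have hPhi i : expands (F := pV_frame k) r
    [set p | [/\ V p.1, Omega (psi p.1) & 0 <= p.2 < e0]] (chi z0, 0)
    (fun p => chi (Phi (psi p.1) p.2) i 0)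
    (B i ++ tint (tpos (JP i))).
  rewrite -catA; apply: expands_near (hJP i); apply: near_all => -[x e] [/= Vx Ox ee].
  have /andP[ep /e0lt[ee2 _]] := ee.
  have [Vp [-> _]] := EPhi _ _ Ox ee.
  have [_ _ cx] := chart_from hchart Vx; rewrite cx in Vp *.
  by have [_ _ ->] := chart_from hchart Vp; split => //; split => //; rewrite ep.
have hG i : expands (F := pV_frame k) r
    [set p | [/\ V p.1, St (psi p.1) & 0 <= p.2 < e1]] (chi z0, 0)
    (fun p => chi (Gs (psi p.1) p.2) i 0) (B i ++ tint (tpos (JG i))).
  by rewrite -catA; exact: hJG i.
have jets l (lr : (l <= r)%N) := jets_agree lr (fun i => order2_tint_tpos (JG i))
  (fun i => order2_tint_tpos (JP i)) hG hPhi.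
exists e0, Omega; split.
- by rewrite e00.
- split; last by move=> z [].
  by split; [split => //; exact: (W_z0 hchart)|exact: ballxx].
- exists (W `&` ball z0 d1); split; last by move=> z [? []].
    by apply: openI; [case: hchart|exact: ball_open].
  by split; [exact: (W_z0 hchart)|exact: ballxx].
- by move=> z e Oz ee; have [_ []] := EPhi _ _ Oz ee.
have p1 z e : Omega z -> 0 <= e < e0 -> `|(chi z - chi z0, e)| <= 1.
  move=> /hO1 cz /andP[ep /e0lt[_ ee1]].
  by rewrite [leLHS]/Num.norm /= ge_max cz ger0_norm // ltW.
split.
  have [cG [cP [jG jP h1 _]]] := jets 1%N (ltnW hr).
  by exists cG, cP; split => // z e _ _; exact: h1.
move=> l /andP[_ lr]; have [cG [cP [jG jP _ [C hC]]]] := jets l lr.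
exists cG, cP; split => //; exists C => z e Oz ee.
exact: (hC _ (p1 _ _ Oz ee)).
Qed.
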